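(* Let $n\ge1$ and $\alpha\in(0,1)$. If $f\in W^{\alpha,1}(\mathbb R^n)$, then $f\in BV^\alpha(\mathbb R^n)$ with $$|D^\alpha f|(\mathbb R^n)\le\mu_{n,\alpha}\,[f]_{W^{\alpha,1}(\mathbb R^n)}$$ and $$\int_{\mathbb R^n}f\,\mathrm{div}^\alpha\varphi\,dx=-\int_{\mathbb R^n}\varphi\cdot\nabla^\alpha f\,dx$$ for all $\varphi\in\mathrm{Lip}_c(\mathbb R^n;\mathbb R^n)$, so that $D^\alpha f=\nabla^\alpha f\,\mathscr L^n$. Moreover, if $f\in BV(\mathbb R^n)$, then $f\in W^{\alpha,1}(\mathbb R^n)$ for every $\alpha\in(0,1)$, with $$\|f\|_{W^{\alpha,1}(\mathbb R^n)}\le c_{n,\alpha}\|f\|_{BV(\mathbb R^n)}$$ for some constant $c_{n,\alpha}>0$ depending only on $n$ and $\alpha$, and $$\nabla^\alpha f(x)=\frac{\mu_{n,\alpha}}{n+\alpha-1}\int_{\mathbb R^n}\frac{dDf(y)}{|y-x|^{n+\alpha-1}}$$ for $\mathscr L^n$-a.e. $x\in\mathbb R^n$.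
   Context: $\mathscr L^n$ is Lebesgue measure and $\mathrm{Lip}_c(\mathbb R^n;\mathbb R^n)$ is the space of Lipschitz vector fields with compact support. For $\alpha\in(0,1)$ let $\mu_{n,\alpha}:=2^\alpha\pi^{-n/2}\,\Gamma\big(\tfrac{n+\alpha+1}{2}\big)/\Gamma\big(\tfrac{1-\alpha}{2}\big)$. For $\varphi\in\mathrm{Lip}_c(\mathbb R^n;\mathbb R^n)$, $$\mathrm{div}^\alpha\varphi(x):=\mu_{n,\alpha}\int_{\mathbb R^n}\frac{(y-x)\cdot(\varphi(y)-\varphi(x))}{|y-x|^{n+\alpha+1}}\,dy,$$ a function in $L^1(\mathbb R^n)\cap L^\infty(\mathbb R^n)$. $W^{\alpha,1}(\mathbb R^n)$ is the space of $f\in L^1(\mathbb R^n)$ with $[f]_{W^{\alpha,1}(\mathbb R^n)}:=\int_{\mathbb R^n}\int_{\mathbb R^n}\frac{|f(x)-f(y)|}{|x-y|^{n+\alpha}}\,dx\,dy<+\infty$, with norm $\|f\|_{W^{\alpha,1}}:=\|f\|_{L^1}+[f]_{W^{\alpha,1}}$. For $f\in W^{\alpha,1}(\mathbb R^n)$, the fractional $\alpha$-gradient $$\nabla^\alpha f(x):=\mu_{n,\alpha}\int_{\mathbb R^n}\frac{(y-x)(f(y)-f(x))}{|y-x|^{n+\alpha+1}}\,dy$$ is well defined (absolutely convergent integral) for $\mathscr L^n$-a.e. $x$. $BV^\alpha(\mathbb R^n)$ is the space of $f\in L^1(\mathbb R^n)$ with $$|D^\alpha f|(\mathbb R^n):=\sup\Big\{\int_{\mathbb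 R^n}f\,\mathrm{div}^\alpha\varphi\,dx:\ \varphi\in C^\infty_c(\mathbb R^n;\mathbb R^n),\ \|\varphi\|_{L^\infty}\le1\Big\}<+\infty.$$ For $f\in BV^\alpha(\mathbb R^n)$, $D^\alpha f$ denotes the unique finite $\mathbb R^n$-valued Radon measure with $\int_{\mathbb R^n} f\,\mathrm{div}^\alpha\varphi\,dx=-\int_{\mathbb R^n}\varphi\cdot dD^\alpha f$ for all $\varphi\in C^\infty_c(\mathbb R^n;\mathbb R^n)$. $BV(\mathbb R^n)$ is the usual space of functions of bounded variation, $Df$ the distributional gradient measure, $\|f\|_{BV}:=\|f\|_{L^1}+|Df|(\mathbb R^n)$. *)

(* Defs.v *)
From HB Require Import structures.
From mathcomp Require Import all_boot all_order all_algebra.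
From mathcomp Require Import all_classical all_reals all_analysis.

Set Implicit Arguments.
Unset Strict Implicit.
Unset Printing Implicit Defensive.

Import Order.TTheory GRing.Theory Num.Theory.
Import numFieldNormedType.Exports.

Local Open Scope classical_set_scope.
Local Open Scope ring_scope.

(* The space R^n is ['rV[R]_n], with its library topology. The library norm on
   it is the sup norm, so the Euclidean norm is introduced as [enorm] below. *)

(* The sigma-algebra generated by the coordinates, as the library does for
   [n.-tuple T]; it is the Borel sigma-algebra of R^n. *)
Definition measure_rV_display : measure_display -> measure_display.
Proof. exact. Qed.

Section measurable_rV.
Context {R : realType} (n : nat).

Definition rV_coord (i : 'I_n) (x : 'rV[R]_n) : R := x ord0 i.

Let rV_set0 : g_sigma_preimage rV_coord set0.
Proof. exact: sigma_algebra0. Qed.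

Let rV_setC A : g_sigma_preimage rV_coord A -> g_sigma_preimage rV_coord (~` A).
Proof. exact: sigma_algebraC. Qed.

Let rV_bigcup (F : _^nat) : (forall i, g_sigma_preimage rV_coord (F i)) ->
  g_sigma_preimage rV_coord (\bigcup_i (F i)).
Proof. exact: sigma_algebra_bigcup. Qed.

HB.instance Definition _ := @isMeasurable.Build (measure_rV_display default_measure_display)
  'rV[R]_n (g_sigma_preimage rV_coord) rV_set0 rV_setC rV_bigcup.

Lemma measurable_rV_coord (i : 'I_n) : measurable_fun [set: 'rV[R]_n] (rV_coord i).
Proof.
move=> _ Y mY; rewrite setTI; apply: sub_sigma_algebra => /=.
rewrite -bigcup_seq/=; exists i => /=; first by rewrite mem_index_enum.
by exists Y => //; rewrite setTI.
Qed.

Lemma measurable_fun_rVP d (T : measurableType d) (f : T -> 'rV[R]_n) :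
  (forall i, measurable_fun setT (rV_coord i \o f)) -> measurable_fun setT f.
Proof.
move=> mf.
suff H : g_sigma_preimage rV_coord `<=` [set A | measurable (f @^-1` A)].
  by move=> _ A mA; rewrite setTI; exact: H.
apply: smallest_sub.
  split => //=.
  - by rewrite preimage_set0.
  - by move=> A mA; rewrite setTD preimage_setC; exact: measurableC.
  - by move=> F mF; rewrite preimage_bigcup; exact: bigcup_measurable.
move=> A; rewrite -bigcup_seq/= => -[i _ [B mB <-]].
by rewrite /= setTI -comp_preimage -[X in measurable X]setTI; exact: mf.
Qed.

End measurable_rV.

Definition rV_cons {R : realType} (n : nat) (p : measurableTypeR R * 'rV[R]_n) :
  'rV[R]_n.+1 := \row_j oapp (fun k => p.2 ord0 k) (p.1 : R) (unlift ord0 j).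

Definition rV_uncons {R : realType} (n : nat) (x : 'rV[R]_n.+1) :
  measurableTypeR R * 'rV[R]_n := (x ord0 ord0, \row_j x ord0 (lift ord0 j)).

Lemma rV_consK {R : realType} n : cancel (@rV_cons R n) (@rV_uncons R n).
Proof.
move=> [a v]; rewrite /rV_uncons /rV_cons; congr pair.
  by rewrite mxE unlift_none.
by apply/rowP => j; rewrite !mxE liftK.
Qed.

Lemma measurable_rV_cons {R : realType} n : measurable_fun setT (@rV_cons R n).
Proof.
apply: measurable_fun_rVP => i.
rewrite (_ : _ \o _ =
  fun p : measurableTypeR R * 'rV[R]_n =>
    oapp (fun k => p.2 ord0 k) (p.1 : R) (unlift ord0 i)); last first.
  by apply/funext => p; rewrite /rV_coord /= mxE.
case: unliftP => [j|] _ /=; last exact: measurable_fst.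
exact: (measurableT_comp (measurable_rV_coord j) measurable_snd).
Qed.

Lemma measurable_rV_uncons {R : realType} n : measurable_fun setT (@rV_uncons R n).
Proof.
apply/measurable_fun_pairP; split; first exact: (measurable_rV_coord ord0).
apply: measurable_fun_rVP => i.
rewrite (_ : _ \o _ = rV_coord (lift ord0 i)); first exact: measurable_rV_coord.
by apply/funext => x; rewrite /rV_coord /= mxE.
Qed.

Section lebesgue_step.
Context {R : realType} (n : nat) (m : {sigma_finite_measure set 'rV[R]_n -> \bar R}).
Local Open Scope ereal_scope.

Definition lebesgue_step : set 'rV[R]_n.+1 -> \bar R :=
  pushforward (lebesgue_measure \x m) (@rV_cons R n).

Let mpre A : measurable A -> measurable (@rV_cons R n @^-1` A).
Proof. by move=> mA; rewrite -[X in measurable X]setTI; exact: measurable_rV_cons. Qed.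

Let step0 : lebesgue_step set0 = 0.
Proof. by rewrite /lebesgue_step /pushforward preimage_set0 measure0. Qed.

Let step_ge0 A : 0 <= lebesgue_step A.
Proof. by rewrite /lebesgue_step /pushforward; exact: measure_ge0. Qed.

Let step_sigma_additive : semi_sigma_additive lebesgue_step.
Proof.
move=> F mF tF mUF; rewrite /lebesgue_step /pushforward preimage_bigcup.
apply: measure_semi_sigma_additive.
- by move=> k; exact: mpre.
- apply/trivIsetP => /= i j _ _ ij; rewrite -preimage_setI.
  by move/trivIsetP : tF => /(_ _ _ _ _ ij) ->//; rewrite preimage_set0.
- by rewrite -preimage_bigcup; exact: mpre.
Qed.

HB.instance Definition _ := isMeasure.Build _ _ _ lebesgue_step
  step0 step_ge0 step_sigma_additive.

Let step_sigma_finite : sigma_finite setT lebesgue_step.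
Proof.
have /sigma_finiteP[F [TF ndF Foo]] := sigma_finiteT (@lebesgue_measure R).
have /sigma_finiteP[G [TG ndG Goo]] := sigma_finiteT m.
exists (fun k => @rV_uncons R n @^-1` (F k `*` G k)).
  rewrite -preimage_bigcup predeqE => x; split => // _; rewrite /preimage/=.
  have [i _ Fi] : (\bigcup_i F i) (rV_uncons x).1 by rewrite -TF.
  have [j _ Gj] : (\bigcup_j G j) (rV_uncons x).2 by rewrite -TG.
  exists (maxn i j) => //; split.
  - by move: Fi; exact/subsetPset/ndF/leq_maxl.
  - by move: Gj; exact/subsetPset/ndG/leq_maxr.
move=> k; have [mF Fk] := Foo k; have [mG Gk] := Goo k; split.
  rewrite -[X in measurable X]setTI; apply: measurable_rV_uncons => //.
  exact: measurableX.
rewrite /lebesgue_step /pushforward -comp_preimage.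
rewrite (_ : _ \o _ = id) ?preimage_id//.
  by rewrite product_measure1E// lte_mul_pinfty// ge0_fin_numE.
by apply/funext => p; exact: rV_consK.
Qed.

HB.instance Definition _ := Measure_isSigmaFinite.Build _ _ _ lebesgue_step
  step_sigma_finite.

End lebesgue_step.

(* n-dimensional Lebesgue measure, as an iterated product *)
Fixpoint lebesgue_rV (R : realType) (n : nat) :
    {sigma_finite_measure set 'rV[R]_n -> \bar R} :=
  match n with
  | 0 => \d_(0 : 'rV[R]_0)
  | n'.+1 => lebesgue_step (lebesgue_rV R n')
  end.

Lemma lebesgue_rV_box (R : realType) (n : nat) (a b : 'rV[R]_n) :
  (forall i, a ord0 i <= b ord0 i) ->
  lebesgue_rV R n [set x : 'rV[R]_n | forall i, a ord0 i <= x ord0 i <= b ord0 i] =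
  (\prod_i (b ord0 i - a ord0 i))%:E.
Proof.
elim: n a b => [|n IH] a b ab.
  by rewrite big_ord0 /= diracE mem_set// => -[].
rewrite [LHS]/= /lebesgue_step /pushforward.
set A := _ @^-1` _.
pose B : set 'rV[R]_n :=
  [set x | forall i, (rV_uncons a).2 ord0 i <= x ord0 i <= (rV_uncons b).2 ord0 i].
have -> : A = (`[a ord0 ord0, b ord0 ord0]%classic : set (measurableTypeR R)) `*` B.
  apply/seteqP; split => -[t v] /=; rewrite /A /=.
    move=> H; split; first by have := H ord0; rewrite !mxE unlift_none/= in_itv.
    by move=> i; have := H (lift ord0 i); rewrite !mxE liftK.
  move=> [+ H] i; rewrite in_itv/= => H0; rewrite !mxE.
  by case: unliftP => [j|] -> //=; have := H j; rewrite !mxE.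
rewrite product_measure1E//; last first.
  rewrite (_ : B = \big[setI/setT]_(i < n)
     (rV_coord i @^-1` `[(rV_uncons a).2 ord0 i, (rV_uncons b).2 ord0 i])).
    apply: bigsetI_measurable => i _; rewrite -[X in measurable X]setTI.
    exact: measurable_rV_coord.
  apply/seteqP; split => x /=.
    by move=> H; rewrite -bigcap_seq => i _ /=; rewrite in_itv/=; exact: H.
  rewrite -bigcap_seq => H i; have := H i; rewrite /= in_itv/=; apply.
  by rewrite mem_index_enum.
rewrite IH; last by move=> i; rewrite !mxE.
have leb1 : lebesgue_measure (`[a ord0 ord0, b ord0 ord0]%classic : set (measurableTypeR R)) =
    (b ord0 ord0 - a ord0 ord0)%:E.
  rewrite (lebesgue_measure_itv `[a ord0 ord0, b ord0 ord0])/= lte_fin.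
  case: ltP => [_|ba]; first by rewrite EFinB.
  by rewrite (_ : b ord0 ord0 = a ord0 ord0) ?subrr//; apply/eqP; rewrite eq_le ba ab.
apply: etrans (congr1 (fun z => z * _)%E leb1) _.
rewrite -EFinM big_ord_recl; congr (_ * _)%:E.
by apply: eq_bigr => i _; rewrite !mxE.
Qed.

Section charge_integral.
Context d (T : measurableType d) (R : realType).

(* Integral with respect to a finite signed measure. The Jordan decomposition
   does not depend on the Hahn decomposition chosen here. *)
Definition charge_integral (nu : {charge set T -> \bar R}) (g : T -> \bar R) :
    \bar R :=
  let hahnPN := projT2 (cid (projT2 (cid (Hahn_decomposition nu)))) in
  (\int[jordan_pos hahnPN]_x g x - \int[jordan_neg hahnPN]_x g x)%E.

End charge_integral.

Section fractional.
Context {R : realType} {n : nat}.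

Local Notation Rn := 'rV[R]_n.
Local Notation leb := (lebesgue_rV R n).
Implicit Types (f : Rn -> R) (phi : Rn -> Rn) (alpha : R).

Definition dotr (u v : Rn) : R := \sum_i u ord0 i * v ord0 i.

Definition enorm (u : Rn) : R := Num.sqrt (dotr u u).

Definition compact_support phi : Prop := compact (closure [set x | phi x != 0]).

Definition Lip_c phi : Prop :=
  (exists L : R, forall x y, enorm (phi x - phi y) <= L * enorm (x - y)) /\
  compact_support phi.

Definition partial (i : 'I_n) phi : Rn -> Rn := 'D_(delta_mx ord0 i) phi.

(* all partial derivatives up to order k exist and are continuous *)
Fixpoint class_C (k : nat) phi : Prop :=
  continuous phi /\
  match k with
  | 0 => True
  | k'.+1 => forall i : 'I_n,
      (forall x, derivable phi x (delta_mx ord0 i)) /\ class_C k' (partial i phi)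
  end.

Definition Cinfty_c phi : Prop := (forall k, class_C k phi) /\ compact_support phi.

Definition Linfty_norm phi : \bar R := 'N[leb]_+oo[EFin \o (enorm \o phi)].

Definition divergence phi (x : Rn) : R := \sum_i partial i phi x ord0 i.

Definition Gamma (s : R) : R :=
  \int[lebesgue_measure]_(t in `]0%R, +oo[) (t `^ (s - 1) * expR (- t)).

Definition frac_const alpha : R :=
  2 `^ alpha * pi `^ (- (n%:R / 2)) *
  Gamma ((n%:R + alpha + 1) / 2) / Gamma ((1 - alpha) / 2).

Definition frac_div alpha phi (x : Rn) : R :=
  frac_const alpha *
  \int[leb]_y (dotr (y - x) (phi y - phi x) / enorm (y - x) `^ (n%:R + alpha + 1)).

Definition frac_grad alpha f (x : Rn) : Rn :=
  \row_i (frac_const alpha *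
    \int[leb]_y ((y - x) ord0 i * (f y - f x) / enorm (y - x) `^ (n%:R + alpha + 1))).

(* The measurable functions are the Borel ones: every L^1 class has a Borel
   representative. *)
Definition in_L1 f : Prop := leb.-integrable setT (EFin \o f).

Definition L1_norm f : \bar R := 'N[leb]_1[EFin \o f].

Definition W_seminorm alpha f : \bar R :=
  (\int[leb]_y \int[leb]_x (`|f x - f y| / enorm (x - y) `^ (n%:R + alpha))%:E)%E.

Definition in_W alpha f : Prop := in_L1 f /\ (W_seminorm alpha f < +oo)%E.

Definition W_norm alpha f : \bar R := (L1_norm f + W_seminorm alpha f)%E.

Definition variation_for (diver : (Rn -> Rn) -> Rn -> R) f : \bar R :=
  ereal_sup [set (\int[leb]_x (f x * diver phi x)%:E)%E |
    phi in [set phi | Cinfty_c phi /\ (Linfty_norm phi <= 1)%E]].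

Definition frac_variation alpha f : \bar R := variation_for (frac_div alpha) f.

Definition in_BValpha alpha f : Prop := in_L1 f /\ (frac_variation alpha f < +oo)%E.

Definition variation f : \bar R := variation_for divergence f.

Definition in_BV f : Prop := in_L1 f /\ (variation f < +oo)%E.

Definition BV_norm f : \bar R := (L1_norm f + variation f)%E.

(* A finite R^n-valued Radon measure is given by its n components, which are
   finite signed Borel measures. *)
Definition vector_measure := 'I_n -> {charge set Rn -> \bar R}.

Definition is_gradient_measure_for (diver : (Rn -> Rn) -> Rn -> R) f
    (D : vector_measure) : Prop :=
  forall phi, Cinfty_c phi ->
    (\int[leb]_x (f x * diver phi x)%:E =
     - \sum_i charge_integral (D i) (fun x => (phi x ord0 i)%:E))%E.

(* [is_frac_gradient_measure alpha f D] states that [D] is D^alpha f. *)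
Definition is_frac_gradient_measure alpha f (D : vector_measure) : Prop :=
  is_gradient_measure_for (frac_div alpha) f D.

(* [is_gradient_measure f D] states that [D] is the distributional gradient Df. *)
Definition is_gradient_measure f (D : vector_measure) : Prop :=
  is_gradient_measure_for divergence f D.

End fractional.

Arguments frac_const {R} n alpha.
Arguments vector_measure : clear implicits.

(* Main.v *)
Require Import Defs.
From mathcomp Require Import all_boot all_order all_algebra.
From mathcomp Require Import all_classical all_reals all_analysis.
From mathcomp Require Import measurable_realfun ess_sup_inf.
From mathcomp Require Import ring lra.

(** Let K_p(z) = |z|^-p and q = n + alpha. Dyadic shells show that K_p is integrable near 0 for
    p < n and near infinity for p > n, so a function of h bounded by C |h| and by C is integrable
    against K_q.

    For f in W^{alpha,1} and phi Lipschitz and bounded, Fubini, translation invariance and the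
    oddness of z |z|^-(q+1) move the difference quotient from phi to f; this is the integration by
    parts, and with Cauchy-Schwarz it bounds the variation. D^alpha f is identified because finite
    combinations of products of one-dimensional bumps approximate every Borel set with respect to
    a finite measure.

    For f in BV, testing the variation with difference quotients of primitives of such combinations
    gives |f(. + h) - f|_1 <= C |h| |Df|, hence the bound of the W^{alpha,1} norm. The formula for
    the gradient comes from testing Df with y |-> G_m(y - x), where G_m are smooth truncations of
    K_{q-1} whose partial derivatives are odd, dominated by C K_q and converge to those of K_{q-1}:
    dominated convergence applies on both sides for almost every x. *)

Import Order.TTheory GRing.Theory Num.Theory.
Import numFieldNormedType.Exports.

Local Open Scope classical_set_scope.
Local Open Scope ring_scope.

Set Implicit Arguments.
Unset Strict Implicit.
Unset Printing Implicit Defensive.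

(** The variation is a supremum over smooth fields, and [Df] is known only through pairings with
    them, so each estimate has to come from an admissible compactly supported field. For the
    translation estimate, f(x) - f(x + s e_i) is paired with a test function u; a change of variable
    turns this into f against u - u(. - s e_i), the i-th derivative of P - P(. - s e_i), where P is
    a primitive of u along e_i. This difference has compact support although P need not, and it is
    at most |s| if |u| <= 1: hence the factor |s| |Df|. Tensor products are chosen because their
    primitive along an axis is again a tensor product.

    For the gradient formula, the i-th derivative of |z|^-(q-1) is -(q-1) z_i |z|^-(q+1), the origin
    of 1/(n + alpha - 1). The limit kernel is of order |z|^-q with q > n, too singular to be paired
    with f itself. The truncated derivatives are odd and have integral zero, so f(x) can be
    subtracted before the limit; the integrands are then dominated by C |f(x + z) - f(x)| K_q(z),
    integrable for almost every x. *)

Section measure_rV.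
Context {R : realType} {n : nat}.
Local Notation Rn := 'rV[R]_n.
Local Notation leb := (lebesgue_rV R n).

(** Rays ]t, +oo[ generate the Borel sets of the line and every generator on R^n is a preimage under
    one coordinate, so open half-spaces generate. This reduces statements on all Borel sets to
    half-spaces. *)
Lemma measurable_rV_ind (S : set (set Rn)) : sigma_algebra setT S ->
  (forall i t, S ([set x : Rn | t < x ord0 i] : set Rn)) -> forall A, measurable A -> S A.
Proof.
move=> sS hS; apply: smallest_sub => // A.
rewrite -bigcup_seq/= => -[i _ [B mB <-]]; rewrite setTI.
have : (@RGenOInfty.G R).-sigma.-measurable B.
  by rewrite -RGenOInfty.measurableE.
move: B {mB}; apply: (@smallest_sub _ (sigma_algebra setT) _
   [set B | S (rV_coord i @^-1` B)]).
  case: sS => S0 SC SU; split => /=.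
  - by rewrite preimage_set0.
  - by move=> B SB; rewrite setTD preimage_setC -setTD; exact: SC.
  - by move=> F SF; rewrite preimage_bigcup; exact: SU.
move=> _ [t ->] /=; suff -> : rV_coord i @^-1` `]t, +oo[ = ([set x : Rn | t < x ord0 i] : set Rn).
  exact: hS.
by apply/seteqP; split => x /=; rewrite in_itv/= andbT.
Qed.

(** * Boxes as a generating pi-system, and invariance of Lebesgue measure *)

Definition rV_box (a b : Rn) : set Rn :=
  [set x | forall i, a ord0 i <= x ord0 i <= b ord0 i].

Lemma rV_boxI a b c d : rV_box a b `&` rV_box c d =
  rV_box (\row_i Num.max (a ord0 i) (c ord0 i)) (\row_i Num.min (b ord0 i) (d ord0 i)).
Proof.
apply/seteqP; split => x /=.
  move=> [h1 h2] i; rewrite !mxE ge_max le_min.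
  by have /andP[-> ->] := h1 i; have /andP[-> ->] := h2 i.
move=> h; split=> i; have := h i; rewrite !mxE ge_max le_min => /andP[/andP[? ?] /andP[? ?]];
  exact/andP.
Qed.

Lemma measurable_rV_box a b : measurable (rV_box a b).
Proof.
rewrite (_ : rV_box a b = \big[setI/setT]_(i < n)
     (rV_coord i @^-1` `[a ord0 i, b ord0 i])).
  apply: bigsetI_measurable => i _; rewrite -[X in measurable X]setTI.
  exact: measurable_rV_coord.
apply/seteqP; split => x /=.
  by move=> H; rewrite -bigcap_seq => i _ /=; rewrite in_itv/=; exact: H.
rewrite -bigcap_seq => H i; have := H i; rewrite /= in_itv/=; apply.
by rewrite mem_index_enum.
Qed.

Lemma rV_box_exhaust (x : Rn) : exists k : nat, forall j, `|x ord0 j| <= k%:R.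
Proof.
have h i : exists k : nat, `|x ord0 i| <= k%:R.
  by exists (Num.Def.trunc `|x ord0 i|).+1; rewrite ltW// truncnS_gt.
have [k hk] := choice h.
exists (\max_i k i)%N => j; apply: (le_trans (hk j)).
by rewrite ler_nat; apply: (@leq_bigmax_cond _ xpredT k j).
Qed.

(** The form of the sigma-algebra that uniqueness of measures asks for. An open half-space is the
    union of boxes whose i-th side is [t + 1/(k+1), k] and whose other sides are [-k, k]. *)
Lemma measurable_rV_boxE :
  (measurable : set (set Rn)) = <<s [set rV_box ab.1 ab.2 | ab in setT] >>.
Proof.
apply/seteqP; split; last first.
  apply: smallest_sub; first exact: sigma_algebra_measurable.
  by move=> _ [ab _ <-]; exact: measurable_rV_box.
apply: measurable_rV_ind; first exact: smallest_sigma_algebra.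
move=> i t; set S := <<s _ >>.
pose c k : Rn := \row_j (if j == i then t + k.+1%:R^-1 else - k%:R).
rewrite (_ : ([set x : Rn | t < x ord0 i] : set Rn) = \bigcup_k (rV_box (c k) (\row_j k%:R))); last first.
  apply/seteqP; split => x /=.
    move=> tx; have [k hk] := ltr_add_invr tx; have [m hm] := rV_box_exhaust x.
    exists (maxn k m) => // j; rewrite !mxE; apply/andP; split; last first.
      apply: (le_trans (ler_norm _)); apply: (le_trans (hm j)).
      by rewrite ler_nat leq_maxr.
    case: eqP => [->|_]; last first.
      rewrite lerNl; apply: (@le_trans _ _ m%:R); last by rewrite ler_nat leq_maxr.
      by apply: le_trans (hm j); rewrite -normrN ler_norm.
    apply: le_trans (ltW hk); rewrite lerD2l lef_pV2 ?posrE ?ltr0n// ler_nat ltnS.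
    exact: leq_maxl.
  move=> [k _ /(_ i)]; rewrite !mxE eqxx => /andP[+ _]; apply: lt_le_trans.
  by rewrite ltrDl invr_gt0 ltr0n.
have [_ _] := smallest_sigma_algebra setT [set rV_box ab.1 ab.2 | ab in setT].
apply => k; apply: sub_sigma_algebra; by exists (c k, \row_j k%:R).
Qed.

Lemma rV_box_eq0 (a b : Rn) i : b ord0 i < a ord0 i -> rV_box a b = set0.
Proof.
move=> ba; apply/seteqP; split => // x /(_ i) /andP[h1 h2].
by have := le_lt_trans (le_trans h1 h2) ba; rewrite ltxx.
Qed.

Lemma leb_box_fin a b : (leb (rV_box a b) < +oo)%E.
Proof.
have [h|] := pselect (forall i, a ord0 i <= b ord0 i).
  by rewrite lebesgue_rV_box// ltry.
move=> /existsNP[i /negP]; rewrite -ltNge => /rV_box_eq0 ->.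
by rewrite measure0.
Qed.

(** Uniqueness of measures on a pi-system, with the cubes [-k, k]^n as exhaustion by sets of finite
    measure. Boxes with reversed ends are empty, so testing ordered corners is enough. *)
Lemma leb_ext (m : {measure set Rn -> \bar R}) :
  (forall a b : Rn, (forall i, a ord0 i <= b ord0 i) ->
     m (rV_box a b) = (\prod_i (b ord0 i - a ord0 i))%:E) ->
  forall A, measurable A -> m A = leb A.
Proof.
move=> mE A mA.
have E (B : set Rn) : [set rV_box ab.1 ab.2 | ab in setT] B -> m B = leb B.
  move=> [[a b] _ <-] /=.
  have [h|] := pselect (forall i, a ord0 i <= b ord0 i).
    by rewrite lebesgue_rV_box// mE.
  move=> /existsNP[i /negP]; rewrite -ltNge => /rV_box_eq0 ->.
  by rewrite !measure0.
pose g k := rV_box (\row_j (- k%:R : R)) (\row_j (k%:R : R)).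
apply: (@measure_unique _ _ _ _ g measurable_rV_boxE) => //.
- move=> _ _ [[a b] _ <-] [[c d] _ <-]; rewrite rV_boxI.
  by eexists (_, _).
- by move=> k; eexists (_, _).
- apply/seteqP; split => // x _; have [k hk] := rV_box_exhaust x.
  by exists k => // j; rewrite !mxE; have := hk j; rewrite ler_norml.
- by move=> k; rewrite E ?leb_box_fin//; eexists (_, _).
Qed.

Lemma measurable_rVD (c : Rn) : measurable_fun setT (fun x : Rn => x + c).
Proof.
apply: measurable_fun_rVP => i.
rewrite (_ : _ \o _ = fun x => rV_coord i x + c ord0 i).
  by apply: measurable_funD => //; exact: measurable_rV_coord.
by apply/funext => x; rewrite /rV_coord /= mxE.
Qed.

Lemma measurable_rVN : measurable_fun setT (fun x : Rn => - x).
Proof.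
apply: measurable_fun_rVP => i.
rewrite (_ : _ \o _ = fun x => - rV_coord i x).
  by apply: measurableT_comp => //; exact: measurable_rV_coord.
by apply/funext => x; rewrite /rV_coord /= mxE.
Qed.

Lemma leb_shift (c : Rn) A : measurable A ->
  pushforward leb (fun x : Rn => x + c) A = leb A.
Proof.
move=> mA.
(* Naming the canonical instance bundles the push-forward as a measure, so that [leb_ext] applies to
   it. *)
pose m : {measure set Rn -> \bar R} :=
  @measure_function_pushforward__canonical__measure_function_Measure _ _ _ _ _ leb _ (measurable_rVD c).
apply: (@leb_ext m) => // a b ab.
have -> : m (rV_box a b) = leb (rV_box (a - c) (b - c)).
  congr (leb _); apply/seteqP; split => x /= h i; have := h i; rewrite !mxE.
    by rewrite lerBlDr lerBrDr.
  by rewrite lerBlDr lerBrDr.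
rewrite lebesgue_rV_box => [|i]; last by rewrite !mxE lerD2r.
by congr EFin; apply: eq_bigr => i _; rewrite !mxE; ring.
Qed.

Lemma leb_opp A : measurable A -> pushforward leb (fun x : Rn => - x) A = leb A.
Proof.
move=> mA.
pose m : {measure set Rn -> \bar R} :=
  @measure_function_pushforward__canonical__measure_function_Measure _ _ _ _ _ leb _ measurable_rVN.
apply: (@leb_ext m) => // a b ab.
have -> : m (rV_box a b) = leb (rV_box (- b) (- a)).
  congr (leb _); apply/seteqP; split => x /= h i; have := h i; rewrite !mxE.
    by rewrite lerNl (lerNr _ (x ord0 i)) andbC.
  by rewrite lerNl (lerNr _ (x ord0 i)) andbC.
rewrite lebesgue_rV_box => [|i]; last by rewrite !mxE lerN2.
by congr EFin; apply: eq_bigr => i _; rewrite !mxE; ring.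
Qed.

End measure_rV.

(** * Integrals under translations and reflection *)

Section integral_rV.
Context {R : realType} {n : nat}.
Local Notation Rn := 'rV[R]_n.
Local Notation leb := (lebesgue_rV R n).
Implicit Types (f : Rn -> \bar R) (c : Rn).
Local Open Scope ereal_scope.

Lemma ge0_integral_leb_comp (T : Rn -> Rn) f : measurable_fun setT T ->
  (forall A, measurable A -> pushforward leb T A = leb A) ->
  measurable_fun setT f -> (forall x, 0 <= f x) ->
  \int[leb]_x f (T x) = \int[leb]_x f x.
Proof.
move=> mT TE mf f0.
rewrite -[LHS](ge0_integral_pushforward mT leb measurableT mf)//.
pose m : {measure set Rn -> \bar R} :=
  @measure_function_pushforward__canonical__measure_function_Measure _ _ _ _ _ leb _ mT.
by apply: (@eq_measure_integral _ _ _ _ leb m) => A mA _; exact: TE.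
Qed.

Lemma integral_leb_comp (T : Rn -> Rn) f : measurable_fun setT T ->
  (forall A, measurable A -> pushforward leb T A = leb A) ->
  measurable_fun setT f ->
  \int[leb]_x f (T x) = \int[leb]_x f x.
Proof.
move=> mT TE mf; rewrite integralE [RHS]integralE; congr (_ - _).
  rewrite -(ge0_integral_leb_comp mT TE (measurable_funepos mf))//; apply: eq_integral => x _.
  by rewrite -[RHS]/((f^\+ \o T) x) -funepos_comp.
rewrite -(ge0_integral_leb_comp mT TE (measurable_funeneg mf))//; apply: eq_integral => x _.
  by rewrite -[RHS]/((f^\- \o T) x) -funeneg_comp.
Qed.

Lemma integrable_leb_comp (T : Rn -> Rn) f : measurable_fun setT T ->
  (forall A, measurable A -> pushforward leb T A = leb A) ->
  leb.-integrable setT f -> leb.-integrable setT (fun x => f (T x)).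
Proof.
move=> mT TE /integrableP[mf fi]; apply/integrableP; split.
  exact: measurableT_comp.
rewrite (@ge0_integral_leb_comp T (fun x => `|f x|))//.
exact: measurableT_comp.
Qed.

Lemma ge0_integral_shift c f : measurable_fun setT f -> (forall x, 0 <= f x) ->
  \int[leb]_x f (x + c)%R = \int[leb]_x f x.
Proof. exact: (ge0_integral_leb_comp (measurable_rVD c) (@leb_shift _ _ c)). Qed.

Lemma integral_shift c f : measurable_fun setT f ->
  \int[leb]_x f (x + c)%R = \int[leb]_x f x.
Proof. exact: (integral_leb_comp (measurable_rVD c) (@leb_shift _ _ c)). Qed.

Lemma integrable_shift c f : leb.-integrable setT f ->
  leb.-integrable setT (fun x => f (x + c)%R).
Proof. exact: (integrable_leb_comp (measurable_rVD c) (@leb_shift _ _ c)). Qed.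

Lemma ge0_integral_reflect f : measurable_fun setT f -> (forall x, 0 <= f x) ->
  \int[leb]_x f (- x)%R = \int[leb]_x f x.
Proof. exact: (ge0_integral_leb_comp measurable_rVN (@leb_opp _ _)). Qed.

Lemma integral_reflect f : measurable_fun setT f ->
  \int[leb]_x f (- x)%R = \int[leb]_x f x.
Proof. exact: (integral_leb_comp measurable_rVN (@leb_opp _ _)). Qed.

End integral_rV.

Section open_measurable.
Context {R : realType} {n : nat}.
Local Notation Rn := 'rV[R]_n.

(** The sigma-algebra is generated by coordinates, so open sets must be shown to belong to it: an
    open set is the union of the countably many rational boxes that it contains, enumerated by
    [pickle]. *)
Lemma open_rV_measurable (U : set Rn) : open U -> measurable U.
Proof.
move=> oU.
pose B (q : 'rV[rat]_n) (m : nat) : set Rn :=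
  rV_box (\row_i (ratr (q ord0 i) - m.+1%:R^-1)) (\row_i (ratr (q ord0 i) + m.+1%:R^-1)).
pose F k : set Rn := if @unpickle ('rV[rat]_n * nat)%type k is Some (q, m) then
  (if `[< B q m `<=` U >] then B q m else set0) else set0.
suff -> : U = \bigcup_k F k.
  apply: bigcup_measurable => k _; rewrite /F.
  case: (unpickle k) => [[q m]|]; last exact: measurable0.
  by case: asboolP => _; [exact: measurable_rV_box|exact: measurable0].
apply/seteqP; split => x; last first.
  move=> [k _]; rewrite /F; case: (unpickle k) => [[q m]|] //.
  by case: asboolP => // + Bx; exact.
move=> Ux; have : nbhs x U by exact: open_nbhs_nbhs.
rewrite -nbhs_ballE => -[e /= e0 eU].
(* Half the radius, because [x] and [y] are each compared with the rational centre of the box. *)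
have /ltr_add_invr[m] : 0 < e / 2 by rewrite divr_gt0.
rewrite add0r => me.
have m0 : 0 < m.+1%:R^-1 :> R by rewrite invr_gt0 ltr0n.
have [d dE] : exists d, d = m.+1%:R^-1 :> R by eexists.
rewrite -dE in me m0; have h i : exists r : rat, `|ratr r - x ord0 i| < d.
  have : x ord0 i - d < x ord0 i + d by lra.
  move=> /rat_in_itvoo[r]; rewrite in_itv/= => /andP[h1 h2]; exists r.
  by rewrite ltr_norml; apply/andP; split; lra.
have [q hq] := choice h.
exists (pickle (\row_i q i, m)) => //; rewrite /F pickleK.
have Bx : B (\row_i q i) m x.
  move=> i; rewrite !mxE -dE; have := hq i; rewrite ltr_norml => /andP[h1 h2].
  by apply/andP; split; lra.
case: asboolP => // -[] y By; apply: eU; split=> // i j; rewrite ord1.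
rewrite /ball /= ltr_norml; have := By j; have := Bx j; rewrite !mxE -dE.
by move=> /andP[? ?] /andP[? ?]; apply/andP; split; lra.
Qed.

Lemma continuous_rV_measurable (f : Rn -> R) : continuous f -> measurable_fun setT f.
Proof.
move=> cf; apply: (measurability (@RGenOInfty.G R)).
  exact: RGenOInfty.measurableE.
move=> _ [_ [t ->] <-]; rewrite setTI; apply: open_rV_measurable.
by apply: open_comp => // x _; exact: cf.
Qed.

End open_measurable.

Section euclid.
Context {R : realType} {n : nat}.
Local Notation Rn := 'rV[R]_n.
Implicit Types x y z : Rn.

Lemma dotr_ge0 x : 0 <= dotr x x.
Proof. by apply: sumr_ge0 => i _; rewrite -expr2 sqr_ge0. Qed.

Lemma enorm_ge0 x : 0 <= enorm x.
Proof. exact: sqrtr_ge0. Qed.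

Lemma enorm_sqr x : enorm x ^+ 2 = dotr x x.
Proof. by rewrite sqr_sqrtr// dotr_ge0. Qed.

Lemma enormN x : enorm (- x) = enorm x.
Proof. by congr Num.sqrt; apply: eq_bigr => i _; rewrite mxE mulrNN. Qed.

Lemma enormZ (a : R) x : enorm (a *: x) = `|a| * enorm x.
Proof.
rewrite /enorm -sqrtr_sqr -sqrtrM ?sqr_ge0//; congr Num.sqrt.
by rewrite /dotr mulr_sumr; apply: eq_bigr => i _; rewrite !mxE; ring.
Qed.

Lemma enorm_delta (i : 'I_n) : enorm (delta_mx ord0 i : Rn) = 1.
Proof.
rewrite /enorm /dotr (bigD1 i)//= big1 ?addr0.
  by rewrite !mxE !eqxx mulr1 sqrtr1.
by move=> j ji; rewrite !mxE (negbTE ji) andbF mulr0.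
Qed.

Lemma enorm0 : enorm (0 : Rn) = 0.
Proof. by rewrite -(scale0r (0 : Rn)) enormZ normr0 mul0r. Qed.

Lemma coord_le_enorm x i : `|x ord0 i| <= enorm x.
Proof.
rewrite -sqrtr_sqr ler_sqrt ?dotr_ge0// /dotr (bigD1 i)//= -expr2 lerDl.
by apply: sumr_ge0 => j _; rewrite -expr2 sqr_ge0.
Qed.

Lemma enorm_eq0 x : (enorm x == 0) = (x == 0).
Proof.
apply/eqP/eqP => [x0|->]; last exact: enorm0.
apply/rowP => i; rewrite mxE; apply/eqP; rewrite -normr_le0 -x0.
exact: coord_le_enorm.
Qed.

Lemma enorm_gt0 x : (0 < enorm x) = (x != 0).
Proof. by rewrite lt_neqAle enorm_ge0 andbT eq_sym enorm_eq0. Qed.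

Lemma enorm_le_sum x : enorm x <= \sum_i `|x ord0 i|.
Proof.
have h : 0 <= \sum_i `|x ord0 i| by exact: sumr_ge0.
rewrite -(ger0_norm h) -sqrtr_sqr ler_sqrt ?sqr_ge0// expr2 mulr_suml.
apply: ler_sum => i _; rewrite -expr2 -real_normK ?num_real// expr2.
apply: ler_wpM2l => //; rewrite (bigD1 i)//= lerDl.
exact: sumr_ge0.
Qed.

(* Nonnegativity of the quadratic |y|^2 |x|^2 - (x.y)^2 via |(y.y) x - (x.y) y|^2. *)
Lemma dotr_CS x y : `|dotr x y| <= enorm x * enorm y.
Proof.
have [->|y0] := eqVneq y 0.
  rewrite enorm0 mulr0 /dotr big1 ?normr0// => i _; by rewrite mxE mulr0.
have yy : 0 < dotr y y by rewrite -enorm_sqr exprn_gt0// enorm_gt0.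
rewrite -sqrtrM ?dotr_ge0// -sqrtr_sqr ler_sqrt ?mulr_ge0 ?dotr_ge0//.
have : 0 <= dotr (dotr y y *: x - dotr x y *: y) (dotr y y *: x - dotr x y *: y).
  exact: dotr_ge0.
have -> : dotr (dotr y y *: x - dotr x y *: y) (dotr y y *: x - dotr x y *: y) =
   dotr y y * (dotr x x * dotr y y - dotr x y ^+ 2).
  transitivity (\sum_i (dotr y y ^+ 2 * (x ord0 i * x ord0 i)
      - (dotr y y * dotr x y *+ 2) * (x ord0 i * y ord0 i)
      + dotr x y ^+ 2 * (y ord0 i * y ord0 i))).
    by apply: eq_bigr => i _; rewrite !mxE; ring.
  rewrite big_split sumrB/= -!mulr_sumr -/(dotr x x) -/(dotr x y) -/(dotr y y).
  ring.
by rewrite pmulr_rge0// subr_ge0.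
Qed.

Lemma measurable_dotr d (T : measurableType d) (f g : T -> Rn) :
  measurable_fun setT f -> measurable_fun setT g ->
  measurable_fun setT (fun t => dotr (f t) (g t)).
Proof.
move=> mf mg; apply: measurable_sum => i; apply: measurable_funM.
  exact: (measurableT_comp (measurable_rV_coord i) mf).
exact: (measurableT_comp (measurable_rV_coord i) mg).
Qed.

Lemma measurable_enorm d (T : measurableType d) (f : T -> Rn) :
  measurable_fun setT f -> measurable_fun setT (fun t => enorm (f t)).
Proof.
move=> mf; apply: (measurableT_comp (continuous_measurable_fun (@sqrt_continuous R))) => //.
exact: measurable_dotr.
Qed.

End euclid.

(** * Integrability of the power kernels *)

Section kernels.
Context {R : realType} {n : nat}.
Local Notation Rn := 'rV[R]_n.
Local Notation leb := (lebesgue_rV R n).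

Definition rV_cube (r : R) : set Rn := rV_box (\row_i - r) (\row_i r).

Lemma rV_cubeP r x : rV_cube r x <-> (forall i, `|x ord0 i| <= r).
Proof.
by split=> h i; have := h i; rewrite ?mxE ler_norml// => ->.
Qed.

Lemma measurable_rV_cube r : measurable (rV_cube r).
Proof. exact: measurable_rV_box. Qed.

Lemma leb_cube r : 0 <= r -> leb (rV_cube r) = ((2 * r) ^+ n)%:E.
Proof.
move=> r0; rewrite lebesgue_rV_box => [|i]; last by rewrite !mxE; lra.
rewrite (eq_bigr (fun=> 2 * r)); first by rewrite prodr_const card_ord.
by move=> i _; rewrite !mxE; ring.
Qed.

(** On [D], [g] is below the sum over k of c_k times the indicator of the cube of radius rho_k,
    since a single term already dominates it. Integrating term by term leaves a geometric series;
    the cubes may overlap. *)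
Lemma integral_shells (g : Rn -> R) (D : set Rn) (c rho : nat -> R) (a r : R) :
  measurable D -> measurable_fun D g -> (forall x, D x -> 0 <= g x) ->
  0 <= a -> 0 < r < 1 -> (forall k, 0 <= c k) -> (forall k, 0 <= rho k) ->
  (forall k, c k * (2 * rho k) ^+ n <= a * r ^+ k) ->
  (forall x, D x -> exists2 k, g x <= c k & rV_cube (rho k) x) ->
  (\int[leb]_(x in D) (g x)%:E <= (a / (1 - r))%:E)%E.
Proof.
move=> mD mg g0 a0 /andP[r0 r1] c0 rho0 hc hD.
pose u k x : \bar R := (c k * \1_(rV_cube (rho k)) x)%:E.
have u0 k x : (0 <= u k x)%E by rewrite lee_fin mulr_ge0.
have mu k : measurable_fun setT (u k).
  apply/measurable_EFinP; apply: measurable_funM => //.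
  by apply/measurable_indicP; exact: measurable_rV_cube.
have Iu k : (\int[leb]_x u k x <= (a * r ^+ k)%:E)%E.
  rewrite /u; under eq_integral do rewrite EFinM.
  rewrite ge0_integralZl_EFin//; last first.
    by apply/measurable_EFinP/measurable_indicP; exact: measurable_rV_cube.
  have -> : (\int[leb]_x (\1_(rV_cube (rho k)) x)%:E = ((2 * rho k) ^+ n)%:E)%E.
    rewrite integral_indic//; last exact: measurable_rV_cube.
    by rewrite setIT; exact: leb_cube.
  by rewrite -EFinM lee_fin.
apply: (@le_trans _ _ (\int[leb]_(x in D) \sum_(k <oo) u k x)%E).
  apply: ge0_le_integral => //.
  - exact/measurable_EFinP.
  - apply: measurable_funTS; apply: ge0_emeasurable_sum => // k x _ _; exact: u0.
  - move=> x Dx; have [k gk xk] := hD x Dx.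
    apply: (@le_trans _ _ (\sum_(0 <= i < k.+1) u i x)%E); last first.
      by apply: nneseries_lim_ge => // i _ _; exact: u0.
    rewrite big_nat_recr//=; apply: (@le_trans _ _ (u k x)).
      by rewrite /u indicE mem_set// mulr1 lee_fin.
    by rewrite leeDr// sume_ge0.
apply: (@le_trans _ _ (\int[leb]_x \sum_(k <oo) u k x)%E).
  apply: ge0_subset_integral => //.
    by apply: ge0_emeasurable_sum => // k x _ _; exact: u0.
  by move=> x _; apply: nneseries_ge0.
rewrite integral_nneseries//.
apply: lime_le; first by apply: is_cvg_nneseries => k _ _; exact: integral_ge0.
apply: nearW => N; rewrite big_mkord.
apply: (@le_trans _ _ (\sum_(k < N) (a * r ^+ k)%:E)%E); first by apply: lee_sum => k _.
rewrite sumEFin lee_fin -(big_mkord xpredT (fun k => a * r ^+ k)).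
apply: (@geometric_le_lim R N a r) => //.
by rewrite ger0_norm// ltW.
Qed.

(** For nonzero p the conventions for powers of 0 and for the inverse of 0 give the value 0 at the
    origin, so that identities such as [kernel_decomp] have no exceptional point. *)
Definition kernel (p : R) (x : Rn) : R := (enorm x `^ p)^-1.

Lemma measurable_kernel p : measurable_fun setT (kernel p).
Proof.
rewrite /kernel; under eq_fun do rewrite -powRN.
apply: (measurableT_comp (measurable_powR (- p))).
exact: (@measurable_enorm _ _ _ _ id).
Qed.

Lemma kernel_ge0 p x : 0 <= kernel p x.
Proof. by rewrite invr_ge0 powR_ge0. Qed.

Lemma kernelN p x : kernel p (- x) = kernel p x.
Proof. by rewrite /kernel enormN. Qed.

Lemma kernel_le p x r : 0 <= p -> 0 < r -> r <= enorm x -> kernel p x <= r `^ (- p).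
Proof.
move=> p0 r0 rx; rewrite powRN lef_pV2 ?posrE ?powR_gt0 ?(lt_le_trans r0)//.
by apply: ge0_ler_powR => //; rewrite nnegrE ?enorm_ge0// ltW.
Qed.

Let pow2 (k : nat) : (2 : R) ^- k = 2 `^ (- k%:R).
Proof. by rewrite powR_invn. Qed.

(** Where the sup norm lies in ]2^-(k+1), 2^-k], the kernel is at most 2^(p(k+1)), and the cube of
    radius 2^-k has volume 2^(n - kn). The product is 2^(p+n) 2^((p-n)k), summable because p < n. *)
Lemma kernel_int_near (p : R) : 0 < p < n%:R ->
  (\int[leb]_(x in rV_cube 1) (kernel p x)%:E < +oo)%E.
Proof.
move=> /andP[p0 pn].
have r01 : 0 < (2 : R) `^ (p - n%:R) < 1.
  rewrite powR_gt0//= -[ltRHS](powRr0 2) /powR gt_eqF// ltr_expR mul0r.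
  by rewrite nmulr_rlt0 ?ln_gt0 ?ltr1n// subr_lt0.
have h := @integral_shells (kernel p) (rV_cube 1) (fun k => 2 `^ (p * k.+1%:R))
  (fun k => 2 `^ (- k%:R)) (2 `^ (p + n%:R)) (2 `^ (p - n%:R)).
apply: le_lt_trans (h _ _ _ _ r01 _ _ _ _) _; rewrite ?ltry//.
- exact: measurable_rV_cube.
- apply: measurable_funTS; exact: measurable_kernel.
- by move=> x _; exact: kernel_ge0.
- move=> k; rewrite -(@powR_mulrn _ _ n) ?mulr_ge0 ?powR_ge0//.
  rewrite powRM ?powR_ge0// -powRrM mulrA -powRD ?pnatr_eq0 ?implybT//.
  rewrite -powRD ?pnatr_eq0 ?implybT// -[in leRHS]powR_mulrn ?powR_ge0//.
  rewrite -powRrM -powRD ?pnatr_eq0 ?implybT//.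
  by rewrite le_eqVlt; apply/orP; left; apply/eqP; congr powR; rewrite -natr1; ring.
move=> x /rV_cubeP x1; have [->|x0] := eqVneq x 0.
  exists 0%N; last by apply/rV_cubeP => i; rewrite mxE normr0 powR_ge0.
  by rewrite /kernel enorm0 powR0 ?gt_eqF// invr0 powR_ge0.
have [i xi0] : exists i, x ord0 i != 0.
  apply/existsP; apply: contraT => /existsPn h0; case/eqP: x0.
  by apply/rowP => i; rewrite mxE; apply/eqP; have := h0 i; rewrite negbK.
pose P k := [exists i, (2 : R) `^ (- k.+1%:R) < `|x ord0 i|].
have exP : exists k, P k.
  exists (Num.Def.trunc `|x ord0 i|^-1).+1; apply/existsP; exists i.
  rewrite -pow2; set m := (Num.Def.trunc _).+1; rewrite -[ltRHS]invrK ltf_pV2 ?posrE ?invr_gt0 ?normr_gt0//.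
    apply: (@lt_trans _ _ (m%:R : R)); first exact: truncnS_gt. 
    by rewrite -natrX ltr_nat (ltn_trans (ltnSn m))// ltn_expl.
(* The least k with a coordinate above 2^-(k+1): minimality puts all coordinates below 2^-k, and for
   k = 0 this is membership in the unit cube. *)
exists (ex_minn exP); case: ex_minnP => k /existsP[j kj] kmin.
  rewrite mulrC; have := @kernel_le p x _ (ltW p0) (powR_gt0 _ _) (ltW (lt_le_trans kj (coord_le_enorm x j))).
  rewrite -powRrM mulrNN; exact.
apply/rV_cubeP => l; case: k kmin {kj} => [|k] kmin; first by rewrite oppr0 powRr0.
rewrite leNgt; apply/negP => h1.
have : P k by apply/existsP; exists l.
by move=> /kmin; rewrite ltnn.
Qed.

(** The same scheme with 2^k < sup norm <= 2^(k+1): the terms are 2^(2n) 2^((n-p)k), summable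
    because p > n. *)
Lemma kernel_int_far (p : R) : n%:R < p ->
  (\int[leb]_(x in ~` rV_cube 1) (kernel p x)%:E < +oo)%E.
Proof.
move=> pn; have p0 : 0 < p by apply: le_lt_trans pn.
have r01 : 0 < (2 : R) `^ (n%:R - p) < 1.
  rewrite powR_gt0//= -[ltRHS](powRr0 2) /powR gt_eqF// ltr_expR mul0r.
  by rewrite nmulr_rlt0 ?ln_gt0 ?ltr1n// subr_lt0.
have h := @integral_shells (kernel p) (~` rV_cube 1) (fun k => 2 `^ (- p * k%:R))
  (fun k => 2 `^ (k.+1%:R)) (2 `^ (2 * n%:R)) (2 `^ (n%:R - p)).
apply: le_lt_trans (h _ _ _ _ r01 _ _ _ _) _; rewrite ?ltry//.
- apply: measurableC; exact: measurable_rV_cube.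
- apply: measurable_funTS; exact: measurable_kernel.
- by move=> x _; exact: kernel_ge0.
- move=> k; rewrite -(@powR_mulrn _ _ n) ?mulr_ge0 ?powR_ge0//.
  rewrite powRM ?powR_ge0// -powRrM mulrA -powRD ?pnatr_eq0 ?implybT//.
  rewrite -powRD ?pnatr_eq0 ?implybT// -[in leRHS]powR_mulrn ?powR_ge0//.
  rewrite -powRrM -powRD ?pnatr_eq0 ?implybT//.
  by rewrite le_eqVlt; apply/orP; left; apply/eqP; congr powR; rewrite -natr1; ring.
move=> x x1.
pose P k := [forall i, `|x ord0 i| <= (2 : R) `^ (k.+1%:R)].
have exP : exists k, P k.
  have [m hm] := rV_box_exhaust x; exists m; apply/forallP => i.
  apply: (le_trans (hm i)); rewrite powR_mulrn// -natrX ler_nat ltnW//.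
  by rewrite (ltn_trans (ltnSn m))// ltn_expl.
exists (ex_minn exP); case: ex_minnP => k /forallP kj kmin; last exact/rV_cubeP.
have [j hj] : exists j, 2 `^ k%:R < `|x ord0 j|.
  apply/existsP; apply: contraT => /existsPn h0; exfalso.
  case: k kj kmin h0 => [_ _|k _ kmin] h0.
    by apply: x1; apply/rV_cubeP => i; have := h0 i; rewrite powRr0 -leNgt.
  have : P k by apply/forallP => i; have := h0 i; rewrite -leNgt.
  by move=> /kmin; rewrite ltnn.
have := @kernel_le p x _ (ltW p0) (powR_gt0 _ _) (ltW (lt_le_trans hj (coord_le_enorm x j))).
by rewrite -powRrM mulrN mulrC -mulNr; exact.
Qed.

Lemma kernel_decomp (p : R) x : 0 < p -> enorm x * kernel (p + 1) x = kernel p x.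
Proof.
move=> p0; rewrite /kernel; have [->|x0] := eqVneq x 0.
  by rewrite enorm0 mul0r powR0 ?invr0// gt_eqF.
have e0 : 0 < enorm x by rewrite enorm_gt0.
rewrite (@powRD _ _ p 1) ?gt_eqF ?addr_gt0// powRr1 ?enorm_ge0// invfM mulrCA.
by rewrite mulfV ?mulr1// gt_eqF.
Qed.

(** C1 is the integral of K_(q-1) over the unit cube, where the factor |z| lowers the exponent below
    n; C2 is the integral of K_q outside. Both are fixed before [u]. The bound serves twice: for L^1
    moduli of BV functions and for increments of Lipschitz functions. *)
Lemma kernel_int_bound (alpha : R) : (0 < n)%N -> 0 < alpha < 1 ->
  exists C1 C2 : R, [/\ 0 <= C1, 0 <= C2 &
    forall (A B : R) (u : Rn -> \bar R), 0 <= A -> 0 <= B ->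
      measurable_fun setT u -> (forall z, 0 <= u z)%E ->
      (forall z, u z <= (A * enorm z)%:E)%E -> (forall z, u z <= B%:E)%E ->
    (\int[leb]_z (u z * (kernel (n%:R + alpha) z)%:E) <= (A * C1 + B * C2)%:E)%E].
Proof.
move=> n0 /andP[a0 a1]; set q := n%:R + alpha.
have n1 : (1 : R) <= n%:R by rewrite ler1n.
have near_fin := @kernel_int_near (q - 1).
have far_fin := @kernel_int_far q.
have {}near_fin : (\int[leb]_(x in rV_cube 1) (kernel (q - 1) x)%:E < +oo)%E.
  by apply: near_fin; rewrite /q; apply/andP; split; lra.
have {}far_fin : (\int[leb]_(x in ~` rV_cube 1) (kernel q x)%:E < +oo)%E.
  by apply: far_fin; rewrite /q; lra.
have mcube := measurable_rV_cube 1.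
have near0 : (0 <= \int[leb]_(x in rV_cube 1) (kernel (q - 1) x)%:E)%E.
  by apply: integral_ge0 => x _; rewrite lee_fin kernel_ge0.
have far0 : (0 <= \int[leb]_(x in ~` rV_cube 1) (kernel q x)%:E)%E.
  by apply: integral_ge0 => x _; rewrite lee_fin kernel_ge0.
exists (fine (\int[leb]_(x in rV_cube 1) (kernel (q - 1) x)%:E)),
  (fine (\int[leb]_(x in ~` rV_cube 1) (kernel q x)%:E)).
split; [exact: fine_ge0|exact: fine_ge0|].
move=> A B u A0 B0 mu u0 uA uB.
have mk p : measurable_fun setT (fun x => (kernel p x)%:E).
  by apply/measurable_EFinP; exact: measurable_kernel.
have k0 p x : (0 <= (kernel p x)%:E)%E by rewrite lee_fin kernel_ge0.
have muk : measurable_fun setT (fun z => u z * (kernel q z)%:E)%E.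
  by apply: emeasurable_funM => //; exact: mk.
rewrite -(setvU (rV_cube 1)) ge0_integral_setU//=; last 4 first.
- exact: measurableC.
- by rewrite setvU.
- by move=> x _; rewrite mule_ge0.
- by apply/disj_set2P; rewrite setICl.
rewrite addeC EFinD; apply: leeD.
  rewrite EFinM fineK ?ge0_fin_numE// -ge0_integralZl//; last first.
    by apply: measurable_funTS; exact: mk.
  apply: ge0_le_integral => //.
  - by move=> x _; rewrite mule_ge0.
  - exact: measurable_funTS.
  - by apply: measurable_funTS; apply: emeasurable_funM => //; exact: mk.
  - move=> x _; rewrite -(@kernel_decomp (q - 1)); last by rewrite /q; lra.
    rewrite subrK EFinM muleA; apply: lee_wpmul2r => //; rewrite -EFinM; exact: uA.
rewrite EFinM fineK ?ge0_fin_numE// -ge0_integralZl//; last 2 first.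
- exact: measurableC.
- by apply: measurable_funTS; exact: mk.
apply: ge0_le_integral => //.
- exact: measurableC.
- by move=> x _; rewrite mule_ge0.
- exact: measurable_funTS.
- by apply: measurable_funTS; apply: emeasurable_funM => //; exact: mk.
- by move=> x _; rewrite lee_wpmul2r.
Qed.

End kernels.

(** * Differentiability along a family of directions *)

Section differentiability_classes.
Context {R : realType} {V : normedModType R} {I : Type} (e : I -> V).
Implicit Types (u w : V -> R).

(** Directional derivatives become one-variable derivatives at 0, to which the chain rule and the
    Caratheodory criterion apply. *)
Lemma is_derive_line u x v d :
  is_derive x v u d <-> is_derive (0 : R) 1 (fun h : R => u (h *: v + x)) d.
Proof.
have E : (fun h : R => h^-1 *: ((u \o shift x) (h *: v) - u x)) =
  (fun h : R => h^-1 *: (((fun h : R => u (h *: v + x)) \o shift 0) (h *: 1) -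
     (fun h : R => u (h *: v + x)) 0)).
  by apply/funext => h /=; rewrite addr0 scale0r add0r [_%:A]mulr1.
split=> -[d1 d2]; split.
- by rewrite /derivable -E.
- by rewrite /derive -E.
- by rewrite /derivable E.
- by rewrite /derive E.
Qed.

Lemma is_derive_comp (g : R -> R) u x v (a b : R) :
  is_derive (u x) 1 g a -> is_derive x v u b ->
  is_derive x v (fun x => g (u x)) (a * b).
Proof.
move=> ga /is_derive_line ub; apply/is_derive_line.
by apply: (@is_derive1_comp R g (fun h : R => u (h *: v + x))); rewrite // scale0r add0r.
Qed.

(** An arbitrary family [e] of directions lets one calculus serve both the line, with the single
    direction 1, and R^n, with the basis [vbase]. *)
Fixpoint Ck k u : Prop := continuous u /\
  match k with
  | 0 => True
  | k'.+1 => forall i, (forall x, derivable u x (e i)) /\ Ck k' ('D_(e i) u)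
  end.

Lemma Ck_continuous k u : Ck k u -> continuous u.
Proof. by case: k => [|k] []. Qed.

Lemma Ck_intro k u : continuous u ->
  (forall i, exists2 u', Ck k u' & forall x, is_derive x (e i) u (u' x)) ->
  Ck k.+1 u.
Proof.
move=> cu h; split=> // i; have [u' Cu' du] := h i.
split; first by move=> x; have [] := du x.
by rewrite (_ : 'D_(e i) u = u')//; apply/funext => x; have [_] := du x.
Qed.

Lemma Ck_elim k u i : Ck k.+1 u ->
  Ck k ('D_(e i) u) /\ forall x, is_derive x (e i) u ('D_(e i) u x).
Proof. by move=> [_ /(_ i)[h1 h2]]; split => // x; exact: derivableP. Qed.

Lemma CkS k u : Ck k.+1 u -> Ck k u.
Proof.
elim: k u => [|k IH] u Cu; first by split => //; exact: Ck_continuous Cu.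
apply: Ck_intro => [|i]; first exact: Ck_continuous Cu.
by have [C1 C2] := Ck_elim i Cu; exists ('D_(e i) u) => //; exact: IH.
Qed.

Lemma Ck_cst k (c : R) : Ck k (fun=> c).
Proof.
elim: k c => [|k IH] c; first by split => //; exact: cst_continuous.
apply: Ck_intro => [|i]; first exact: cst_continuous.
by exists (fun=> 0) => // x; exact: is_derive_cst.
Qed.

Lemma CkD k u w : Ck k u -> Ck k w -> Ck k (fun x => u x + w x).
Proof.
elim: k u w => [|k IH] u w Cu Cw.
  by split => // x; apply: cvgD; [case: Cu|case: Cw] => + _; exact.
apply: Ck_intro => [x|i].
  by apply: cvgD; [exact: (Ck_continuous Cu)|exact: (Ck_continuous Cw)].
have [C1 C2] := Ck_elim i Cu; have [C3 C4] := Ck_elim i Cw.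
by exists (fun x => 'D_(e i) u x + 'D_(e i) w x); [exact: IH|move=> x; exact: is_deriveD].
Qed.

Lemma CkM k u w : Ck k u -> Ck k w -> Ck k (fun x => u x * w x).
Proof.
elim: k u w => [|k IH] u w Cu Cw.
  by split => // x; apply: cvgM; [case: Cu|case: Cw] => + _; exact.
apply: Ck_intro => [x|i].
  by apply: cvgM; [exact: (Ck_continuous Cu)|exact: (Ck_continuous Cw)].
have [C1 C2] := Ck_elim i Cu; have [C3 C4] := Ck_elim i Cw.
exists (fun x => u x * 'D_(e i) w x + w x * 'D_(e i) u x).
  by apply: CkD; apply: IH => //; exact: CkS.
by move=> x; exact: is_deriveM.
Qed.

Lemma Ck_sum k (J : Type) (s : seq J) (P : pred J) (F : J -> V -> R) :
  (forall j, Ck k (F j)) -> Ck k (fun x => \sum_(j <- s | P j) F j x).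
Proof.
move=> CF; elim: s => [|j s IH].
  by under eq_fun do rewrite big_nil; exact: Ck_cst.
under eq_fun do rewrite big_cons.
by case: (P j) => //; exact: CkD.
Qed.

Lemma Ck_prod k (J : Type) (s : seq J) (P : pred J) (F : J -> V -> R) :
  (forall j, Ck k (F j)) -> Ck k (fun x => \prod_(j <- s | P j) F j x).
Proof.
move=> CF; elim: s => [|j s IH].
  by under eq_fun do rewrite big_nil; exact: Ck_cst.
under eq_fun do rewrite big_cons.
by case: (P j) => //; exact: CkM.
Qed.

End differentiability_classes.

(** * Smooth functions of one variable *)

Section smooth1.
Context {R : realType}.
Implicit Types (g b : R -> R) (r t : R).

Definition smooth1 g := forall k, Ck (fun _ : unit => 1 : R) k g.

Lemma smooth1_derive g : smooth1 g ->
  smooth1 ('D_1 g) /\ forall t, is_derive t (1 : R) g ('D_1 g t).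
Proof.
move=> Cg; split=> [k|t]; first by case: (Ck_elim tt (Cg k.+1)).
by case: (Ck_elim tt (Cg 1%N)).
Qed.

Lemma smooth1_affine (a c : R) : smooth1 (fun t => a * t + c).
Proof.
have ca : continuous (fun t : R => a * t + c).
  move=> t; apply: cvgD; last exact: cvg_cst.
  by apply: cvgM; [exact: cvg_cst|exact: cvg_id].
case=> [|k]; first by split.
apply: Ck_intro => // _; exists (fun=> a); first exact: Ck_cst.
move=> t; apply/is_derive1_caratheodory; exists (fun=> a); split=> //; last exact: cst_continuous.
by move=> z; ring.
Qed.

Lemma Ck_comp {V : normedModType R} {I : Type} (e : I -> V) k g (u : V -> R) :
  smooth1 g -> Ck e k u -> Ck e k (fun x => g (u x)).
Proof.
elim: k g u => [|k IH] g u Cg Cu.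
  split => // x; apply: (@continuous_comp _ _ _ u g).
    exact: (Ck_continuous Cu).
  exact: (Ck_continuous (Cg 0%N)).
apply: Ck_intro => [x|i].
  apply: (@continuous_comp _ _ _ u g); first exact: (Ck_continuous Cu).
  exact: (Ck_continuous (Cg 0%N)).
have [Cu1 Cu2] := Ck_elim i Cu; have [Cg1 Cg2] := smooth1_derive Cg.
exists (fun x => 'D_1 g (u x) * 'D_(e i) u x).
  exact: (CkM (IH _ _ Cg1 (CkS Cu)) Cu1).
by move=> x; exact: is_derive_comp.
Qed.

Lemma smooth1_primitive b (B : R -> R) :
  smooth1 b -> (forall t : R, is_derive t (1 : R) B (b t)) -> smooth1 B.
Proof.
move=> Cb dB; have cB : continuous B.
  by move=> t; apply/differentiable_continuous/derivable1_diffP; have [] := dB t.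
case=> [|k]; first by split.
by apply: Ck_intro => // _; exists b.
Qed.

(* All functions [t ^ (-r) exp (-1/t)], extended by 0 to [t <= 0]; their span is closed under derivation. *)
Definition flat (r t : R) : R := if 0 < t then t `^ (- r) * expR (- t^-1) else 0.

Lemma flat_ge0 r t : 0 <= flat r t.
Proof. by rewrite /flat; case: ifP => // _; rewrite mulr_ge0 ?powR_ge0 ?expR_ge0. Qed.

Lemma flat_le0 r t : t <= 0 -> flat r t = 0.
Proof. by rewrite /flat ltNge => ->. Qed.

Lemma flat0_le1 t : flat 0 t <= 1.
Proof.
rewrite /flat; case: ifPn => // t0; rewrite oppr0 powRr0 mul1r expR_le1.
by rewrite oppr_le0 invr_ge0 ltW.
Qed.

(** Trading a factor t for one unit of exponent gives both the continuity of [flat] at 0 and its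
    difference quotient there. *)
Lemma flatS r t : flat r t = t * flat (r + 1) t.
Proof.
rewrite /flat; case: ifPn => t0; last by rewrite mulr0.
have tn0 : t != 0 by rewrite gt_eqF.
rewrite mulrA opprD powRD ?tn0 ?implybT// powR_inv1 ?ltW// mulrCA mulfV//.
by rewrite mulr1.
Qed.

(** With u = 1/t the function is u^r exp(-u), at most 1 for u <= 1. For u > 1, u^r <= u^(m+1) with m
    the integer part of r, and exp u >= u^(m+1) / (m+1)!. *)
Lemma flat_bounded r : 0 <= r -> exists2 C, 0 <= C & forall t, flat r t <= C.
Proof.
move=> r0; set m := Num.Def.trunc r.
exists (1 + (m.+1)`!%:R); first by rewrite addr_ge0.
move=> t; rewrite /flat; case: ifPn => [t0|_]; last by rewrite addr_ge0.
have u0 : 0 < t^-1 by rewrite invr_gt0.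
rewrite powRN -[t]invrK; set u := t^-1 in u0 *; rewrite invrK.
have -> : (u^-1 `^ r)^-1 = u `^ r.
  rewrite -powR_inv1; last by rewrite powR_ge0.
  by rewrite -powR_inv1 ?ltW// -!powRrM mulrN1 mulN1r opprK.
have e1 : expR (- u) <= 1 by rewrite expR_le1 oppr_le0 ltW.
have [u1|u1] := leP u 1.
  apply: (@le_trans _ _ 1); last by rewrite lerDl.
  rewrite -[leRHS]mulr1; apply: ler_pM; rewrite ?powR_ge0 ?expR_ge0//.
  apply: (@le_trans _ _ (1 `^ r)); last by rewrite powR1.
  by apply: ge0_ler_powR => //; rewrite nnegrE ltW.
apply: (@le_trans _ _ ((m.+1)`!%:R)); last by rewrite lerDr.
rewrite expRN ler_pdivrMr ?expR_gt0//.
apply: (@le_trans _ _ (u ^+ m.+1)).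
  have := @ler_powR _ u (ltW u1) r m.+1%:R; rewrite (powR_mulrn _ (ltW u0)); apply.
  by apply: ltW; exact: truncnS_gt.
have := expR_ge1Dxn m (ltW u0); rewrite -ler_pdivrMl ?ltr0n ?fact_gt0//.
by apply: le_trans; rewrite mulrC lerDr.
Qed.

Lemma flat_continuous0 r : 0 <= r -> flat r t @[t --> 0] --> (0 : R).
Proof.
move=> r0; have [C C0 hC] := @flat_bounded (r + 1) (addr_ge0 r0 ler01).
apply/cvgrPdist_le => eps eps0; near=> t.
rewrite sub0r normrN flatS normrM (@ger0_norm _ (flat _ _)) ?flat_ge0//.
apply: (@le_trans _ _ (`|t| * (C + 1))).
  by apply: ler_wpM2l => //; apply: (le_trans (hC t)); rewrite lerDl.
rewrite -ler_pdivlMr ?ltr_wpDl//.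
near: t; have : 0 < eps / (C + 1) by rewrite divr_gt0 ?ltr_wpDl.
by move=> h; exact: (@nbhs0_le _ R).
Unshelve. all: by end_near. Qed.

Lemma is_derive_flat r t : 0 <= r ->
  is_derive t (1 : R) (flat r) (- r * flat (r + 1) t + flat (r + 2) t).
Proof.
move=> r0; have [t0|t0|<-] := ltgtP 0 t.
- apply: (@near_eq_is_derive _ _ _ (fun t => t `^ (- r) * expR (- t^-1))).
    near=> s; rewrite /flat ifT//; near: s; exact: lt_nbhsr.
  apply: is_derive_eq.
    apply: is_deriveM; first exact: is_derive1_powR.
    apply: (@is_derive1_comp R expR (fun t => - t^-1)).
    apply: is_deriveN; apply: is_deriveV; first by rewrite gt_eqF.
  have tn0 : t != 0 by rewrite gt_eqF.
  rewrite /flat t0 /GRing.scale/= mulr1 !opprD !powRD ?tn0 ?implybT//.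
  by rewrite powR_inv1 ?ltW// -exprVn; ring.
- apply: (@near_eq_is_derive _ _ _ (cst 0)).
    near=> s; rewrite /flat ifF//; apply/negbTE; rewrite -leNgt ltW//.
    near: s; exact: lt_nbhsl.
  by rewrite !flat_le0 ?(ltW t0)// mulr0 addr0; exact: is_derive_cst.
(* At 0 the difference quotient of [flat r] is [flat (r + 1)] by [flatS], which is continuous there
   with value 0. *)
apply/is_derive1_caratheodory; exists (flat (r + 1)); split.
- by move=> z; rewrite (@flat_le0 _ 0)// !subr0 flatS mulrC.
- suff : flat (r + 1) t @[t --> (0 : R)] --> flat (r + 1) 0 by [].
  by rewrite (@flat_le0 (r + 1) 0)//; apply: flat_continuous0; lra.
- by rewrite !flat_le0// mulr0 addr0.
Unshelve. all: by end_near. Qed.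

Lemma smooth1_flat r : 0 <= r -> smooth1 (flat r).
Proof.
move=> + k; elim: k r => [|k IH] r r0; last first.
  apply: Ck_intro => [t|_].
    by apply/differentiable_continuous/derivable1_diffP; have [] := is_derive_flat t r0.
  exists (fun t => - r * flat (r + 1) t + flat (r + 2) t).
    apply: CkD; last by apply: IH; lra.
    apply: CkM; first exact: Ck_cst.
    by apply: IH; lra.
  by move=> t; exact: is_derive_flat.
split=> // t.
by apply/differentiable_continuous/derivable1_diffP; have [] := is_derive_flat t r0.
Qed.

(** The primitive is the integral from -oo; compact support makes [b] integrable, so that the
    fundamental theorem of calculus applies at every point. *)
Lemma primitive_exists b (M : R) : continuous b -> (forall t, M <= `|t| -> b t = 0) ->
  exists B : R -> R, forall t : R, is_derive t (1 : R) B (b t).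
Proof.
move=> cb bM; exists (fun t => \int[lebesgue_measure]_(s in `]-oo, t]) b s) => t.
have ib : lebesgue_measure.-integrable setT (EFin \o b).
  have mb : measurable_fun setT (EFin \o b).
    by apply/measurable_EFinP; exact: continuous_measurable_fun.
  have -> : EFin \o b = (EFin \o b) \_ `[- M, M].
    apply/funext => s; rewrite patchE; case: ifPn => // /negP; rewrite inE/= in_itv/=.
    move=> h /=; rewrite bM//; move/negP: h; rewrite negb_and -!ltNge ler_normr.
    by move=> /orP[] /ltW h; apply/orP; [right; lra|left].
  apply/(integrable_mkcond _ _).1 => //.
  by apply: continuous_compact_integrable; [exact: segment_compact|exact: continuous_subspaceT].
have := @continuous_FTC1 R b -oo%O t (t + 1) _ _ _ (cb t).
case=> [|||h1 h2].
- by rewrite ltrDl.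
- exact: integrableS ib.
- by rewrite ltNyr.
split; first exact: h1.
by rewrite -derive1E; exact: h2.
Qed.

End smooth1.

Lemma continuous_scale {R : realType} {V W : normedModType R} (v : V -> R) (w : W) :
  continuous v -> continuous (fun x => v x *: w).
Proof. by move=> cv x; apply: cvgZr_tmp; exact: cv. Qed.

(** * Tensor test functions on R^n *)

Section smooth_rV.
Context {R : realType} {n : nat}.
Local Notation Rn := 'rV[R]_n.
Local Notation leb := (lebesgue_rV R n).
Implicit Types (u : Rn -> R) (i j : 'I_n) (x : Rn).

Definition vbase i : Rn := delta_mx ord0 i.

Definition smooth u := forall k, Ck vbase k u.

Lemma is_derive_scale u (w : Rn) x v d : is_derive x v u d ->
  is_derive x v (fun x => u x *: w) (d *: w).
Proof.
move=> [du <-].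
have h : (fun h : R => h^-1 *: (((fun x => u x *: w) \o shift x) (h *: v) - u x *: w)) @ 0^'
    --> 'D_v u x *: w.
  under eq_fun do rewrite /= -scalerBl scalerA.
  by apply: cvgZr_tmp; exact: du.
split; first by apply/cvg_ex; exists ('D_v u x *: w).
by apply: cvg_lim => //; exact: norm_hausdorff.
Qed.

(** All test fields built below are a scalar function times a fixed vector; this carries the scalar
    calculus of [Ck] over to the class used for fields. *)
Lemma class_C_scale k u (w : Rn) : Ck vbase k u -> class_C k (fun x => u x *: w).
Proof.
elim: k u => [|k IH] u Cu /=; first by split => //; exact/continuous_scale/(Ck_continuous Cu).
split=> [|i]; first exact/continuous_scale/(Ck_continuous Cu).
have [C1 C2] := Ck_elim i Cu; split.
  by move=> x; have [] := is_derive_scale w (C2 x).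
rewrite (_ : partial i _ = fun x => 'D_(vbase i) u x *: w); first exact: IH.
by apply/funext => x; have [_] := is_derive_scale w (C2 x).
Qed.

Lemma rV_cube_compact (M : R) : compact (rV_cube M : set Rn).
Proof.
have -> : rV_cube M = [set v : Rn | forall i, `[- M, M]%classic (v ord0 i)].
  by apply/seteqP; split => x /= h i; have := h i; rewrite !mxE in_itv.
by apply: (@rV_compact R n (fun=> `[- M, M]%classic)) => i; exact: segment_compact.
Qed.

Lemma compact_support_cube (phi : Rn -> Rn) (M : R) :
  (forall x, ~ rV_cube M x -> phi x = 0) -> compact_support phi.
Proof.
move=> h; have cM : compact (rV_cube M : set Rn) by exact: rV_cube_compact.
apply: (subclosed_compact _ cM); first exact: closed_closure.
have clM : closed (rV_cube M : set Rn) by apply: compact_closed => //; exact: norm_hausdorff.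
rewrite closureE => x; apply; split => // y /=; apply: contraNP => ny.
by apply/eqP; exact: h.
Qed.

Lemma Cinfty_c_scale u (w : Rn) (M : R) : smooth u ->
  (forall x, ~ rV_cube M x -> u x = 0) -> Cinfty_c (fun x => u x *: w).
Proof.
move=> Cu uM; split; first by move=> k; apply: class_C_scale; exact: Cu.
by apply: (@compact_support_cube _ M) => x /uM ->; rewrite scale0r.
Qed.

Lemma divergence_scale u i x d : (forall i, derivable u x (vbase i)) ->
  is_derive x (vbase i) u d -> divergence (fun x => u x *: vbase i) x = d.
Proof.
move=> du dd; rewrite /divergence (bigD1 i)//= big1 ?addr0 => [|j ji].
  rewrite /partial; have [_ ->] := is_derive_scale (vbase i) dd.
  by rewrite !mxE !eqxx mulr1.
rewrite /partial; have [_ ->] := is_derive_scale (vbase i) (derivableP (du j)).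
by rewrite !mxE (negbTE ji) andbF mulr0.
Qed.

Lemma smooth_coord0 j : smooth (fun x => x ord0 j).
Proof.
have ca : continuous (fun x : Rn => x ord0 j) by exact: coord_continuous.
case=> [|k]; first by split.
apply: Ck_intro => // i; exists (fun=> (vbase i) ord0 j); first exact: Ck_cst.
move=> x; apply/is_derive_line; apply/is_derive1_caratheodory.
exists (fun=> (vbase i) ord0 j); split => //; last exact: cst_continuous.
by move=> z; rewrite !mxE; ring.
Qed.

Definition tensor (b : 'I_n -> R -> R) (x : Rn) : R := \prod_j b j (x ord0 j).

Lemma tensor_smooth b : (forall j, smooth1 (b j)) -> smooth (tensor b).
Proof.
by move=> sb k; apply: Ck_prod => j; apply: Ck_comp => //; exact: smooth_coord0.
Qed.

Lemma coord_line (h : R) x i j : (h *: vbase i + x) ord0 j = h *+ (j == i) + x ord0 j.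
Proof. by rewrite !mxE/= mulr_natr. Qed.

Lemma is_derive_tensor (b : 'I_n -> R -> R) (d : R -> R) i x :
  is_derive (x ord0 i) (1 : R) (b i) (d (x ord0 i)) ->
  is_derive x (vbase i) (tensor b) (tensor (fun j => if j == i then d else b j) x).
Proof.
move=> bd; apply/is_derive_line.
set c := \prod_(j < n | j != i) b j (x ord0 j).
have -> : (fun h : R => tensor b (h *: vbase i + x)) = (fun h => b i (h + x ord0 i) * c).
  apply/funext => h; rewrite /tensor (bigD1 i)//= coord_line eqxx; congr (_ * _).
  by apply: eq_bigr => j ji; rewrite coord_line (negbTE ji) add0r.
have -> : tensor (fun j => if j == i then d else b j) x = d (x ord0 i) * c.
  rewrite /tensor (bigD1 i)//= eqxx; congr (_ * _).
  by apply: eq_bigr => j /negbTE ->.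
move: bd => /is_derive1_caratheodory[g [g1 g2 g3]].
apply/is_derive1_caratheodory; exists (fun h => g (h + x ord0 i) * c); split.
- move=> z; rewrite add0r -mulrBl g1; ring.
- apply: cvgM; last exact: cvg_cst.
  apply: (@continuous_comp _ _ _ (fun h : R => h + x ord0 i) g).
    by apply: cvgD; [exact: cvg_id|exact: cvg_cst].
  by rewrite add0r.
- by rewrite add0r g3.
Qed.

Definition bump1 (b : R -> R) :=
  smooth1 b /\ exists2 M, 0 <= M & forall t, M <= `|t| -> b t = 0.

(** Generated inductively so that smoothness, support, bounds and primitives along an axis follow
    from the one-variable factors. The family is also stable under products, which complements and
    unions of sets call for. *)
Inductive testfun : (Rn -> R) -> Prop :=
| testfun_tensor b : (forall j, bump1 (b j)) -> testfun (tensor b)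
| testfun_lin (c : R) u w : testfun u -> testfun w -> testfun (fun x => c * u x + w x).

Lemma bump1M b b' : bump1 b -> bump1 b' -> bump1 (fun t => b t * b' t).
Proof.
move=> [sb [M M0 bM]] [sb' _]; split; first by move=> k; exact: CkM.
by exists M => // t /bM ->; rewrite mul0r.
Qed.

Lemma testfunM u w : testfun u -> testfun w -> testfun (fun x => u x * w x).
Proof.
elim=> [b hb|c u1 u2 _ IH1 _ IH2] tw.
  elim: tw => [b' hb'|c w1 w2 _ IH1 _ IH2].
    rewrite (_ : (fun x => _) = tensor (fun j t => b j t * b' j t)).
      by apply: testfun_tensor => j; exact: bump1M.
    by apply/funext => x; rewrite /tensor big_split.
  rewrite (_ : (fun x => _) = fun x => c * (tensor b x * w1 x) + tensor b x * w2 x).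
    exact: testfun_lin.
  by apply/funext => x; ring.
rewrite (_ : (fun x => _) = fun x => c * (u1 x * w x) + u2 x * w x).
  by apply: testfun_lin; [exact: IH1|exact: IH2].
by apply/funext => x; ring.
Qed.

Lemma testfun_smooth u : testfun u -> smooth u.
Proof.
elim=> [b hb|c u1 u2 _ IH1 _ IH2]; first by apply: tensor_smooth => j; have [] := hb j.
by move=> k; apply: CkD => //; apply: CkM => //; exact: Ck_cst.
Qed.

Lemma rV_cubeS (M N : R) : M <= N -> rV_cube M `<=` (rV_cube N : set Rn).
Proof. by move=> MN x /rV_cubeP xM; apply/rV_cubeP => i; apply: le_trans MN. Qed.

Lemma not_rV_cube (M : R) x : ~ rV_cube M x -> exists i, M < `|x ord0 i|.
Proof.
move=> /rV_cubeP; rewrite -existsNP => -[i /negP]; rewrite -ltNge => ?; by exists i.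
Qed.

Lemma bump1_family (b : 'I_n -> R -> R) : (forall j, bump1 (b j)) ->
  exists2 M, 0 <= M & forall j t, M <= `|t| -> b j t = 0.
Proof.
move=> hb; have h j : exists M, 0 <= M /\ forall t, M <= `|t| -> b j t = 0.
  by have [_ [M M0 bM]] := hb j; exists M.
have [F hF] := choice h; exists (\sum_j F j).
  by apply: sumr_ge0 => j _; have [] := hF j.
move=> j t Ft; have [_] := hF j; apply; apply: le_trans Ft.
rewrite (bigD1 j)//= lerDl; apply: sumr_ge0 => k _; by have [] := hF k.
Qed.

Lemma testfun_support u : testfun u ->
  exists2 M, 0 <= M & forall x, ~ rV_cube M x -> u x = 0.
Proof.
elim=> [b /bump1_family[M M0 bM]|c u1 u2 _ [M1 M10 h1] _ [M2 M20 h2]].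
  exists M => // x /not_rV_cube[i xi]; rewrite /tensor (bigD1 i)//= bM ?mul0r//.
  exact: ltW.
exists (M1 + M2); first exact: addr_ge0.
move=> x xM; rewrite h1 ?h2 ?mulr0 ?addr0//; apply: contra_not xM.
  by apply: rV_cubeS; rewrite lerDr.
by apply: rV_cubeS; rewrite lerDl.
Qed.

(** [t] and [t - s] lie on the same side of the support, so the mean value theorem applies on a
    segment that avoids it. The constants on the two sides of the support may differ. *)
Lemma primitive_cst (b B : R -> R) (M t s : R) :
  (forall t, M <= `|t| -> b t = 0) -> (forall t : R, is_derive t (1 : R) B (b t)) ->
  0 <= M -> M + `|s| < `|t| -> B t = B (t - s).
Proof.
move=> bM dB M0 Mt.
have cB : continuous B.
  by move=> r; apply/differentiable_continuous/derivable1_diffP; have [] := dB r.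
have key a c : a <= c -> (forall r, r \in `[a, c] -> M <= `|r|) -> B a = B c.
  move=> ac h; have [r rac] := @MVT_segment R B b a c ac (fun r _ => dB r) (continuous_subspaceT cB).
  by rewrite bM ?h// mul0r => /eqP; rewrite subr_eq0 => /eqP.
move: Mt; rewrite ltr_normr => /orP[] Mt.
  have s1 := ler_norm s; have s2 := ler_norm (- s); rewrite normrN in s2.
  have [ts|ts] := leP t (t - s).
    apply: key => // r; rewrite in_itv/= => /andP[r1 r2].
    by rewrite ler_normr; apply/orP; left; lra.
  apply/esym; apply: key => [|r]; first exact: ltW.
  rewrite in_itv/= => /andP[r1 r2].
  by rewrite ler_normr; apply/orP; left; lra.
have s1 := ler_norm s; have s2 := ler_norm (- s); rewrite normrN in s2.
have [ts|ts] := leP t (t - s).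
  apply: key => // r; rewrite in_itv/= => /andP[r1 r2].
  by rewrite ler_normr; apply/orP; right; lra.
apply/esym; apply: key => [|r]; first exact: ltW.
rewrite in_itv/= => /andP[r1 r2].
by rewrite ler_normr; apply/orP; right; lra.
Qed.

(** On a tensor product, the i-th factor is replaced by its primitive, which can destroy compact
    support along axis i. The last clause is the substitute: [P] minus a translate along that axis
    has compact support. If the point leaves the cube along axis i, the primitive is constant there;
    along another axis, an unchanged factor vanishes. *)
Lemma testfun_primitive i u : testfun u -> exists P : Rn -> R,
  [/\ smooth P, forall x, is_derive x (vbase i) P (u x) &
    forall s : R, exists M, forall x, ~ rV_cube M x -> P x = P (x - s *: vbase i)].
Proof.
elim=> [b hb|c u1 u2 _ [P1 [C1 d1 M1]] _ [P2 [C2 d2 M2]]].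
  have [M M0 bM] := bump1_family hb.
  have cb : continuous (b i) by have [sb _] := hb i; exact: (Ck_continuous (sb 0%N)).
  have [B dB] := @primitive_exists R (b i) M cb (bM i).
  exists (tensor (fun j => if j == i then B else b j)); split.
  - apply: tensor_smooth => j; case: eqP => [_|_]; last by have [] := hb j.
    by apply: smooth1_primitive dB; have [] := hb i.
  - move=> x; rewrite (_ : tensor b x =
        tensor (fun j => if j == i then b i else if j == i then B else b j) x).
      by apply: is_derive_tensor; rewrite eqxx; exact: dB.
    by apply: eq_bigr => j _; case: eqP => [->|].
  - move=> s; exists (M + `|s|) => x /not_rV_cube[j xj].
    have xE k : (x - s *: vbase i) ord0 k = x ord0 k - s *+ (k == i).
      by rewrite !mxE/= mulr_natr.
    rewrite /tensor (bigD1 j)//= [RHS](bigD1 j)//= !xE.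
    have [ji|ji] := eqVneq j i.
      rewrite mulr1n; congr (_ * _).
        apply: (primitive_cst (bM i)) => //; by rewrite -?ji.
      apply: eq_bigr => k kj; rewrite xE.
      by rewrite ji in kj; rewrite (negbTE kj) subr0.
    rewrite mulr0n subr0 bM ?mul0r//.
    by apply: le_trans (ltW xj); rewrite lerDl.
exists (fun x => c * P1 x + P2 x); split.
- by move=> k; apply: CkD => //; apply: CkM => //; exact: Ck_cst.
- move=> x; have h1 := is_deriveZ c (d1 x).
  exact: (is_deriveD h1 (d2 x)).
move=> s; have [N1 h1] := M1 s; have [N2 h2] := M2 s.
exists (Num.max N1 N2) => x xN; congr (c * _ + _).
  by apply: h1; apply: contra_not xN; apply: rV_cubeS; rewrite le_max lexx.
by apply: h2; apply: contra_not xN; apply: rV_cubeS; rewrite le_max lexx orbT.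
Qed.

(* The exponents of [flat 0] tend to 0 inside the interval, so [hat m a c] tends to its indicator. *)
Definition hat (m a c t : R) : R := flat 0 (m * (t - a)) * flat 0 (m * (c - t)).

Lemma hat_ge0 m a c t : 0 <= hat m a c t.
Proof. by rewrite mulr_ge0 ?flat_ge0. Qed.

Lemma hat_le1 m a c t : hat m a c t <= 1.
Proof. by rewrite /hat -[leRHS]mulr1; apply: ler_pM; rewrite ?flat_ge0 ?flat0_le1. Qed.

Lemma hat_bump m a c : 0 <= m -> bump1 (hat m a c).
Proof.
move=> m0; split.
  have fs (g : R -> R) : smooth1 g -> smooth1 (fun t => flat 0 (g t)).
    by move=> sg k; apply: Ck_comp => //; exact: smooth1_flat.
  move=> k; apply: CkM; apply: fs => l.
    have -> : (fun t : R => m * (t - a)) = (fun t => m * t + - (m * a)).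
      by apply/funext => t; ring.
    exact: smooth1_affine.
  have -> : (fun t : R => m * (c - t)) = (fun t => - m * t + m * c).
    by apply/funext => t; ring.
  exact: smooth1_affine.
exists (`|a| + `|c|) => [|t]; first exact: addr_ge0.
have a1 := ler_norm a; have a2 := ler_norm (- a); rewrite normrN in a2.
have c1 := ler_norm c; have c2 := ler_norm (- c); rewrite normrN in c2.
rewrite ler_normr => /orP[] h.
  by rewrite /hat (@flat_le0 _ 0 (m * (c - t))) ?mulr0// mulr_ge0_le0//; lra.
by rewrite /hat (@flat_le0 _ 0 (m * (t - a))) ?mul0r// mulr_ge0_le0//; lra.
Qed.

End smooth_rV.

(** From exp(-1/s) >= 1 - 1/s, the distance to 1 is at most 1/s, and s grows at least linearly in
    m. *)
Lemma flat_cvg1 {R : realType} (s : nat -> R) (d : R) : 0 < d ->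
  (\forall m \near \oo, d * m%:R <= s m) -> flat 0 (s m) @[m --> \oo] --> (1 : R).
Proof.
move=> d0 hs; apply/cvgrPdist_le => e e0.
have [k hk] : exists k : nat, (d * e)^-1 < k%:R.
  by exists (Num.Def.trunc (d * e)^-1).+1; exact: truncnS_gt.
near=> m.
have km : k%:R <= m%:R :> R by rewrite ler_nat; near: m; exact: nbhs_infty_ge.
have dm : d * m%:R <= s m by near: m.
have de : 0 < (d * e)^-1 by rewrite invr_gt0 mulr_gt0.
have m0 : 0 < m%:R :> R by apply: lt_le_trans km; apply: lt_trans hk.
have s0 : 0 < s m by apply: lt_le_trans dm; rewrite mulr_gt0.
rewrite ger0_norm ?subr_ge0 ?flat0_le1//.
rewrite /flat s0 oppr0 powRr0 mul1r.
have h1 := expR_ge1Dx (- (s m)^-1).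
suff : (s m)^-1 <= e by lra.
rewrite -[leRHS]invrK lef_pV2 ?posrE ?invr_gt0//.
apply: le_trans dm; apply: (@le_trans _ _ (d * (d * e)^-1)).
  by rewrite invfM mulrA mulfV ?gt_eqF// mul1r.
by rewrite ler_pM2l//; apply: le_trans km; exact: ltW.
Unshelve. all: by end_near. Qed.

(** * Pointwise approximation of half-spaces by test functions *)

Section approximation.
Context {R : realType} {n : nat}.
Local Notation Rn := 'rV[R]_n.

Lemma testfun_measurable (u : Rn -> R) : testfun u -> measurable_fun setT u.
Proof.
by move=> /testfun_smooth su; apply: continuous_rV_measurable; exact: (Ck_continuous (su 0%N)).
Qed.

Lemma testfun0 : testfun ((fun=> 0) : Rn -> R).
Proof.
have h : testfun (tensor (fun _ : 'I_n => hat 0 0 0 : R -> R)).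
  by apply: testfun_tensor => j; exact: hat_bump.
set b := tensor _ in h.
have -> : (fun=> 0) = (fun x => -1 * b x + b x) by apply/funext => x; ring.
exact: testfun_lin.
Qed.

Lemma cvg_tensor (b : nat -> 'I_n -> R -> R) (x : Rn) :
  (forall j, b m j (x ord0 j) @[m --> \oo] --> (1 : R)) ->
  tensor (b m) x @[m --> \oo] --> (1 : R).
Proof.
move=> h; rewrite /tensor; elim: (index_enum _) => [|j s IH].
  by under eq_fun do rewrite big_nil; exact: cvg_cst.
have -> : (fun m => \prod_(k <- j :: s) b m k (x ord0 k)) =
    (fun m => b m j (x ord0 j) * \prod_(k <- s) b m k (x ord0 k)).
  by apply/funext => m; rewrite big_cons.
by rewrite -[X in _ --> X]mulr1; apply: cvgM; [exact: h|exact: IH].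
Qed.

(** A substitute for the constant 1, which has no compact support when n >= 1; it enters wherever a
    complement or a sign has to be formed. *)
Definition plateau (m : nat) : Rn -> R := tensor (fun=> hat m%:R (- m%:R) m%:R).

Lemma tensor_hat01 (m a c : 'I_n -> R) (x : Rn) :
  0 <= tensor (fun j => hat (m j) (a j) (c j)) x <= 1.
Proof.
rewrite /tensor; apply/andP; split; first by apply: prodr_ge0 => j _; exact: hat_ge0.
by apply: prodr_ile1 => j _; rewrite hat_ge0 hat_le1.
Qed.

Lemma hat_plateau_cvg (t : R) : hat m%:R (- m%:R) m%:R t @[m --> \oo] --> (1 : R).
Proof.
have [k hk] : exists k : nat, `|t| + 1 <= k%:R.
  by exists (Num.Def.trunc (`|t| + 1)).+1; exact/ltW/truncnS_gt.
rewrite -[X in _ --> X]mulr1; apply: cvgM; apply: (@flat_cvg1 _ _ 1) => //.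
  near=> m; rewrite mulrC ler_wpM2l// opprK.
  have km : k%:R <= m%:R :> R by rewrite ler_nat; near: m; exact: nbhs_infty_ge.
  have := ler_norm (- t); rewrite normrN => h; lra.
near=> m; rewrite mulrC ler_wpM2l//.
have km : k%:R <= m%:R :> R by rewrite ler_nat; near: m; exact: nbhs_infty_ge.
have := ler_norm t => h; lra.
Unshelve. all: by end_near. Qed.

Lemma plateau_cvg x : plateau m x @[m --> \oo] --> (1 : R).
Proof. by apply: cvg_tensor => j; exact: hat_plateau_cvg. Qed.

Lemma plateau_testfun m : testfun (plateau m).
Proof. by apply: testfun_tensor => j; exact: hat_bump. Qed.

Lemma plateau01 m x : 0 <= plateau m x <= 1.
Proof. exact: (@tensor_hat01 (fun=> m%:R) (fun=> - m%:R) (fun=> m%:R)). Qed.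

(** The i-th interval keeps its left end [t] while all other ends go to infinity. Since [hat]
    vanishes at its end points, the limit is the indicator of the open half-space on the boundary
    too. *)
Definition half_bump (i : 'I_n) (t : R) (m : nat) : Rn -> R :=
  tensor (fun j => hat m%:R (if j == i then t else - m%:R) m%:R).

Lemma half_bump_cvg i t x :
  half_bump i t m x @[m --> \oo] --> (\1_[set x : Rn | t < x ord0 i] x : R).
Proof.
have [tx|xt] := ltP t (x ord0 i).
  rewrite indicE mem_set//; apply: cvg_tensor => j; case: eqP => [->|_]; last first.
    exact: hat_plateau_cvg.
  have [k hk] : exists k : nat, `|x ord0 i| + 1 <= k%:R.
    by exists (Num.Def.trunc (`|x ord0 i| + 1)).+1; exact/ltW/truncnS_gt.
  rewrite -[X in _ --> X]mulr1; apply: cvgM.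
    apply: (@flat_cvg1 _ _ (x ord0 i - t)); first by rewrite subr_gt0.
    by near=> m; rewrite mulrC.
  apply: (@flat_cvg1 _ _ 1) => //.
  near=> m; rewrite mulrC ler_wpM2l//.
  have km : k%:R <= m%:R :> R by rewrite ler_nat; near: m; exact: nbhs_infty_ge.
  have := ler_norm (x ord0 i) => h; lra.
rewrite indicE memNset/=; last by apply/negP; rewrite -leNgt.
have -> : (fun m => half_bump i t m x) = fun=> 0.
  apply/funext => m; rewrite /half_bump /tensor (bigD1 i)//= eqxx /hat.
  by rewrite (@flat_le0 _ 0 (_ * (_ - t))) ?mul0r// mulr_ge0_le0// subr_le0.
exact: cvg_cst.
Unshelve. all: by end_near. Qed.

Lemma half_bump_testfun i t m : testfun (half_bump i t m).
Proof. by apply: testfun_tensor => j; exact: hat_bump. Qed.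

Lemma half_bump01 i t m x : 0 <= half_bump i t m x <= 1.
Proof. exact: (@tensor_hat01 (fun=> m%:R) (fun j => if j == i then t else - m%:R) (fun=> m%:R)). Qed.

End approximation.

Section weighted_distance.
Context d (T : measurableType d) {R : realType} (mu : {measure set T -> \bar R}) (w : T -> R).
Hypotheses (iw : mu.-integrable setT (EFin \o w)) (w0 : forall x, 0 <= w x).

Let mw : measurable_fun setT w.
Proof. by apply/measurable_EFinP; exact: measurable_int iw. Qed.

(** Dominated convergence, with the weight [w] as dominating function. *)
Lemma weighted_small (h : nat -> T -> R) : (forall m, measurable_fun setT (h m)) ->
  (forall m x, `|h m x| <= 1) -> (forall x, h m x @[m --> \oo] --> (0 : R)) ->
  forall e, 0 < e -> exists m, (\int[mu]_x (`|h m x| * w x)%:E <= e%:E)%E.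
Proof.
move=> mh h1 h0 e e0.
have mhw m : measurable_fun setT (fun x => (`|h m x| * w x)%:E).
  by apply/measurable_EFinP; apply: measurable_funM => //; exact: measurableT_comp.
have [||||//|_ _ +] := @dominated_convergence _ _ _ mu setT measurableT
   (fun m x => (`|h m x| * w x)%:E) (cst 0%E) (EFin \o w).
- exact: mhw.
- exact: measurable_cst.
- apply/aeW => x _; apply/fine_cvgP; split; first exact: nearW.
  rewrite -[X in _ --> X](mul0r (w x)); apply: cvgM; last exact: cvg_cst.
  by rewrite -[X in _ --> X](normr0 R); apply: cvg_norm; exact: h0.
- exact: iw.
- apply/aeW => x m _; rewrite /= lee_fin ger0_norm ?mulr_ge0//.
  by rewrite -[leRHS]mul1r ler_wpM2r.
rewrite integral0 => /fine_cvgP[fin /cvgrPdist_le/(_ _ e0) he].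
have [m []] := filter_ex (filterI fin he).
  move=> mfin; rewrite sub0r normrN => hm; exists m.
  rewrite /= in mfin hm; rewrite -(fineK mfin) lee_fin; apply: le_trans hm; exact: ler_norm.
Qed.

Lemma weighted_triangle (h h1 h2 : T -> R) : measurable_fun setT h ->
  measurable_fun setT h1 -> measurable_fun setT h2 ->
  (forall x, `|h x| <= `|h1 x| + `|h2 x|) ->
  (\int[mu]_x (`|h x| * w x)%:E <=
   \int[mu]_x (`|h1 x| * w x)%:E + \int[mu]_x (`|h2 x| * w x)%:E)%E.
Proof.
move=> mh mh1 mh2 hh.
have m_ (g : T -> R) : measurable_fun setT g -> measurable_fun setT (fun x => (`|g x| * w x)%:E).
  by move=> mg; apply/measurable_EFinP; apply: measurable_funM => //; exact: measurableT_comp.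
rewrite -ge0_integralD//; [|by move=> x _; rewrite lee_fin mulr_ge0|exact: m_
  |by move=> x _; rewrite lee_fin mulr_ge0|exact: m_].
apply: ge0_le_integral => //.
- by move=> x _; rewrite lee_fin mulr_ge0.
- exact: m_.
- by apply: emeasurable_funD; exact: m_.
- by move=> x _; rewrite -EFinD lee_fin -mulrDl ler_wpM2r.
Qed.

End weighted_distance.

(** * Approximation of Borel sets in weighted L^1 distance *)

Section approximation_of_sets.
Context {R : realType} {n : nat}.
Local Notation Rn := 'rV[R]_n.
Variables (mu : {measure set Rn -> \bar R}) (w : Rn -> R).
Hypotheses (iw : mu.-integrable setT (EFin \o w)) (w0 : forall x, 0 <= w x).

Let dist (h : Rn -> R) (A : set Rn) := (\int[mu]_x (`|h x - \1_A x| * w x)%:E)%E.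

(** The weight covers two uses: Lebesgue measure with weight |u| in the L^1 duality, and a finite
    measure with weight 1 in the uniqueness of charges. Values in [0, 1] keep the errors of products
    bounded by those of the factors. *)
Definition approximable (A : set Rn) := measurable A /\
  forall e, 0 < e -> exists h, [/\ testfun h, forall x, 0 <= h x <= 1 & (dist h A <= e%:E)%E].

Let mind (A : set Rn) : measurable A -> measurable_fun setT (\1_A : Rn -> R).
Proof. by move=> mA; apply/measurable_indicP. Qed.

Let indic01 (A : set Rn) x : 0 <= (\1_A x : R) <= 1.
Proof. by rewrite indicE; case: (_ \in _); rewrite ?lexx ?ler01. Qed.

Lemma approximable_half i t : approximable [set x : Rn | t < x ord0 i].
Proof.
set A := [set x : Rn | _].
have mA : measurable A.
  have -> : A = rV_coord i @^-1` `]t, +oo[.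
    by apply/seteqP; split => x /=; rewrite in_itv/= andbT.
  by rewrite -[X in measurable X]setTI; exact: measurable_rV_coord.
split=> // e e0.
have [|||m hm] := @weighted_small _ _ _ mu w iw w0 (fun m x => half_bump i t m x - \1_A x) _ _ _ e e0.
- move=> m; apply: measurable_funB; last exact: mind.
  by apply: testfun_measurable; exact: half_bump_testfun.
- move=> m x; have /andP[? ?] := half_bump01 i t m x; have /andP[? ?] := indic01 A x.
  by rewrite ler_norml; apply/andP; split; lra.
- move=> x; rewrite -(subrr (\1_A x : R)); apply: cvgB; last exact: cvg_cst.
  exact: half_bump_cvg.
exists (half_bump i t m); split => //; first exact: half_bump_testfun.
by move=> x; exact: half_bump01.
Qed.

Lemma approximable_setC A : approximable A -> approximable (~` A).
Proof.
move=> [mA hA]; split=> [|e e0]; first exact: measurableC.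
have e20 : 0 < e / 2 by rewrite divr_gt0.
have [h [th h01 hh]] := hA _ e20.
have [|||m hm] := @weighted_small _ _ _ mu w iw w0 (fun m x => plateau m x - 1) _ _ _ _ e20.
- by move=> m; apply: measurable_funB => //; by apply: testfun_measurable; exact: plateau_testfun.
- move=> m x; have /andP[? ?] := plateau01 m x.
  by rewrite ler_norml; apply/andP; split; lra.
- move=> x; rewrite -(subrr 1); apply: cvgB; last exact: cvg_cst.
  exact: plateau_cvg.
have tP := @plateau_testfun R n m; have P01 := @plateau01 R n m.
(* This is P (1 - h): the complement of h, cut off by a plateau P, at the price of the extra error
   |P - 1|. *)
exists (fun x => -1 * (plateau m x * h x) + plateau m x); split.
- by apply: testfun_lin => //; exact: testfunM.
- move=> x; have /andP[? ?] := P01 x; have /andP[? ?] := h01 x.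
  by apply/andP; split; nra.
apply: (@le_trans _ _ (e / 2 + e / 2)%:E); last by rewrite -splitr.
rewrite EFinD; apply: le_trans (leeD hm hh).
have mPl : measurable_fun setT (plateau m : Rn -> R) by exact: testfun_measurable.
have mh : measurable_fun setT h by exact: testfun_measurable.
apply: weighted_triangle => //.
- apply: measurable_funB; last by apply: mind; exact: measurableC.
  apply: measurable_funD => //; apply: measurable_funM => //.
  exact: measurable_funM.
- exact: measurable_funB.
- by apply: measurable_funB => //; exact: mind.
move=> x; have /andP[? ?] := P01 x; have /andP[? ?] := h01 x.
have -> : -1 * (plateau m x * h x) + plateau m x - \1_(~` A) x =
  (plateau m x - 1) * (1 - h x) - (h x - \1_A x).
  rewrite !indicE in_setC; case: (_ \in _) => /=; ring.
apply: (le_trans (ler_normB _ _)); rewrite lerD2r normrM -[leRHS]mulr1.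
by apply: ler_wpM2l => //; rewrite ler_norml; apply/andP; split; lra.
Qed.

Lemma approximable_setU A B : approximable A -> approximable B -> approximable (A `|` B).
Proof.
move=> [mA hA] [mB hB]; split=> [|e e0]; first exact: measurableU.
have e20 : 0 < e / 2 by rewrite divr_gt0.
have [h [th h01 hh]] := hA _ e20; have [g [tg g01 hg]] := hB _ e20.
(* h + g - h g, the union formula for functions with values in [0, 1], arranged as a [testfun]. *)
exists (fun x => -1 * (h x * g x) + (1 * h x + g x)); split.
- apply: testfun_lin; first exact: testfunM.
  exact: testfun_lin.
- move=> x; have /andP[? ?] := h01 x; have /andP[? ?] := g01 x.
  by apply/andP; split; nra.
apply: (@le_trans _ _ (e / 2 + e / 2)%:E); last by rewrite -splitr.
rewrite EFinD; apply: le_trans (leeD hh hg).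
have mh : measurable_fun setT h by exact: testfun_measurable.
have mg : measurable_fun setT g by exact: testfun_measurable.
apply: weighted_triangle => //.
- apply: measurable_funB; last by apply: mind; exact: measurableU.
  apply: measurable_funD => //.
    by apply: measurable_funM => //; exact: measurable_funM.
  by apply: measurable_funD => //; exact: measurable_funM.
- by apply: measurable_funB => //; exact: mind.
- by apply: measurable_funB => //; exact: mind.
move=> x; have /andP[? ?] := h01 x; have /andP[? ?] := g01 x.
have /andP[? ?] := indic01 A x.
have -> : -1 * (h x * g x) + (1 * h x + g x) - \1_(A `|` B) x =
  (h x - \1_A x) * (1 - g x) + (g x - \1_B x) * (1 - \1_A x).
  by rewrite !indicE in_setU; case: (_ \in A) => /=; case: (_ \in B) => /=; ring.
apply: (le_trans (ler_normD _ _)); rewrite !normrM; apply: lerD.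
  rewrite -[leRHS]mulr1.
  by apply: ler_wpM2l => //; rewrite ler_norml; apply/andP; split; lra.
rewrite -[leRHS]mulr1.
by apply: ler_wpM2l => //; rewrite ler_norml; apply/andP; split; lra.
Qed.

Lemma approximable_set0 : approximable set0.
Proof.
split=> // e e0; exists (fun=> 0); split=> [|x|]; [exact: testfun0|by rewrite lexx ler01|].
rewrite /dist; under eq_integral do rewrite indic0 subrr normr0 mul0r.
by rewrite integral0 lee_fin ltW.
Qed.

Lemma approximable_bigcup (F : (set Rn)^nat) : (forall k, approximable (F k)) ->
  approximable (\bigcup_k F k).
Proof.
move=> aF; split=> [|e e0]; first by apply: bigcup_measurable => k _; have [] := aF k.
pose G k := \big[setU/set0]_(i < k) F i.
have aG k : approximable (G k).
  rewrite /G; elim: k => [|k IH]; first by rewrite big_ord0; exact: approximable_set0.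
  by rewrite big_ord_recr/=; exact: approximable_setU.
have e20 : 0 < e / 2 by rewrite divr_gt0.
set U := \bigcup_k F k.
have mU : measurable U by apply: bigcup_measurable => k _; have [] := aF k.
(* Finite unions converge pointwise to [U]. Half of [e] pays for stopping at m, the other half for
   approximating [G m]. *)
have [|||m hm] := @weighted_small _ _ _ mu w iw w0
    (fun m x => \1_(G m) x - \1_U x) _ _ _ _ e20.
- by move=> m; apply: measurable_funB; apply: mind => //; have [] := aG m.
- move=> m x; have /andP[? ?] := indic01 (G m) x; have /andP[? ?] := indic01 U x.
  by rewrite ler_norml; apply/andP; split; lra.
- move=> x; have [[k _ Fkx]|nUx] := pselect (U x).
    apply: cvg_near_cst; near=> m.
    have Gm : G m x.
      rewrite /G -bigcup_mkord; exists k => //=.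
      by near: m; exact: nbhs_infty_gt.
    have Ux : U x by exists k.
    by rewrite !indicE !mem_set// subrr.
  rewrite (_ : (fun m => _) = fun=> 0); first exact: cvg_cst.
  apply/funext => m; rewrite !indicE !memNset ?subrr//.
  by rewrite /G -bigcup_mkord => -[k _ Fk]; apply: nUx; exists k.
have [mG /(_ _ e20)[h [th h01 hh]]] := aG m.
exists h; split => //.
apply: (@le_trans _ _ (e / 2 + e / 2)%:E); last by rewrite -splitr.
rewrite EFinD; apply: le_trans (leeD hh hm).
have mh : measurable_fun setT h by exact: testfun_measurable.
apply: weighted_triangle => //; try by apply: measurable_funB => //; exact: mind.
by move=> x; apply: le_trans (ler_normD _ _); rewrite addrA subrK.
Unshelve. all: by end_near. Qed.

Lemma approximable_measurable A : measurable A -> approximable A.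
Proof.
apply: measurable_rV_ind; last exact: approximable_half.
split; first exact: approximable_set0.
  by move=> B; rewrite setTD; exact: approximable_setC.
exact: approximable_bigcup.
Qed.

End approximation_of_sets.

Section shift_calculus.
Context {R : realType} {V : normedModType R} {I : Type} (e : I -> V).

Lemma is_derive_shiftV (u : V -> R) (c x v : V) d :
  is_derive (x + c) v u d -> is_derive x v (fun x => u (x + c)) d.
Proof.
move=> /is_derive_line h; apply/is_derive_line.
by rewrite (_ : (fun h : R => _) = fun h : R => u (h *: v + (x + c)))//;
  apply/funext => t; rewrite addrA.
Qed.

Lemma Ck_shift k (u : V -> R) c : Ck e k u -> Ck e k (fun x => u (x + c)).
Proof.
have cs (w : V -> R) : continuous w -> continuous (fun x => w (x + c)).
  move=> cw x; apply: (@continuous_comp _ _ _ (fun x => x + c) w); last exact: cw.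
  by apply: cvgD; [exact: cvg_id|exact: cvg_cst].
elim: k u => [|k IH] u Cu; first by split => //; exact/cs/(Ck_continuous Cu).
apply: Ck_intro => [|i]; first exact/cs/(Ck_continuous Cu).
have [C1 C2] := Ck_elim i Cu; exists (fun x => 'D_(e i) u (x + c)); first exact: (IH _ C1).
by move=> x; exact: is_derive_shiftV.
Qed.

End shift_calculus.

Lemma line_MVT_bound {R : realType} {V : normedModType R} (u d : V -> R) (v x : V) (s C : R) :
  (forall x, is_derive x v u (d x)) -> (forall x, `|d x| <= C) ->
  `|u (s *: v + x) - u x| <= C * `|s|.
Proof.
move=> du dC.
pose g h := u (h *: v + x).
have dg h : is_derive h (1 : R) g (d (h *: v + x)).
  have /is_derive_line h1 := du (h *: v + x).
  have -> : g = fun t : R => (fun t : R => u (t *: v + (h *: v + x))) (t + - h).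
    by apply/funext => t; rewrite /g addrA -scalerDl subrK.
  apply: (@is_derive_shiftV R R (fun t : R => u (t *: v + (h *: v + x))) (- h) h 1).
  by rewrite subrr.
have cg : continuous g.
  by move=> r; apply/differentiable_continuous/derivable1_diffP; have [] := dg r.
have key a b : a <= b -> `|g b - g a| <= C * (b - a).
  move=> ab; have [r _ ->] := MVT_segment ab (fun r _ => dg r) (continuous_subspaceT cg).
  by rewrite normrM (ger0_norm (x := b - a)) ?subr_ge0// ler_wpM2r ?subr_ge0.
have g0 : g 0 = u x by rewrite /g scale0r add0r.
have [s0|s0] := leP 0 s.
  by have := key _ _ s0; rewrite g0 subr0 (ger0_norm s0).
by have := key _ _ (ltW s0); rewrite g0 sub0r distrC (ltr0_norm s0).
Qed.

Lemma in_L1_measurable {R : realType} {n : nat} (f : 'rV[R]_n -> R) :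
  in_L1 f -> measurable_fun setT f.
Proof. by move=> fi; apply/measurable_EFinP; exact: measurable_int fi. Qed.

(** * Translation estimate for functions of bounded variation *)

Section bv_estimates.
Context {R : realType} {n : nat}.
Local Notation Rn := 'rV[R]_n.
Local Notation leb := (lebesgue_rV R n).
Implicit Types (f u : Rn -> R) (i : 'I_n).

Lemma smooth_shift u c : smooth u -> smooth (fun x => u (x + c)).
Proof. by move=> su k; apply: Ck_shift. Qed.

(** The increment is split along the axes, and subadditivity absorbs one axis at a time. It is
    applied to the L^1 modulus of a BV function and to the uniform modulus of a smooth field. *)
Lemma telescoping (N : Rn -> \bar R) (C : R) : N 0 = 0%E ->
  (forall h k, (N (h + k)%R <= N h + N k)%E) ->
  (forall i s, (N (s *: vbase i) <= (`|s| * C)%:E)%E) ->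
  forall h, (N h <= ((\sum_i `|h ord0 i|) * C)%:E)%E.
Proof.
move=> N0 Nadd Nb h.
have {1}-> : h = \sum_i h ord0 i *: vbase i.
  rewrite [LHS]row_sum_delta; apply: eq_bigr => i _; by [].
elim: (index_enum _) => [|i s IH]; first by rewrite !big_nil N0 mul0r.
rewrite !big_cons mulrDl EFinD; apply: (le_trans (Nadd _ _)); exact: leeD.
Qed.

Lemma sum_le_enorm (h : Rn) : \sum_i `|h ord0 i| <= n%:R * enorm h.
Proof.
rewrite mulr_natl -[X in _ *+ X]card_ord -sumr_const.
by apply: ler_sum => i _; exact: coord_le_enorm.
Qed.

Lemma Linfty_norm_le1 (phi : Rn -> Rn) : (forall x, enorm (phi x) <= 1) ->
  (Linfty_norm phi <= 1)%E.
Proof.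
(* The norm of exponent +oo is 0 by convention when the whole space is null, hence the two cases. *)
move=> h; rewrite /Linfty_norm unlock /=; case: ifPn => [_|_]; last exact: lee01.
apply/ess_supP; apply/aeW => x /=.
by rewrite lee_fin ger0_norm ?enorm_ge0.
Qed.

(** The test field is u e_i, whose divergence is the i-th partial derivative of [u]. *)
Lemma bv_pairing f u (d : Rn -> R) i (M : R) : smooth u ->
  (forall x, ~ rV_cube M x -> u x = 0) -> (forall x, `|u x| <= 1) ->
  (forall x, is_derive x (vbase i) u (d x)) ->
  (\int[leb]_x (f x * d x)%:E <= Defs.variation f)%E.
Proof.
move=> su uM u1 ud; apply: ereal_sup_ubound.
exists (fun x => u x *: vbase i); last first.
  apply: eq_integral => x _; congr (f x * _)%:E.
  by apply: divergence_scale => // j; have [_ /(_ x)[]] := Ck_elim j (su 1%N).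
split; first exact: Cinfty_c_scale uM.
by apply: Linfty_norm_le1 => x; rewrite enormZ enorm_delta mulr1.
Qed.

Lemma testfun_bounded u : testfun u -> exists2 C, 0 <= C & forall x, `|u x| <= C.
Proof.
elim=> [b hb|c u1 u2 _ [C1 C10 h1] _ [C2 C20 h2]]; last first.
  exists (`|c| * C1 + C2) => [|x]; first by rewrite addr_ge0// mulr_ge0.
  by apply: (le_trans (ler_normD _ _)); rewrite normrM lerD// ler_wpM2l.
have h j : exists C, 0 <= C /\ forall t, `|b j t| <= C.
  have [sb [M M0 bM]] := hb j.
  have cb : continuous (b j) := Ck_continuous (sb 0%N).
  have MM : - M <= M :> R by have : (0 : R) <= M := M0; lra.
  have cn : {within `[- M, M], continuous (fun t => `|b j t|)}.
    by apply: continuous_subspaceT => t; apply: cvg_norm; exact: cb.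
  have [t _ ht] := EVT_max MM cn.
  exists (`|b j t|); split => // s.
  have [sM|sM] := leP `|s| M; last by rewrite bM ?normr0// ltW.
  by apply: ht; rewrite in_itv/= -ler_norml.
have [F hF] := choice h; exists (\prod_j F j) => [|x].
  by apply: prodr_ge0 => j _; have [] := hF j.
rewrite /tensor normr_prod; apply: ler_prod => j _.
by rewrite normr_ge0; have [_] := hF j; exact.
Qed.

Lemma integrable_Mbounded f (g : Rn -> R) (C : R) : in_L1 f -> measurable_fun setT g ->
  (forall x, `|g x| <= C) -> leb.-integrable setT (fun x => (f x * g x)%:E).
Proof.
move=> fi mg gC.
have mf : measurable_fun setT f by exact: in_L1_measurable.
have C0 : 0 <= C by apply: le_trans (gC 0).
apply: (@le_integrable _ _ _ _ _ measurableT _ (fun x => (C%:E * (f x)%:E)%E)).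
- by apply/measurable_EFinP; exact: measurable_funM.
- move=> x _; rewrite -EFinM !abse_EFin lee_fin !normrM (ger0_norm C0) mulrC.
  by rewrite ler_wpM2r.
- by apply: integrableZl.
Qed.

Lemma in_L1_shift f c : in_L1 f -> in_L1 (fun x => f (x + c)).
Proof. by move=> fi; exact: (@integrable_shift R n c (EFin \o f)). Qed.

Lemma bv_shift_pairing f (V : R) i s u : in_L1 f -> (Defs.variation f <= V%:E)%E ->
  testfun u -> (forall x, `|u x| <= 1) ->
  (\int[leb]_x ((f x - f (x + s *: vbase i)) * u x)%:E <= (`|s| * V)%:E)%E.
Proof.
move=> fi fV tu u1.
have [->|s0] := eqVneq s 0.
  under eq_integral do rewrite scale0r addr0 subrr mul0r.
  by rewrite integral0 normr0 mul0r.
have mu : measurable_fun setT u by exact: testfun_measurable.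
have mf : measurable_fun setT f by exact: in_L1_measurable.
pose e := s *: vbase i.
have mue : measurable_fun setT (fun x : Rn => u (x - e)).
  by apply: (@measurableT_comp _ _ _ _ _ _ u _ (fun x : Rn => x - e)) => //; exact: measurable_rVD.
have I1 := integrable_Mbounded fi mu u1.
have I2 := @integrable_Mbounded f (fun x : Rn => u (x - e)) 1 fi mue (fun x => u1 _).
have I3 := @integrable_Mbounded _ u 1 (in_L1_shift e fi) mu u1.
have -> : (\int[leb]_x ((f x - f (x + e)) * u x)%:E =
   \int[leb]_x (f x * (u x - u (x - e)))%:E)%E.
  transitivity (\int[leb]_x (f x * u x)%:E - \int[leb]_x (f (x + e) * u x)%:E)%E.
    by rewrite -integralB_EFin//; apply: eq_integral => x _; rewrite -EFinB mulrBl.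
  transitivity (\int[leb]_x (f x * u x)%:E - \int[leb]_x (f x * u (x - e))%:E)%E.
    congr (_ - _)%E.
    rewrite -(@integral_shift R n e (fun x => (f x * u (x - e))%:E)); last first.
      by apply/measurable_EFinP; exact: measurable_funM.
    by apply: eq_integral => x _; rewrite addrK.
  by rewrite -integralB_EFin//; apply: eq_integral => x _; rewrite -EFinB mulrBr.
have [P [sP dP PM]] := testfun_primitive i tu.
have [M hM] := PM s.
have s0' : 0 < `|s| by rewrite normr_gt0.
(* Division by |s| makes [w] admissible: the derivative of [P] along e_i is [u], at most 1 in
   absolute value, so the mean value theorem gives |w| <= 1. *)
pose w x := (P x - P (x - e)) * `|s|^-1.
have := @bv_pairing f w (fun x => (u x - u (x - e)) * `|s|^-1) i M _ _ _ _.
have {I3}I3 : leb.-integrable setT (fun x => (f x * (u x - u (x - e)))%:E).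
  apply: (@eq_integrable _ _ _ _ _ measurableT (fun x => ((f x * u x)%:E - (f x * u (x - e))%:E)%E)).
    by move=> x _; rewrite -EFinB -mulrBr.
  exact: integrableB.
have -> : (\int[leb]_x (f x * ((u x - u (x - e)) * `|s|^-1))%:E =
    `|s|^-1%:E * \int[leb]_x (f x * (u x - u (x - e)))%:E)%E.
  rewrite -integralZl//; apply: eq_integral => x _; rewrite -EFinM; congr EFin; ring.
move=> H.
have {H} : (`|s|^-1%:E * \int[leb]_x (f x * (u x - u (x - e)))%:E <= V%:E)%E.
  apply: le_trans fV; apply: H.
  - move=> k; apply: CkM; last exact: Ck_cst.
    apply: CkD => //; have := @CkM _ _ _ _ k _ _ (Ck_cst _ k (-1)) (smooth_shift (- e) sP k).
    by under eq_fun do rewrite mulN1r.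
  - by move=> x xM; rewrite /w -(hM x xM) subrr mul0r.
  - move=> x; rewrite /w normrM normfV normr_id -ler_pdivlMr ?invr_gt0// invrK.
    have := line_MVT_bound (x - e) s dP u1; rewrite (addrC (s *: _)) subrK.
    exact.
  - move=> x; rewrite mulrC.
    have h1 := is_derive_shiftV (c := - e) (dP (x - e)).
    have h2 := is_deriveZ `|s|^-1 (is_deriveB (dP x) h1).
    rewrite (_ : w = `|s|^-1 *: (P - (fun x => P (x - e))))//.
    by apply/funext => y; rewrite /w mulrC.
rewrite -(fineK (integrable_fin_num _ I3))// -EFinM !lee_fin => H.
by rewrite mulrC -ler_pdivrMr// mulrC.
Qed.

(** The sign of [u] is approximated by g = 2 P h - P, where h approximates the indicator of u > 0
    and P is a plateau. With D and E the weighted errors of h and P, |u| <= u g + 2 D + E pointwise;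
    each of the three error terms costs eps / 3. *)
Lemma L1_duality u (C : R) : in_L1 u ->
  (forall h, testfun h -> (forall x, `|h x| <= 1) -> (\int[leb]_x (u x * h x)%:E <= C%:E)%E) ->
  (\int[leb]_x `|u x|%:E <= C%:E)%E.
Proof.
move=> ui hC; apply/lee_addgt0Pr => eps eps0.
pose A := [set x | 0 < u x].
have mu : measurable_fun setT u by apply/measurable_EFinP; exact: measurable_int ui.
have mA : measurable A.
  rewrite (_ : A = u @^-1` `]0, +oo[); first by rewrite -[X in measurable X]setTI; exact: mu.
  by apply/seteqP; split => x /=; rewrite in_itv/= andbT.
pose w x := `|u x|.
have iw : leb.-integrable setT (EFin \o w) by exact: (integrable_abse ui).
have w0 x : 0 <= w x by exact: normr_ge0.
have e30 : 0 < eps / 3 by rewrite divr_gt0.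
have [_ /(_ _ e30)[h [th h01 hh]]] := @approximable_measurable R n leb w iw w0 A mA.
have [|||m hm] := @weighted_small _ _ _ leb w iw w0 (fun m x => plateau m x - 1) _ _ _ _ e30.
- by move=> m; apply: measurable_funB => //; apply: testfun_measurable; exact: plateau_testfun.
- move=> m x; have /andP[? ?] := @plateau01 R n m x.
  by rewrite ler_norml; apply/andP; split; lra.
- move=> x; rewrite -(subrr 1); apply: cvgB; last exact: cvg_cst.
  exact: plateau_cvg.
have tP := @plateau_testfun R n m; have P01 := @plateau01 R n m.
pose g x := 2 * (plateau m x * h x) + (-1 * plateau m x + 0).
have tg : testfun g.
  apply: testfun_lin; first exact: testfunM.
  by apply: testfun_lin => //; exact: testfun0.
have g1 x : `|g x| <= 1.
  have /andP[? ?] := P01 x; have /andP[? ?] := h01 x.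
  by rewrite /g ler_norml; apply/andP; split; nra.
have mg := testfun_measurable tg; have mP := testfun_measurable tP.
have mh := testfun_measurable th.
have mi : measurable_fun setT (\1_A : Rn -> R) by apply/measurable_indicP.
have := hC g tg g1 => ug.
have Iug := integrable_Mbounded ui mg g1.
pose D x := `|h x - \1_A x| * w x; pose E x := `|plateau m x - 1| * w x.
have mw : measurable_fun setT w by exact: measurableT_comp.
have mD : measurable_fun setT (fun x => (D x)%:E).
  apply/measurable_EFinP; apply: measurable_funM => //; apply: measurableT_comp => //.
  exact: measurable_funB.
have mE : measurable_fun setT (fun x => (E x)%:E).
  apply/measurable_EFinP; apply: measurable_funM => //; apply: measurableT_comp => //.
  exact: measurable_funB.
have D0 x : (0 <= (D x)%:E)%E by rewrite lee_fin mulr_ge0.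
have E0 x : (0 <= (E x)%:E)%E by rewrite lee_fin mulr_ge0.
have ID : leb.-integrable setT (fun x => (D x)%:E).
  apply/integrableP; split => //.
  under eq_integral do rewrite gee0_abs//.
  by apply: le_lt_trans hh _; rewrite ltry.
have IE : leb.-integrable setT (fun x => (E x)%:E).
  apply/integrableP; split => //.
  under eq_integral do rewrite gee0_abs//.
  by apply: le_lt_trans hm _; rewrite ltry.
apply: (@le_trans _ _ (\int[leb]_x ((u x * g x)%:E + ((D x)%:E + ((D x)%:E + (E x)%:E))))%E).
  apply: le_integral => //.
  - by apply: integrableD => //; apply: integrableD => //; exact: integrableD.
  - move=> x _; rewrite -!EFinD lee_fin /D /E /w /g.
    have /andP[p0 p1] := P01 x; have /andP[k0 k1] := h01 x.
    rewrite indicE; have [xA|xA] := pselect (A x).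
      rewrite mem_set//; have u0 : 0 < u x by [].
      rewrite (gtr0_norm u0) (@ler0_norm _ (h x - 1%:R)) ?subr_le0//.
      rewrite (@ler0_norm _ (plateau m x - 1)) ?subr_le0//.
      (* Twice this product is exactly the gap in the pointwise inequality; where u <= 0 the
         corresponding product is -u (1 - P) h. *)
      have : 0 <= u x * ((1 - plateau m x) * (1 - h x)).
        by rewrite !mulr_ge0 ?subr_ge0// ltW.
      by move=> ?; nra.
    rewrite memNset//; have u0 : u x <= 0 by rewrite leNgt; apply/negP.
    rewrite (ler0_norm u0) subr0 (ger0_norm k0).
    rewrite (@ler0_norm _ (plateau m x - 1)) ?subr_le0//.
    have : 0 <= - u x * ((1 - plateau m x) * h x).
      by rewrite !mulr_ge0 ?subr_ge0 ?oppr_ge0.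
    by move=> ?; nra.
rewrite integralD//; last first.
  by apply: integrableD => //; exact: integrableD.
rewrite integralD//; last exact: integrableD.
rewrite integralD//.
apply: leeD => //.
apply: (@le_trans _ _ ((eps / 3)%:E + ((eps / 3)%:E + (eps / 3)%:E))%E).
  by apply: leeD => //; apply: leeD.
by rewrite -!EFinD lee_fin; lra.
Qed.

Definition shift_L1 f (h : Rn) : \bar R := (\int[leb]_x `|f (x + h)%R - f x|%:E)%E.

Lemma shift_L1_ge0 f h : (0 <= shift_L1 f h)%E.
Proof. by apply: integral_ge0 => x _; rewrite lee_fin. Qed.

Lemma measurable_shift_diff f (h : Rn) : measurable_fun setT f ->
  measurable_fun setT (fun x : Rn => (`|f (x + h) - f x|)%:E).
Proof.
move=> mf; apply/measurable_EFinP; apply: measurableT_comp => //.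
apply: measurable_funB => //.
by apply: (@measurableT_comp _ _ _ _ _ _ f _ (fun x : Rn => x + h)) => //; exact: measurable_rVD.
Qed.

(** Along one axis, [L1_duality] turns the pairings into a norm bound. For general increments,
    subadditivity comes from the triangle inequality and translation invariance. *)
Lemma bv_shift_L1 f (V : R) h : in_L1 f -> (Defs.variation f <= V%:E)%E ->
  (shift_L1 f h <= ((\sum_i `|h ord0 i|) * V)%:E)%E.
Proof.
move=> fi fV.
have mf : measurable_fun setT f by exact: in_L1_measurable.
apply: telescoping => [|a b|i s].
- rewrite /shift_L1; under eq_integral do rewrite addr0 subrr normr0.
  exact: integral0.
- rewrite /shift_L1.
  rewrite -(@ge0_integral_shift R n a _ (measurable_shift_diff b mf))//.
  rewrite -ge0_integralD//; last 2 first.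
  + exact: measurable_shift_diff.
  + apply: (@measurableT_comp _ _ _ _ _ _ (fun x : Rn => (`|f (x + b) - f x|)%:E) _ (fun x : Rn => x + a)).
      exact: measurable_shift_diff.
    exact: measurable_rVD.
  apply: ge0_le_integral => //.
  + exact: measurable_shift_diff.
  + apply: emeasurable_funD; first exact: measurable_shift_diff.
    apply: (@measurableT_comp _ _ _ _ _ _ (fun x : Rn => (`|f (x + b) - f x|)%:E) _ (fun x : Rn => x + a)).
      exact: measurable_shift_diff.
    exact: measurable_rVD.
  + move=> x _; rewrite -EFinD lee_fin addrA.
    by apply: le_trans (ler_normD _ _); rewrite [X in _ <= `|X|]addrC subrKA.
- have := @L1_duality (fun x => f x - f (x + s *: vbase i)) (`|s| * V) _ _.
  rewrite /shift_L1; under eq_integral do rewrite distrC.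
  apply.
    have := in_L1_shift (s *: vbase i) fi; rewrite /in_L1 => fs.
    by have := integrableB measurableT fi fs; apply: eq_integrable.
  by move=> u tu u1; exact: bv_shift_pairing.
Qed.

End bv_estimates.

(** * The fractional seminorm as an integral of L^1 moduli *)

Section gagliardo.
Context {R : realType} {n : nat}.
Local Notation Rn := 'rV[R]_n.
Local Notation leb := (lebesgue_rV R n).
Implicit Types (f : Rn -> R).

Lemma measurable_rVDV d (T : measurableType d) (g h : T -> Rn) :
  measurable_fun setT g -> measurable_fun setT h -> measurable_fun setT (fun t => g t + h t).
Proof.
move=> mg mh; apply: measurable_fun_rVP => i.
rewrite (_ : _ \o _ = fun t => rV_coord i (g t) + rV_coord i (h t)).
  by apply: measurable_funD; apply: measurableT_comp => //; exact: measurable_rV_coord.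
by apply/funext => x; rewrite /rV_coord /= mxE.
Qed.

Lemma measurable_shift_diff2 f : measurable_fun setT f ->
  measurable_fun setT (fun p : Rn * Rn => f (p.1 + p.2) - f p.1).
Proof.
move=> mf; apply: measurable_funB; last exact: measurableT_comp.
by apply: measurableT_comp => //; exact: measurable_rVDV.
Qed.

Lemma measurable_shift_L1 f : measurable_fun setT f -> measurable_fun setT (shift_L1 f).
Proof.
move=> mf.
have := @measurable_fun_fubini_tonelli_G _ _ _ _ R leb
  (fun p : Rn * Rn => (`|f (p.1 + p.2) - f p.1|)%:E); apply => //.
by apply/measurable_EFinP; apply: measurableT_comp => //; exact: measurable_shift_diff2.
Qed.

Lemma measurable_kernel2 p d (T : measurableType d) (g : T -> Rn) :
  measurable_fun setT g -> measurable_fun setT (fun t => kernel p (g t)).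
Proof. by move=> mg; apply: measurableT_comp => //; exact: measurable_kernel. Qed.

Lemma measurable_shift_kernel f q : measurable_fun setT f ->
  measurable_fun setT (fun p : Rn * Rn => (`|f (p.1 + p.2) - f p.1| * kernel q p.2)%:E).
Proof.
move=> mf; apply/measurable_EFinP; apply: measurable_funM; last exact: measurable_kernel2.
by apply: measurableT_comp => //; exact: measurable_shift_diff2.
Qed.

Lemma W_seminorm_diff alpha f : measurable_fun setT f ->
  W_seminorm alpha f =
  (\int[leb]_y \int[leb]_z (`|f (y + z)%R - f y| * kernel (n%:R + alpha) z)%:E)%E.
Proof.
move=> mf; set q := n%:R + alpha.
apply: eq_integral => y _.
rewrite -(@ge0_integral_shift R n y (fun x => (`|f x - f y| / enorm (x - y) `^ q)%:E)); last 2 first.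
- apply/measurable_EFinP; apply: measurable_funM.
    by apply: measurableT_comp => //; exact: measurable_funB.
  by apply: (@measurable_kernel2 q _ _ (fun x : Rn => x - y)); exact: measurable_rVD.
- by move=> x; rewrite lee_fin mulr_ge0 ?(kernel_ge0 q).
by apply: eq_integral => z _; rewrite addrK (addrC y).
Qed.

(** In the variables y and z = x - y, Tonelli isolates the L^1 modulus of continuity, the quantity
    that the variation controls. *)
Lemma W_seminorm_shift alpha f : measurable_fun setT f ->
  W_seminorm alpha f = (\int[leb]_z (shift_L1 f z * (kernel (n%:R + alpha) z)%:E))%E.
Proof.
move=> mf; rewrite W_seminorm_diff//; set q := n%:R + alpha.
have k0 (p : Rn * Rn) : (0 <= (`|f (p.1 + p.2) - f p.1| * kernel q p.2)%:E)%E.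
  by rewrite lee_fin mulr_ge0 ?kernel_ge0.
rewrite (@fubini_tonelli _ _ _ _ R leb leb _ (measurable_shift_kernel q mf) k0).
apply: eq_integral => z _; rewrite /= muleC /shift_L1 -ge0_integralZl//.
- by apply: eq_integral => y _; rewrite -EFinM mulrC.
- exact: measurable_shift_diff.
- by rewrite lee_fin kernel_ge0.
Qed.

Lemma shift_L1_le f h : in_L1 f -> (shift_L1 f h <= L1_norm f + L1_norm f)%E.
Proof.
move=> fi; have mf : measurable_fun setT f by exact: in_L1_measurable.
have ma : measurable_fun setT (fun x => (`|f x|)%:E).
  by apply/measurable_EFinP; exact: measurableT_comp.
rewrite /L1_norm Lnorm1 -{1}(@ge0_integral_shift R n h (fun x => (`|f x|)%:E))//.
have mah : measurable_fun setT (fun x : Rn => (`|f (x + h)|)%:E).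
  apply: (@measurableT_comp _ _ _ _ _ _ (fun x : Rn => (`|f x|)%:E) _ (fun x : Rn => x + h)) => //.
  exact: measurable_rVD.
rewrite -ge0_integralD//.
apply: ge0_le_integral => //.
- exact: measurable_shift_diff.
- exact: emeasurable_funD.
- by move=> x _; rewrite -EFinD lee_fin ler_normB.
Qed.

Lemma L1_norm_fin f : in_L1 f -> L1_norm f \is a fin_num.
Proof.
move=> fi; rewrite ge0_fin_numE ?Lnorm_ge0//.
by rewrite /L1_norm Lnorm1; have /integrableP[_] := fi.
Qed.

Lemma variation_ge0 f : (0 <= Defs.variation f)%E.
Proof.
apply: ereal_sup_ubound; exists (fun=> 0); last first.
  under eq_integral => x _.
    rewrite /divergence big1 ?mulr0; last first.
      move=> i _; rewrite /partial derive_cst mxE//.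
    over.
  exact: integral0.
have -> : (fun=> 0) = (fun x : Rn => (fun=> 0 : R) x *: (0 : Rn)) by apply/funext => x; rewrite scaler0.
split; first by apply: (@Cinfty_c_scale R n _ _ 0) => // k; exact: Ck_cst.
by apply: Linfty_norm_le1 => x; rewrite scaler0 enorm0.
Qed.

(** With V the variation and L the L^1 norm, the modulus is at most n V |h| by the translation
    estimate and at most 2 L by the triangle inequality; this yields n C1 and 2 C2. The summand 1
    accounts for the L^1 part of the norm and makes the constant positive. *)
Lemma bv_W_bound (alpha : R) : (0 < n)%N -> 0 < alpha < 1 ->
  exists2 c : R, 0 < c & forall f, in_BV f ->
    in_W alpha f /\ (W_norm alpha f <= c%:E * BV_norm f)%E.
Proof.
move=> n0 a01; have [C1 [C2 [C10 C20 hC]]] := @kernel_int_bound R n alpha n0 a01.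
exists (1 + n%:R * C1 + 2 * C2) => [|f [fi fV]].
  have := mulr_ge0 (ler0n R n) C10; have := mulr_ge0 (ler0n R 2) C20; lra.
have mf : measurable_fun setT f by exact: in_L1_measurable.
have Vfin : Defs.variation f \is a fin_num by rewrite ge0_fin_numE ?variation_ge0.
have Lfin := L1_norm_fin fi.
set V := fine (Defs.variation f); set L := fine (L1_norm f).
have VE : Defs.variation f = V%:E by rewrite fineK.
have LE : L1_norm f = L%:E by rewrite fineK.
have V0 : 0 <= V by rewrite fine_ge0// variation_ge0.
have L0 : 0 <= L by rewrite fine_ge0// Lnorm_ge0.
have Wle : (W_seminorm alpha f <= (n%:R * V * C1 + 2 * L * C2)%:E)%E.
  rewrite W_seminorm_shift//; apply: hC.
  - by rewrite mulr_ge0.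
  - by rewrite mulr_ge0.
  - exact: measurable_shift_L1.
  - by move=> z; exact: shift_L1_ge0.
  - move=> z; have := @bv_shift_L1 R n f V z fi; rewrite VE => /(_ (lexx _)) h.
    apply: (le_trans h); rewrite lee_fin mulrAC; apply: ler_wpM2r => //.
    exact: sum_le_enorm.
  - move=> z; apply: (le_trans (shift_L1_le z fi)).
    by rewrite LE -EFinD lee_fin; lra.
split; first by split => //; apply: le_lt_trans Wle _; rewrite ltry.
rewrite /W_norm /BV_norm VE LE -EFinD -EFinM.
apply: (le_trans (leeD2l _ Wle)); rewrite -EFinD lee_fin.
have h1 : 0 <= V by []. have h2 : 0 <= L by [].
have h3 : 0 <= (n%:R : R) by [].
have : 0 <= n%:R * C1 * L by rewrite !mulr_ge0.
have : 0 <= C2 * V by rewrite !mulr_ge0.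
by move=> ? ?; nra.
Qed.

End gagliardo.

Lemma lipschitz_norm_continuous {R : realType} {V : normedModType R} (u : V -> R) (C : R) :
  (forall x y, `|u y - u x| <= C * `|y - x|) -> continuous u.
Proof.
move=> uC x; apply/cvgrPdist_le => e e0; near=> y.
rewrite distrC; apply: (le_trans (uC x y)).
have C1 : 0 < `|C| + 1 by rewrite ltr_wpDl.
apply: (@le_trans _ _ ((`|C| + 1) * `|y - x|)).
  by apply: ler_wpM2r => //; apply: (le_trans (ler_norm _)); rewrite lerDl.
rewrite -ler_pdivlMl// mulrC distrC; near: y.
by apply: cvgr_dist_le; [exact: cvg_id|rewrite divr_gt0].
Unshelve. all: by end_near. Qed.

(** * Lipschitz and smooth fields with compact support *)

Section lipschitz.
Context {R : realType} {n : nat}.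
Local Notation Rn := 'rV[R]_n.
Local Notation leb := (lebesgue_rV R n).
Implicit Types (f u : Rn -> R) (phi : Rn -> Rn).

(** The two bounds that [kernel_int_bound] consumes, with the Lipschitz condition in terms of the
    increment z. *)
Definition lipbound (L M : R) u : Prop :=
  (forall x z, `|u (x + z) - u x| <= L * enorm z) /\ (forall x, `|u x| <= M).

Lemma coord_le_norm (x : Rn) i : `|x ord0 i| <= `|x|.
Proof.
rewrite [in leRHS]/Num.norm/= mx_normrE.
exact: (le_bigmax _ (fun p => `|x p.1 p.2|) (ord0, i)).
Qed.

Lemma enorm_le_norm (x : Rn) : enorm x <= n%:R * `|x|.
Proof.
apply: (le_trans (enorm_le_sum _)).
rewrite mulr_natl -[X in _ *+ X]card_ord -sumr_const.
by apply: ler_sum => i _; exact: coord_le_norm.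
Qed.

(** The topology is that of the sup norm while the Lipschitz condition is Euclidean; the factor n
    compares the two norms. *)
Lemma lipschitz_continuous (L : R) u :
  (forall x z : Rn, `|u (x + z) - u x| <= L * enorm z) -> continuous u.
Proof.
move=> uL; apply: (@lipschitz_norm_continuous R Rn u (`|L| * n%:R)) => x y.
have -> : u y - u x = u (x + (y - x)) - u x by rewrite (addrC x) subrK.
apply: (le_trans (uL _ _)); apply: (@le_trans _ _ (`|L| * enorm (y - x))).
  by apply: ler_wpM2r; [exact: enorm_ge0|exact: ler_norm].
by rewrite -mulrA; apply: ler_wpM2l => //; exact: enorm_le_norm.
Qed.

Lemma lipschitz_measurable (L : R) u :
  (forall x z, `|u (x + z) - u x| <= L * enorm z) -> measurable_fun setT u.
Proof. by move=> uL; apply: continuous_rV_measurable; exact: lipschitz_continuous uL. Qed.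

Lemma compact_support_cubeP phi : compact_support phi ->
  exists2 M, 0 <= M & forall x, ~ rV_cube M x -> phi x = 0.
Proof.
move=> /compact_bounded[M [_ hM]]; exists (`|M| + 1); first by rewrite addr_ge0.
move=> x; apply: contra_notP => /eqP phix.
have /hM : M < `|M| + 1 by apply: le_lt_trans (ler_norm _) _; rewrite ltrDl.
move=> /(_ x (@subset_closure _ [set x | phi x != 0] x phix)) xM; apply/rV_cubeP => i.
exact: le_trans (coord_le_norm x i) xM.
Qed.

Lemma Lip_c_lipbound phi (i0 : 'I_n) : Lip_c phi ->
  exists L M, [/\ 0 <= L, 0 <= M & forall i, lipbound L M (fun x => phi x ord0 i)].
Proof.
move=> [[L hL] /compact_support_cubeP[M M0 hM]].
have L1 i x z : `|phi (x + z) ord0 i - phi x ord0 i| <= `|L| * enorm z.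
  have := coord_le_enorm (phi (x + z) - phi x) i; rewrite !mxE => h.
  apply: (le_trans h); apply: (le_trans (hL _ _)).
  rewrite [x + z]addrC addrK; apply: ler_wpM2r; first exact: enorm_ge0.
  exact: ler_norm.
exists `|L|, (`|L| * (M + M + 1)); split => //.
  by rewrite mulr_ge0// !addr_ge0.
move=> i; split => // x.
have [xM|xM] := pselect (rV_cube M x); last by rewrite hM// mxE normr0 mulr_ge0// !addr_ge0.
(* From a point of the cube [-M, M]^n, a step of length 2M + 1 along one axis leaves it; [phi]
   vanishes there, so the Lipschitz condition over this step bounds [phi]. *)
have h0 : phi (x + (M + M + 1) *: vbase i0) = 0.
  apply: hM => /rV_cubeP /(_ i0); rewrite !mxE !eqxx mulr1.
  move/rV_cubeP: xM => /(_ i0).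
  rewrite !ler_norml => /andP[? ?] /andP[? ?].
  have : (0 : R) <= M := M0; lra.
have := L1 i x ((M + M + 1) *: vbase i0).
rewrite h0 mxE sub0r normrN enormZ enorm_delta mulr1 (@ger0_norm _ (M + M + 1))//.
by rewrite !addr_ge0.
Qed.

(** The partial derivatives are continuous and vanish off the closed support, hence are bounded;
    [telescoping], applied to the supremum over x of the increments, makes this a global Lipschitz
    constant. Smooth test fields thereby enter the integration by parts. *)
Lemma Cinfty_c_Lip_c phi : Cinfty_c phi -> Lip_c phi.
Proof.
move=> [Cphi cs]; split => //.
have [cphi C1] := Cphi 1%N.
have [M0 M00 suppM] := compact_support_cubeP cs.
have dbound (ij : 'I_n * 'I_n) : exists M, 0 <= M /\ forall x, `|partial ij.1 phi x ord0 ij.2| <= M.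
  have [dphi [cpart _]] := C1 ij.1.
  have cj : continuous (fun x => partial ij.1 phi x ord0 ij.2).
    move=> x; apply: (@continuous_comp _ _ _ (partial ij.1 phi) (fun v : Rn => v ord0 ij.2)).
      exact: cpart.
    exact: coord_continuous.
  have /compact_bounded[B [_ hB]] : compact ((fun x => partial ij.1 phi x ord0 ij.2) @` closure [set x | phi x != 0]).
    by apply: continuous_compact => //; exact: continuous_subspaceT.
  exists (`|B| + 1); split; first by rewrite addr_ge0.
  move=> x; have [xS|xS] := pselect (closure [set x | phi x != 0] x).
    apply: (hB (`|B| + 1)); first by apply: le_lt_trans (ler_norm _) _; rewrite ltrDl.
    by exists x.
  rewrite (_ : partial ij.1 phi x = 0); first by rewrite mxE normr0 addr_ge0.
  rewrite /partial (@near_eq_derive _ _ _ phi (cst 0)) ?derive_cst//.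
  have : nbhs x (~` closure [set x | phi x != 0]).
    by apply: open_nbhs_nbhs; split => //; apply: closed_openC; exact: closed_closure.
  apply: filterS => y yS; apply/eqP; apply: contra_notT yS => ?.
  exact: subset_closure.
have [F hF] := choice dbound.
pose M := \sum_ij F ij.
have FM ij : F ij <= M.
  by rewrite /M (bigD1 ij)//= lerDl; apply: sumr_ge0 => k _; have [] := hF k.
have dj i j x : is_derive x (vbase i) (fun x => phi x ord0 j) (partial i phi x ord0 j).
  have [dphi _] := C1 i; have := dphi x => dx.
  have /derivable_mxP/(_ ord0 j) d1 := dx.
  split => //; rewrite /partial derive_mx// mxE//.
have key j h x : `|phi (x + h) ord0 j - phi x ord0 j| <= (n%:R * enorm h) * M.
  pose N (h : Rn) := ereal_sup [set (`|phi (x + h) ord0 j - phi x ord0 j|)%:E | x in setT].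
  have Nub h' x' : ((`|phi (x' + h') ord0 j - phi x' ord0 j|)%:E <= N h')%E.
    by apply: ereal_sup_ubound; exists x'.
  have Nh : (N h <= ((\sum_i `|h ord0 i|) * M)%:E)%E.
    apply: telescoping.
    - apply/eqP; rewrite eq_le; apply/andP; split.
        by apply: ub_ereal_sup => _ [y _ <-]; rewrite addr0 subrr normr0.
      by apply: le_trans (Nub 0 0); rewrite lee_fin.
    - move=> a b; apply: ub_ereal_sup => _ [y _ <-].
      apply: le_trans (leeD (Nub a y) (Nub b (y + a))).
      rewrite -EFinD lee_fin addrA.
      by apply: le_trans (ler_normD _ _); rewrite [X in _ <= `|X|]addrC subrKA.
    - move=> i s; apply: ub_ereal_sup => _ [y _ <-]; rewrite lee_fin mulrC.
      have hb z : `|partial i phi z ord0 j| <= M.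
        by have [_ hz] := hF (i, j); exact: le_trans (hz z) (FM _).
      rewrite [y + _]addrC.
      exact: (@line_MVT_bound R _ (fun x : Rn => phi x ord0 j)
        (fun z => partial i phi z ord0 j) (vbase i) y s M (dj i j) hb).
  rewrite -lee_fin; apply: (le_trans (Nub h x)); apply: (le_trans Nh).
  rewrite lee_fin; apply: ler_wpM2r; first by apply: sumr_ge0 => ij _; have [] := hF ij.
  exact: sum_le_enorm.
exists (\sum_(j < n) (n%:R * M)) => x y.
apply: (le_trans (enorm_le_sum _)); rewrite mulr_suml; apply: ler_sum => j _.
have := key j (x - y) y; rewrite (addrC y) subrK !mxE => hk.
by apply: (le_trans hk); rewrite mulrAC.
Qed.

End lipschitz.

(** * Moving the fractional difference from one function to the other *)

Section integration_by_parts.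
Context {R : realType} {n : nat} (alpha : R).
Hypotheses (n0 : (0 < n)%N) (alpha01 : 0 < alpha < 1).
Local Notation Rn := 'rV[R]_n.
Local Notation leb := (lebesgue_rV R n).
Implicit Types (f u : Rn -> R) (phi : Rn -> Rn) (i : 'I_n).
Local Notation q := (n%:R + alpha).

Let q0 : 0 < q.
Proof. by case/andP: alpha01 => a0 _; rewrite ltr_wpDl. Qed.

Definition riesz i (z : Rn) : R := z ord0 i * kernel (q + 1) z.

Lemma rieszN i z : riesz i (- z) = - riesz i z.
Proof. by rewrite /riesz kernelN mxE mulNr. Qed.

Lemma riesz_le i z : `|riesz i z| <= kernel q z.
Proof.
rewrite normrM (ger0_norm (kernel_ge0 _ _)) -(kernel_decomp z q0).
by apply: ler_wpM2r; [exact: kernel_ge0|exact: coord_le_enorm].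
Qed.

Lemma measurable_riesz i : measurable_fun setT (riesz i).
Proof. by apply: measurable_funM; [exact: measurable_rV_coord|exact: measurable_kernel]. Qed.

(** The pair is (base point, increment): the kernel then depends on the second variable alone, and
    translations and the reflection act on separate variables. *)
Definition riesz_diff i f (p : Rn * Rn) : R := riesz i p.2 * (f (p.1 + p.2) - f p.1).

Lemma measurable_riesz_diff i f : measurable_fun setT f -> measurable_fun setT (riesz_diff i f).
Proof.
move=> mf; apply: measurable_funM; last exact: measurable_shift_diff2.
by apply: measurableT_comp => //; exact: measurable_riesz.
Qed.

Lemma riesz_diff_le i f p : `|riesz_diff i f p| <= `|f (p.1 + p.2) - f p.1| * kernel q p.2.
Proof. by rewrite normrM mulrC ler_wpM2l// riesz_le. Qed.

Lemma in_W_integrable_diff f : in_W alpha f ->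
  (leb \x leb)%E.-integrable setT
    (fun p : Rn * Rn => (`|f (p.1 + p.2) - f p.1| * kernel q p.2)%:E).
Proof.
move=> [fi fW]; have mf : measurable_fun setT f by exact: in_L1_measurable.
apply/(@integrable12ltyP _ _ _ _ R leb leb _ (measurable_shift_kernel q mf)).
rewrite W_seminorm_diff// in fW; apply: le_lt_trans fW.
rewrite le_eqVlt; apply/orP; left; apply/eqP.
apply: eq_integral => x _; apply: eq_integral => z _ /=.
by rewrite ger0_norm// mulr_ge0 ?kernel_ge0.
Qed.

Lemma in_W_integrable_riesz i f : in_W alpha f ->
  (leb \x leb)%E.-integrable setT (EFin \o riesz_diff i f).
Proof.
move=> fW; have [fi _] := fW.
have mf : measurable_fun setT f by exact: in_L1_measurable.
apply: le_integrable (in_W_integrable_diff fW) => //.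
  by apply/measurable_EFinP; exact: measurable_riesz_diff.
move=> p _; rewrite /= lee_fin (ger0_norm (x := _ * kernel _ _)) ?mulr_ge0 ?kernel_ge0//.
exact: riesz_diff_le.
Qed.

(** A real number even where the integral diverges. Agreement with the extended integral therefore
    needs integrability in z, which for [f] in W^{alpha,1} holds at almost every x. *)
Definition riesz_int i f (x : Rn) : R := \int[leb]_z riesz_diff i f (x, z).

Lemma frac_gradE f x i : measurable_fun setT f ->
  frac_grad alpha f x ord0 i = frac_const n alpha * riesz_int i f x.
Proof.
move=> mf; rewrite mxE; congr (_ * _); rewrite /riesz_int /Rintegral.
rewrite -(@integral_shift R n x); last first.
  apply/measurable_EFinP; apply: measurable_funM.
    apply: measurable_funM; last exact: measurable_funB.
    have := measurable_rV_coord (R := R) i; move=> /measurableT_comp; apply.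
    exact: measurable_rVD.
  apply: (@measurable_kernel2 R n (q + 1) _ _ (fun y : Rn => y - x)); exact: measurable_rVD.
congr fine; apply: eq_integral => z _; rewrite addrK /riesz_diff /riesz /kernel /= (addrC x).
by congr EFin; rewrite mulrAC.
Qed.

(** The bounds for the increment are L |z| and 2 M. The constant is independent of x, so the inner
    integral can be paired with any L^1 function. *)
Lemma lipbound_kernel_bound : exists C1 C2 : R, [/\ 0 <= C1, 0 <= C2 &
  forall L M u x, 0 <= L -> 0 <= M -> lipbound L M u ->
   (\int[leb]_z (`|u (x + z)%R - u x| * kernel q z)%:E <= (L * C1 + (M + M) * C2)%:E)%E].
Proof.
have [C1 [C2 [C10 C20 hC]]] := @kernel_int_bound R n alpha n0 alpha01.
exists C1, C2; split => // L M u x L0 M0 [uL uM].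
have mu := lipschitz_measurable uL.
apply: (hC L (M + M) (fun z => (`|u (x + z)%R - u x|)%:E)) => //.
- exact: addr_ge0.
- apply/measurable_EFinP; apply: measurableT_comp => //; apply: measurable_funB => //.
  under eq_fun do rewrite addrC.
  by apply: (@measurableT_comp _ _ _ _ _ _ u _ (fun z : Rn => z + x)) => //; exact: measurable_rVD.
- by move=> z; rewrite lee_fin; exact: uL.
- by move=> z; rewrite lee_fin; apply: (le_trans (ler_normB _ _)); exact: lerD.
Qed.

Lemma lipbound_integrable L M u x i : 0 <= L -> 0 <= M -> lipbound L M u ->
  leb.-integrable setT (fun z => (riesz_diff i u (x, z))%:E).
Proof.
move=> L0 M0 uLM; have [C1 [C2 [_ _ /(_ L M u x L0 M0 uLM) hC]]] := lipbound_kernel_bound.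
have mu := lipschitz_measurable uLM.1.
apply/integrableP; split.
  apply/measurable_EFinP.
  by have := measurable_riesz_diff i mu => /measurableT_comp; apply.
apply: le_lt_trans (ltry (L * C1 + (M + M) * C2)); apply: le_trans hC.
apply: ge0_le_integral => //.
- apply: measurableT_comp => //; apply/measurable_EFinP.
  by have := measurable_riesz_diff i mu => /measurableT_comp; apply.
- exact: (measurableT_comp (measurable_shift_kernel q mu) (measurable_pair1 x)).
- by move=> z _; rewrite /= lee_fin; exact: (@riesz_diff_le i u (x, z)).
Qed.

Lemma lipbound_integrable_prod L M u f i : 0 <= L -> 0 <= M -> lipbound L M u -> in_L1 f ->
  (leb \x leb)%E.-integrable setT (fun p => (f p.1 * riesz_diff i u p)%:E).
Proof.
move=> L0 M0 uLM fi; have [C1 [C2 [C10 C20 hC]]] := lipbound_kernel_bound.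
have mu := lipschitz_measurable uLM.1.
have mf : measurable_fun setT f by exact: in_L1_measurable.
have mF : measurable_fun setT (fun p : Rn * Rn => (f p.1 * riesz_diff i u p)%:E).
  apply/measurable_EFinP; apply: measurable_funM; last exact: measurable_riesz_diff.
  exact: measurableT_comp.
apply/(@integrable12ltyP _ _ _ _ R leb leb _ mF).
set C := L * C1 + (M + M) * C2.
apply: (@le_lt_trans _ _ (\int[leb]_x (C%:E * `|(f x)%:E|))%E).
  apply: ge0_le_integral => //.
  - by move=> x _; apply: integral_ge0.
  - apply: (@measurable_fun_fubini_tonelli_F _ _ _ _ R leb (fun p => `|(f p.1 * riesz_diff i u p)%:E|%E)) => //.
    exact: measurableT_comp.
  - by apply: measurable_funeM; apply: measurableT_comp => //; exact/measurable_EFinP.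
  move=> x _.
  under eq_integral do rewrite /= normrM EFinM.
  rewrite ge0_integralZl//; last first.
    apply/measurable_EFinP; apply: measurableT_comp => //.
    by have := measurable_riesz_diff i mu => /measurableT_comp; apply.
  rewrite muleC; apply: lee_wpmul2r => //; apply: le_trans (hC L M u x L0 M0 uLM).
  apply: ge0_le_integral => //.
  - apply/measurable_EFinP; apply: measurableT_comp => //.
    by have := measurable_riesz_diff i mu => /measurableT_comp; apply.
  - exact: (measurableT_comp (measurable_shift_kernel q mu) (measurable_pair1 x)).
  - by move=> z _; rewrite lee_fin; exact: (@riesz_diff_le i u (x, z)).
rewrite ge0_integralZl//.
- by rewrite lte_mul_pinfty ?lee_fin ?addr_ge0 ?mulr_ge0 ?addr_ge0//; have /integrableP[] := fi.
- by apply: measurableT_comp => //; exact/measurable_EFinP.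
- by rewrite lee_fin ?addr_ge0 ?mulr_ge0 ?addr_ge0.
Qed.

Lemma in_W_integrable_prod L M u f i : lipbound L M u -> in_W alpha f ->
  (leb \x leb)%E.-integrable setT (fun p => (u p.1 * riesz_diff i f p)%:E).
Proof.
move=> [uL uM] fW; have fR := in_W_integrable_riesz i fW.
have mu := lipschitz_measurable uL.
have M0 : 0 <= M by apply: le_trans (uM 0).
apply: (@le_integrable _ _ _ _ _ measurableT _ (fun p => (M%:E * (EFin \o riesz_diff i f) p)%E)).
- apply/measurable_EFinP; apply: measurable_funM; first exact: measurableT_comp.
  by apply/measurable_EFinP; exact: measurable_int fR.
- move=> p _; rewrite /= lee_fin !normrM (ger0_norm M0).
  by rewrite ler_wpM2r.
- exact: integrableZl.
Qed.

Lemma riesz_int_integrable i f : in_W alpha f ->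
  leb.-integrable setT (fun x => (riesz_int i f x)%:E).
Proof.
move=> fW; have := integrable_fubini_F (in_W_integrable_riesz i fW) => iF.
apply: le_integrable iF => //.
  apply/measurable_EFinP; apply: measurableT_comp; first exact: fine_measurable.
  exact: measurable_fubini_F (in_W_integrable_riesz i fW).
move=> x _; rewrite /riesz_int /Rintegral /fubini_F /=.
by case: (\int[leb]_z _)%E => [r||] /=; rewrite ?normr0 ?leey.
Qed.

Lemma swap_shift u f (z : Rn) L M : lipbound L M u -> in_L1 f ->
  (\int[leb]_x (u x * (f (x - z) - f x))%:E = \int[leb]_x (f x * (u (x + z) - u x))%:E)%E.
Proof.
move=> [uL uM] fi; have mu := lipschitz_measurable uL.
have mf : measurable_fun setT f by exact: in_L1_measurable.
have muz : measurable_fun setT (fun x : Rn => u (x + z)).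
  by apply: (@measurableT_comp _ _ _ _ _ _ u _ (fun x : Rn => x + z)) => //; exact: measurable_rVD.
have I1 := integrable_Mbounded fi mu uM.
have I2 := @integrable_Mbounded R n f (fun x => u (x + z)) M fi muz (fun x => uM _).
have I3 := @integrable_Mbounded R n _ u M (in_L1_shift (- z) fi) mu uM.
transitivity (\int[leb]_x (f (x - z) * u x)%:E - \int[leb]_x (f x * u x)%:E)%E.
  by rewrite -integralB_EFin//; apply: eq_integral => x _; rewrite -EFinB; congr EFin; ring.
transitivity (\int[leb]_x (f x * u (x + z))%:E - \int[leb]_x (f x * u x)%:E)%E.
  congr (_ - _)%E.
  rewrite -(@integral_shift R n (- z) (fun x => (f x * u (x + z))%:E)).
    by apply: eq_integral => x _; rewrite subrK.
  by apply/measurable_EFinP; exact: measurable_funM.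
by rewrite -integralB_EFin//; apply: eq_integral => x _; rewrite -EFinB mulrBr.
Qed.

(** After Fubini, z is replaced by -z in one of the double integrals: [riesz] changes sign and
    [swap_shift] moves the increment, so the inner integrals are opposite for every z. *)
Lemma riesz_parts L M u f i : 0 <= L -> 0 <= M -> lipbound L M u -> in_W alpha f ->
  (\int[leb]_x (f x * riesz_int i u x)%:E = - \int[leb]_x (u x * riesz_int i f x)%:E)%E.
Proof.
move=> L0 M0 uLM fW; have [fi _] := fW.
have mf : measurable_fun setT f by exact: in_L1_measurable.
have mu := lipschitz_measurable uLM.1.
pose F1 (p : Rn * Rn) := (f p.1 * riesz_diff i u p)%:E.
pose F2 (p : Rn * Rn) := (u p.1 * riesz_diff i f p)%:E.
have I1 : (leb \x leb)%E.-integrable setT F1 by exact: lipbound_integrable_prod uLM fi.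
have I2 : (leb \x leb)%E.-integrable setT F2 by exact: in_W_integrable_prod uLM fW.
have E1 : (\int[leb]_x (f x * riesz_int i u x)%:E = \int[leb]_x \int[leb]_z F1 (x, z))%E.
  apply: eq_integral => x _; rewrite /F1 /= EFinM /riesz_int /Rintegral.
  have Ix := lipbound_integrable x i L0 M0 uLM.
  by rewrite fineK ?integrable_fin_num// -integralZl//; apply: eq_integral => z _; rewrite -EFinM.
have E2 : (\int[leb]_x (u x * riesz_int i f x)%:E = \int[leb]_x \int[leb]_z F2 (x, z))%E.
  (* Equality holds at those x where the increment of [f] is integrable against the kernel, hence
     only almost everywhere. *)
  apply: ae_eq_integral => //.
  - apply/measurable_EFinP; apply: measurable_funM => //; apply/measurable_EFinP.
    exact: measurable_int (riesz_int_integrable i fW).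
  - exact: measurable_fubini_F I2.
  have := ae_integrable1 (in_W_integrable_riesz i fW); apply: filterS => x Ix _.
  by rewrite /F2 /= EFinM /riesz_int /Rintegral fineK ?integrable_fin_num// -integralZl//.
rewrite E1 E2 (Fubini I1) (Fubini I2).
have mG2 : measurable_fun setT (fun z => \int[leb]_x F2 (x, z))%E by exact: measurable_fubini_G I2.
rewrite -(integral_reflect mG2).
transitivity (- \int[leb]_z \int[leb]_x (\- F1) (x, z))%E.
  rewrite (integral21_prod_meas1 (integrableN I1)) integralN ?integrable_add_def//.
  by rewrite oppeK (integral21_prod_meas1 I1).
congr (- _)%E; apply: eq_integral => z _.
have Iu : leb.-integrable setT (fun x => (f x * (u (x + z) - u x))%:E).
  apply: (@integrable_Mbounded R n f (fun x => u (x + z) - u x) (M + M)) => //.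
    apply: measurable_funB => //.
    by apply: (@measurableT_comp _ _ _ _ _ _ u _ (fun x : Rn => x + z)) => //; exact: measurable_rVD.
  by move=> x; apply: (le_trans (ler_normB _ _)); apply: lerD; exact: uLM.2.
have Iw : leb.-integrable setT (fun x => (u x * (f (x - z) - f x))%:E).
  have ifz : in_L1 (fun x => f (x - z) - f x).
    have := integrableB measurableT (in_L1_shift (- z) fi) fi; exact: eq_integrable.
  have := integrable_Mbounded ifz mu uLM.2.
  by apply: eq_integrable => // x _; rewrite mulrC.
transitivity ((- riesz i z)%:E * \int[leb]_x (f x * (u (x + z) - u x))%:E)%E.
  rewrite -integralZl//; apply: eq_integral => x _.
  by rewrite /F1 /riesz_diff /= -EFinM; congr EFin; ring.
rewrite -(swap_shift z uLM fi) -integralZl//.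
by apply: eq_integral => x _; rewrite /F2 /riesz_diff /= rieszN -EFinM; congr EFin; ring.
Qed.

End integration_by_parts.

(** * Integration against signed measures *)

Section charges.
Context d (T : measurableType d) {R : realType}.
Implicit Types (nu : {charge set T -> \bar R}) (mu : {measure set T -> \bar R}).

Lemma finite_measure_integrable (m : {finite_measure set T -> \bar R}) (h : T -> R) (M : R) :
  measurable_fun setT h -> (forall x, `|h x| <= M) -> m.-integrable setT (EFin \o h).
Proof.
move=> mh hM; apply: (@le_integrable _ _ _ _ _ measurableT _ (cst M%:E)) => //.
- exact/measurable_EFinP.
- by move=> x _; rewrite /= lee_fin; apply: (le_trans (hM x)); exact: ler_norm.
- exact: finite_measure_integrable_cst.
Qed.

(** Hides the Hahn decomposition chosen in [charge_integral] behind two abstract finite measures,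
    keeping the difference formulas and the absolute continuity. *)
Lemma charge_integral_decomp nu : exists P N : {finite_measure set T -> \bar R},
  [/\ forall A, measurable A -> nu A = (P A - N A)%E,
      forall g, charge_integral nu g = (\int[P]_x g x - \int[N]_x g x)%E &
      forall mu, nu `<< mu -> P `<< mu /\ N `<< mu].
Proof.
pose H := projT2 (cid (projT2 (cid (Hahn_decomposition nu)))).
exists [the {finite_measure set T -> \bar R} of jordan_pos H],
  [the {finite_measure set T -> \bar R} of jordan_neg H]; split => [A mA|//|mu nmu].
  by rewrite (jordan_decomp H mA)/= /cadd/= cscaleN1.
by split; [exact: jordan_pos_dominates|exact: jordan_neg_dominates].
Qed.

(** Both Jordan parts are absolutely continuous, with densities p and q. Since p - q and [g] have
    equal integrals over all measurable sets, they agree almost everywhere, and the two integrals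
    combine into that of h (p - q). *)
Lemma charge_integral_density nu (mu : {sigma_finite_measure set T -> \bar R})
    (g h : T -> R) (M : R) :
  mu.-integrable setT (EFin \o g) ->
  (forall A, measurable A -> nu A = \int[mu]_(x in A) (g x)%:E)%E ->
  measurable_fun setT h -> (forall x, `|h x| <= M) ->
  charge_integral nu (EFin \o h) = (\int[mu]_x (h x * g x)%:E)%E.
Proof.
move=> ig nug mh hM.
have nmu : nu `<< mu.
  apply/null_content_dominatesP => A mA A0; rewrite nug//.
  by apply: null_set_integral => //; apply: measurable_funTS; exact: measurable_int ig.
have [P [N [PN -> /(_ mu nmu) [Pmu Nmu]]]] := charge_integral_decomp nu.
have iP := finite_measure_integrable P mh hM.
have iN := finite_measure_integrable N mh hM.
have EP := Radon_Nikodym_change_of_variables Pmu measurableT iP.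
have EN := Radon_Nikodym_change_of_variables Nmu measurableT iN.
set p := Radon_Nikodym _ _ in EP; set q := Radon_Nikodym _ _ in EN.
have ip : mu.-integrable setT p by exact: Radon_Nikodym_integrable.
have iq : mu.-integrable setT q by exact: Radon_Nikodym_integrable.
have bM (k : T -> \bar R) : mu.-integrable setT k ->
    mu.-integrable setT (fun x => (h x)%:E * k x)%E.
  move=> ik; apply: (@le_integrable _ _ _ _ _ measurableT _ (fun x => M%:E * k x)%E).
  - apply: emeasurable_funM; first exact/measurable_EFinP.
    exact: measurable_int ik.
  - move=> x _; rewrite !abseM; apply: lee_wpmul2r => //.
    by rewrite lee_fin; apply: (le_trans (hM x)); exact: ler_norm.
  - exact: integrableZl.
rewrite -EP -EN -integralB//; [|exact: bM|exact: bM].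
have mh' : measurable_fun setT (EFin \o h) by exact/measurable_EFinP.
apply: ae_eq_integral => //.
- apply: emeasurable_funB; exact: measurable_int (bM _ _).
- by apply/measurable_EFinP; apply: measurable_funM => //; apply/measurable_EFinP; exact: measurable_int ig.
have pq : ae_eq mu setT (p \- q)%E (EFin \o g).
  apply: integral_ae_eq => //; first exact: integrableB.
    exact: measurable_int ig.
  move=> A _ mA; rewrite integralB//; [|exact: (integrableS measurableT _ _ ip)|exact: (integrableS measurableT _ _ iq)].
  have hP : P A = (\int[mu]_(x in A) p x)%E.
    exact: (@Radon_Nikodym_integral _ _ _ (charge_of_finite_measure P) mu A Pmu mA).
  have hN : N A = (\int[mu]_(x in A) q x)%E.
    exact: (@Radon_Nikodym_integral _ _ _ (charge_of_finite_measure N) mu A Nmu mA).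
  by rewrite -hP -hN -PN// nug.
apply: filterS pq => x /(_ I) /= gx _.
have pf : p x \is a fin_num.
  exact: (@Radon_Nikodym_fin_num _ _ _ (charge_of_finite_measure P) mu x Pmu).
by rewrite EFinM -gx muleBr// fin_num_adde_defr.
Qed.

Lemma induced_charge_exists mu (g : T -> \bar R) : mu.-integrable setT g ->
  exists nu, forall A, nu A = (\int[mu]_(x in A) g x)%E.
Proof. by move=> ig; exists [the {charge set T -> \bar R} of induced_charge ig]. Qed.

End charges.

Section charge_testfun.
Context {R : realType} {n : nat}.
Local Notation Rn := 'rV[R]_n.

(** The four Jordan parts are added into one finite measure, so that a single test function
    approximates the indicator of [A] for all of them; four errors e / 4 then compare the two
    charges. *)
Lemma charge_testfun_uniq (nu nu' : {charge set Rn -> \bar R}) :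
  (forall u, testfun u -> charge_integral nu (EFin \o u) = charge_integral nu' (EFin \o u)) ->
  forall A, measurable A -> nu A = nu' A.
Proof.
have [P [N [PN PNi _]]] := charge_integral_decomp nu.
have [P' [N' [PN' PNi' _]]] := charge_integral_decomp nu'.
move=> h A mA; rewrite PN// PN'//.
have [mu muE] : exists mu : {measure set Rn -> \bar R}, forall k : Rn -> \bar R,
    measurable_fun setT k -> (forall x, 0 <= k x)%E ->
    (\int[mu]_x k x =
     (\int[P]_x k x + \int[N]_x k x) + (\int[P']_x k x + \int[N']_x k x))%E.
  exists [the measure _ _ of measure_add
    [the measure _ _ of measure_add P N] [the measure _ _ of measure_add P' N']] => k mk k0.
  by rewrite !ge0_integral_measure_add.
have i1 : mu.-integrable setT (EFin \o (cst 1%R : Rn -> R)).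
  apply/integrableP; split; first exact/measurable_EFinP.
  have c1 (m : {finite_measure set Rn -> \bar R}) : (\int[m]_x `|(EFin \o (cst 1%R : Rn -> R)) x| < +oo)%E.
    by have /integrableP[] := @finite_measure_integrable _ _ _ m (cst 1) `|1| (measurable_cst _) (fun=> lexx _).
  rewrite muE; [|by apply: measurableT_comp => //; exact/measurable_EFinP|by []].
  by do 2?apply: lte_add_pinfty; exact: c1.
have [_ app] := @approximable_measurable R n mu (cst 1%R) i1 (fun=> ler01) A mA.
have fin (m : {finite_measure set Rn -> \bar R}) : m A \is a fin_num by exact: fin_num_measure.
have key (m : {finite_measure set Rn -> \bar R}) (u : Rn -> R) (e : R) :
    testfun u -> (\int[m]_x (`|u x - \1_A x|)%:E <= e%:E)%E ->
    (\int[m]_x (u x)%:E)%E \is a fin_num /\ `|fine (\int[m]_x (u x)%:E)%E - fine (m A)| <= e.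
  move=> tu ue; have mu' := testfun_measurable tu.
  have [C C0 uC] := testfun_bounded tu.
  have iu := finite_measure_integrable m mu' uC.
  have iA : m.-integrable setT (EFin \o (\1_A : Rn -> R)).
    apply: (@finite_measure_integrable _ _ _ m _ 1); first exact/measurable_indicP.
    by move=> x; rewrite indicE; case: (_ \in _); rewrite ?normr1// normr0.
  have mE : m A = (\int[m]_x (\1_A x)%:E)%E by rewrite integral_indic// setIT.
  have fu := integrable_fin_num measurableT iu.
  split => //; rewrite -lee_fin; apply: le_trans ue.
  rewrite -abse_EFin EFinB fineK// fineK// mE -integralB_EFin//.
  have : measurable_fun setT (fun x => (u x)%:E - (\1_A x)%:E)%E.
    by apply: emeasurable_funB; [exact: measurable_int iu|exact: measurable_int iA].
  move=> /(le_abse_integral m measurableT) /le_trans; apply.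
  rewrite le_eqVlt; apply/orP; left; apply/eqP; apply: eq_integral => x _.
  by rewrite -EFinB.
rewrite -(fineK (fin P)) -(fineK (fin N)) -(fineK (fin P')) -(fineK (fin N')) -!EFinB.
congr EFin; apply/eqP; rewrite -subr_eq0 -normr_le0; apply/ler_addgt0Pl => e e0.
rewrite addr0; have e40 : 0 < e / 4 by rewrite divr_gt0.
have [u [tu _ ue]] := app _ e40.
have ma : measurable_fun setT (fun x => (`|u x - \1_A x|)%:E).
  apply/measurable_EFinP; apply: measurableT_comp => //; apply: measurable_funB.
    exact: testfun_measurable.
  exact/measurable_indicP.
have {}ue : (\int[mu]_x (`|u x - \1_A x|)%:E <= (e / 4)%:E)%E.
  by move: ue; under eq_integral do rewrite mulr1.
rewrite muE// in ue.
have g0 (m : {finite_measure set Rn -> \bar R}) : (0 <= \int[m]_x (`|u x - \1_A x|)%:E)%E.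
  by apply: integral_ge0 => x _; rewrite lee_fin.
have sum_ge (a b c e' : \bar R) : (0 <= a -> 0 <= b -> 0 <= c -> 0 <= e' ->
    [/\ a <= a + b + (c + e'), b <= a + b + (c + e'),
      c <= a + b + (c + e') & e' <= a + b + (c + e')])%E.
  move=> a0 b0 c0 d0; split.
  - by rewrite -addeA leeDl// !adde_ge0.
  - by rewrite (addeC a) -addeA leeDl// !adde_ge0.
  - by rewrite addeCA leeDl// !adde_ge0.
  - by rewrite (addeC c) addeCA leeDl// !adde_ge0.
have [hP hN hP' hN'] := sum_ge _ _ _ _ (g0 P) (g0 N) (g0 P') (g0 N').
have [fP eP] := key P u (e / 4) tu (le_trans hP ue).
have [fN eN] := key N u (e / 4) tu (le_trans hN ue).
have [fP' eP'] := key P' u (e / 4) tu (le_trans hP' ue).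
have [fN' eN'] := key N' u (e / 4) tu (le_trans hN' ue).
have := h u tu; rewrite PNi PNi'/= -(fineK fP) -(fineK fN) -(fineK fP') -(fineK fN') -!EFinB.
move=> [] E; move: eP eN eP' eN'; rewrite !ler_norml.
by move=> /andP[? ?] /andP[? ?] /andP[? ?] /andP[? ?]; apply/andP; split; lra.
Qed.

End charge_testfun.
Lemma Rintegral_sum d (T : measurableType d) (R : realType) (mu : {measure set T -> \bar R})
    (I : finType) (F : I -> T -> R) : (forall i, mu.-integrable setT (EFin \o F i)) ->
  \int[mu]_x (\sum_i F i x) = \sum_i \int[mu]_x F i x.
Proof.
move=> iF; rewrite /Rintegral sum_fine; last by move=> i _; exact: integrable_fin_num (iF i).
rewrite -integral_sum//; congr fine; apply: eq_integral => x _.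
by rewrite sumEFin.
Qed.

Lemma charge_integral_basis {R : realType} {n : nat} (D : vector_measure R n)
    (u : 'rV[R]_n -> R) i :
  (\sum_j charge_integral (D j) (fun x => ((u x *: vbase i) ord0 j)%:E) =
   charge_integral (D i) (EFin \o u))%E.
Proof.
have coord j x : (u x *: vbase i) ord0 j = if j == i then u x else 0.
  by rewrite !mxE eqxx /=; case: (j == i); rewrite ?mulr1 ?mulr0.
rewrite (bigD1 i)//= big1 ?adde0 => [|j ji].
  by congr charge_integral; apply/funext => x; rewrite /= coord eqxx.
rewrite (_ : (fun x => _) = cst 0%E); last first.
  by apply/funext => x; rewrite coord (negbTE ji).
by rewrite /charge_integral !integral0 sube0.
Qed.

(** * Fractional divergence, gradient and variation *)

Section fractional_parts.
Context {R : realType} {n : nat} (alpha : R).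
Hypotheses (n0 : (0 < n)%N) (alpha01 : 0 < alpha < 1).
Local Notation Rn := 'rV[R]_n.
Local Notation leb := (lebesgue_rV R n).
Implicit Types (f u : Rn -> R) (phi : Rn -> Rn) (i : 'I_n).
Local Notation q := (n%:R + alpha).
Local Notation mu := (frac_const n alpha).

Lemma frac_const_ge0 : 0 <= mu.
Proof.
rewrite /frac_const divr_ge0 ?mulr_ge0 ?powR_ge0//.
- by apply: Rintegral_ge0 => x _; rewrite mulr_ge0 ?powR_ge0 ?expR_ge0.
- by apply: Rintegral_ge0 => x _; rewrite mulr_ge0 ?powR_ge0 ?expR_ge0.
Qed.

Lemma frac_grad_integrable i f : in_W alpha f ->
  leb.-integrable setT (fun x => (frac_grad alpha f x ord0 i)%:E).
Proof.
move=> fW; have mf : measurable_fun setT f by apply: in_L1_measurable; have [] := fW.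
have := integrableZl measurableT mu (riesz_int_integrable alpha01 i fW).
by apply: eq_integrable => // x _; rewrite (frac_gradE alpha x i mf) EFinM.
Qed.

(** The divergence is a single integral of a scalar product; splitting it into coordinates relies on
    the integrability of each term, granted by the Lipschitz bounds. *)
Lemma frac_div_sum L M phi x : 0 <= L -> 0 <= M ->
  (forall i, lipbound L M (fun x => phi x ord0 i)) ->
  frac_div alpha phi x = mu * \sum_i riesz_int alpha i (fun y => phi y ord0 i) x.
Proof.
move=> L0 M0 hphi; congr (_ * _).
have mphi i : measurable_fun setT (fun y => phi y ord0 i) by exact: lipschitz_measurable (hphi i).1.
rewrite /riesz_int -Rintegral_sum; last first.
  by move=> i; exact: (@lipbound_integrable _ _ _ n0 alpha01 L M).
rewrite /Rintegral; congr fine.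
rewrite -(@integral_shift R n x); last first.
  apply/measurable_EFinP; apply: measurable_funM.
    apply: measurable_dotr; first exact: measurable_rVD.
    apply: measurable_fun_rVP => i; rewrite (_ : _ \o _ = fun y => phi y ord0 i - phi x ord0 i).
      exact: measurable_funB.
    by apply/funext => y; rewrite /rV_coord /= !mxE.
  apply: (@measurable_kernel2 R n (q + 1) _ _ (fun y : Rn => y - x)); exact: measurable_rVD.
apply: eq_integral => z _; rewrite addrK /dotr mulr_suml; congr EFin.
apply: eq_bigr => i _; rewrite /riesz_diff /riesz /kernel /= (addrC x) !mxE.
by rewrite mulrAC.
Qed.

Lemma lipbound_riesz_integrable L M u f i : 0 <= L -> 0 <= M -> lipbound L M u -> in_L1 f ->
  leb.-integrable setT (fun x => (f x * riesz_int alpha i u x)%:E).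
Proof.
move=> L0 M0 uLM fi.
have := integrable_fubini_F (lipbound_integrable_prod n0 alpha01 i L0 M0 uLM fi).
apply: eq_integrable => // x _; rewrite /fubini_F /= EFinM /riesz_int /Rintegral.
have Ix := lipbound_integrable n0 alpha01 x i L0 M0 uLM.
by rewrite fineK ?integrable_fin_num// -integralZl//; apply: eq_integral => z _; rewrite -EFinM.
Qed.

Lemma frac_parts f phi : in_W alpha f -> Lip_c phi ->
  (\int[leb]_x (f x * frac_div alpha phi x)%:E =
   - \int[leb]_x (dotr (phi x) (frac_grad alpha f x))%:E)%E.
Proof.
move=> fW Lphi; have [fi _] := fW.
have mf : measurable_fun setT f by exact: in_L1_measurable.
have [L [M [L0 M0 hphi]]] := Lip_c_lipbound (Ordinal n0) Lphi.
have mphi i : measurable_fun setT (fun y => phi y ord0 i) by exact: lipschitz_measurable (hphi i).1.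
have J1 i := lipbound_riesz_integrable i L0 M0 (hphi i) fi.
have J2 i : leb.-integrable setT (fun x => (phi x ord0 i * riesz_int alpha i f x)%:E).
  have := integrable_Mbounded (riesz_int_integrable alpha01 i fW) (mphi i) (hphi i).2.
  by apply: eq_integrable => // x _; rewrite mulrC.
transitivity (\sum_i (mu%:E * \int[leb]_x (f x * riesz_int alpha i (fun y => phi y ord0 i) x)%:E))%E.
  under eq_integral => x _.
    rewrite (frac_div_sum x L0 M0 hphi) mulrCA mulr_sumr mulr_sumr -sumEFin.
    over.
  rewrite (@integral_sum _ _ _ leb setT measurableT _
    (fun i x => (mu * (f x * riesz_int alpha i (fun y => phi y ord0 i) x))%:E)).
    by apply: eq_bigr => i _; rewrite -integralZl//; apply: eq_integral => x _; rewrite -EFinM.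
  by move=> i; have := integrableZl measurableT mu (J1 i); apply: eq_integrable => // x _; rewrite -EFinM.
transitivity (\sum_i (mu%:E * - \int[leb]_x (phi x ord0 i * riesz_int alpha i f x)%:E))%E.
  by apply: eq_bigr => i _; congr (_ * _)%E; exact: (riesz_parts n0 alpha01 i L0 M0 (hphi i) fW).
transitivity (\sum_i (- \int[leb]_x (mu * (phi x ord0 i * riesz_int alpha i f x))%:E))%E.
  by apply: eq_bigr => i _; rewrite muleN -integralZl//; congr (- _)%E; apply: eq_integral => x _; rewrite -EFinM.
have J3 i : leb.-integrable setT (fun x => (mu * (phi x ord0 i * riesz_int alpha i f x))%:E).
  by have := integrableZl measurableT mu (J2 i); apply: eq_integrable => // x _; rewrite -EFinM.
rewrite sumeN; last first.
  by move=> i j _ _; rewrite fin_num_adde_defr// integrable_fin_num.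
congr (- _)%E; rewrite -integral_sum//; apply: eq_integral => x _.
rewrite sumEFin; congr EFin; apply: eq_bigr => i _.
by rewrite (frac_gradE alpha x i mf) mulrCA.
Qed.

(** Cauchy-Schwarz is applied under the integral to the scalar product of v and z as a whole; a
    coordinatewise estimate would add a factor depending on n to [frac_const]. *)
Lemma riesz_int_dot_le f v x :
  leb.-integrable setT (fun z => (`|f (x + z)%R - f x| * kernel q z)%:E) ->
  measurable_fun setT f ->
  `|dotr v (frac_grad alpha f x)| <=
    mu * (enorm v * \int[leb]_z (`|f (x + z)%R - f x| * kernel q z)).
Proof.
move=> iK mf; have q0 : 0 < q by case/andP: alpha01 => a0 _; rewrite ltr_wpDl.
have J i : leb.-integrable setT (fun z => (riesz_diff alpha i f (x, z))%:E).
  apply: le_integrable iK => //.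
    apply/measurable_EFinP.
    by have := measurable_riesz_diff alpha i mf => /measurableT_comp; apply.
  move=> z _; rewrite lee_fin [leRHS]ger0_norm ?mulr_ge0 ?kernel_ge0//.
  exact: (riesz_diff_le alpha01 i f (x, z)).
have J' i : leb.-integrable setT (EFin \o (fun z => v ord0 i * riesz_diff alpha i f (x, z))).
  by have := integrableZl measurableT (v ord0 i) (J i); apply: eq_integrable => // z _; rewrite -EFinM.
have -> : dotr v (frac_grad alpha f x) =
    mu * \int[leb]_z (\sum_i (v ord0 i * riesz_diff alpha i f (x, z))).
  rewrite Rintegral_sum// mulr_sumr; apply: eq_bigr => i _.
  by rewrite (frac_gradE alpha x i mf) mulrCA; congr (_ * _); apply/esym; apply: RintegralZl => //; exact: J.
rewrite normrM (ger0_norm frac_const_ge0); apply: ler_wpM2l; first exact: frac_const_ge0.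
have Js : leb.-integrable setT (EFin \o (fun z => \sum_i (v ord0 i * riesz_diff alpha i f (x, z)))).
  have := integrable_sum measurableT (index_enum 'I_n) (P := xpredT) (fun i _ => J' i).
  by apply: eq_integrable => // z _; rewrite /= sumEFin.
apply: (le_trans (le_normr_Rintegral measurableT Js)).
rewrite -RintegralZl//; apply: le_Rintegral => //.
- exact: integrable_abse Js.
- by have := integrableZl measurableT (enorm v) iK; apply: eq_integrable => // z _; rewrite -EFinM.
move=> z _; have -> : \sum_i v ord0 i * riesz_diff alpha i f (x, z) =
    dotr v z * (f (x + z) - f x) * kernel (q + 1) z.
  by rewrite /dotr !mulr_suml; apply: eq_bigr => i _; rewrite /riesz_diff /riesz /=; ring.
rewrite !normrM (ger0_norm (kernel_ge0 _ _)) -(kernel_decomp z q0).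
rewrite (_ : enorm v * _ = enorm v * enorm z * (`|f (x + z) - f x| * kernel (q + 1) z)); last by ring.
by rewrite -mulrA; apply: ler_wpM2r (dotr_CS v z); rewrite mulr_ge0 ?kernel_ge0.
Qed.

Lemma leb_setT_gt0 : (0 < leb setT)%E.
Proof.
apply: (@lt_le_trans _ _ (leb (rV_cube 1))); first by rewrite leb_cube// lte_fin exprn_gt0// mulr1.
by apply: le_measure; rewrite ?inE//; exact: measurable_rV_cube.
Qed.

(** Positive total measure selects the essential supremum in the definition of the norm. *)
Lemma Linfty_norm_le1_ae phi : (Linfty_norm phi <= 1)%E ->
  \forall x \ae leb, enorm (phi x) <= 1.
Proof.
rewrite /Linfty_norm unlock /= leb_setT_gt0 => /ess_supP; apply: filterS => x /=.
by rewrite lee_fin ger0_norm ?enorm_ge0.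
Qed.

Lemma frac_variation_le f : in_W alpha f ->
  (frac_variation alpha f <= mu%:E * W_seminorm alpha f)%E.
Proof.
move=> fW; have [fi _] := fW.
have mf : measurable_fun setT f by exact: in_L1_measurable.
apply: ub_ereal_sup => _ [phi [Cphi phi1] <-].
have Lphi := Cinfty_c_Lip_c Cphi.
have [L [M [L0 M0 hphi]]] := Lip_c_lipbound (Ordinal n0) Lphi.
have mphi : measurable_fun setT phi.
  by apply: measurable_fun_rVP => i; exact: lipschitz_measurable (hphi i).1.
have mgrad : measurable_fun setT (frac_grad alpha f).
  apply: measurable_fun_rVP => i; apply/measurable_EFinP.
  exact: measurable_int (frac_grad_integrable i fW).
have mdot : measurable_fun setT (fun x => (dotr (phi x) (frac_grad alpha f x))%:E).
  by apply/measurable_EFinP; exact: measurable_dotr.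
rewrite (frac_parts fW Lphi) W_seminorm_diff//.
apply: le_trans (lee_abs _) _; rewrite abseN.
apply: (le_trans (le_abse_integral leb measurableT mdot)).
have mS : measurable_fun setT
    (fun x : Rn => \int[leb]_z (`|f (x + z)%R - f x| * kernel q z)%:E)%E.
  apply: (@measurable_fun_fubini_tonelli_F _ _ _ _ R leb
    (fun p : Rn * Rn => (`|f (p.1 + p.2)%R - f p.1| * kernel q p.2)%:E)).
    exact: measurable_shift_kernel.
  by move=> p; rewrite lee_fin mulr_ge0 ?kernel_ge0.
have S0 x : (0 <= \int[leb]_z (`|f (x + z)%R - f x| * kernel q z)%:E)%E.
  by apply: integral_ge0 => z _; rewrite lee_fin mulr_ge0 ?kernel_ge0.
rewrite -ge0_integralZl//; last by rewrite lee_fin frac_const_ge0.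
apply: ae_ge0_le_integral => //.
- exact: measurableT_comp.
- by move=> x _; rewrite mule_ge0// lee_fin frac_const_ge0.
- exact: measurable_funeM.
have := ae_integrable1 (in_W_integrable_diff fW).
(* Two null sets are discarded: where |phi| exceeds 1, and where the increment of [f] is not
   integrable against the kernel. *)
apply: filterS2 (Linfty_norm_le1_ae phi1) => x phix Ix _.
have /= h := riesz_int_dot_le (phi x) Ix mf.
rewrite -[X in (_ * X)%E]fineK; last exact: integrable_fin_num Ix.
rewrite -EFinM lee_fin; apply: (le_trans h); apply: ler_wpM2l; first exact: frac_const_ge0.
rewrite -[leRHS]mul1r; apply: ler_wpM2r => //.
by apply: Rintegral_ge0 => z _; rewrite mulr_ge0 ?kernel_ge0.
Qed.

(** Forward, the fields u e_i with u a [testfun] already determine [D i], by [charge_testfun_uniq]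
    against the charge with density the i-th component of the fractional gradient. The converse is
    the density formula in each coordinate. *)
Lemma frac_gradient_measureP f (D : vector_measure R n) : in_W alpha f ->
  is_frac_gradient_measure alpha f D <->
  (forall i (A : set Rn), measurable A ->
    D i A = (\int[leb]_(x in A) (frac_grad alpha f x ord0 i)%:E)%E).
Proof.
move=> fW; have ig i := frac_grad_integrable i fW; split.
  move=> hD i; have [nu nuE] := induced_charge_exists (ig i).
  move=> A mA; rewrite -nuE; apply: charge_testfun_uniq mA => u tu.
  have [M M0 uM] := testfun_support tu; have [C C0 uC] := testfun_bounded tu.
  have Cu := @Cinfty_c_scale R n u (vbase i) M (testfun_smooth tu) uM.
  have coord j x : (u x *: vbase i) ord0 j = if j == i then u x else 0.
    by rewrite !mxE eqxx /=; case: (j == i); rewrite ?mulr1 ?mulr0.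
  have := hD _ Cu; rewrite (frac_parts fW (Cinfty_c_Lip_c Cu)) => /eqe_oppP.
  rewrite charge_integral_basis.
  move=> <-; rewrite (charge_integral_density (ig i) (fun A _ => nuE A) (testfun_measurable tu) uC).
  apply: eq_integral => x _; congr EFin; rewrite /dotr (bigD1 i)//= coord eqxx big1 ?addr0// => j ji.
  by rewrite coord (negbTE ji) mul0r.
move=> hD phi Cphi; have Lphi := Cinfty_c_Lip_c Cphi.
have [L [M [L0 M0 hphi]]] := Lip_c_lipbound (Ordinal n0) Lphi.
have mphi i : measurable_fun setT (fun y => phi y ord0 i) by exact: lipschitz_measurable (hphi i).1.
rewrite (frac_parts fW Lphi); congr (- _)%E.
have J i : leb.-integrable setT (fun x => (phi x ord0 i * frac_grad alpha f x ord0 i)%:E).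
  have := integrable_Mbounded (ig i) (mphi i) (hphi i).2.
  by apply: eq_integrable => // x _; rewrite mulrC.
transitivity (\sum_i \int[leb]_x (phi x ord0 i * frac_grad alpha f x ord0 i)%:E)%E.
  by rewrite -integral_sum//; apply: eq_integral => x _; rewrite sumEFin.
apply: eq_bigr => i _; apply/esym.
exact: (charge_integral_density (ig i) (hD i) (mphi i) (hphi i).2).
Qed.

End fractional_parts.
Lemma is_derive_affine {R : realType} (a c t : R) :
  is_derive t (1 : R) (fun t => a * t + c) a.
Proof.
apply/is_derive1_caratheodory; exists (fun=> a); split=> //; last exact: cst_continuous.
by move=> z; ring.
Qed.

(** * Smooth truncations of negative powers *)

Section truncated_power.
Context {R : realType} (a : R).
Hypothesis a0 : 0 <= a.
Implicit Types (m s t : R).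

(* A smooth compactly supported truncation of [s ^ (- a)]; the factor [expR 1] makes the second cutoff tend to 1. *)
Definition trunc_pow m s : R :=
  m `^ a * flat a (m * s) * (expR 1 * flat 0 (1 - s / m)).

(** The factor between [trunc_pow] and s^(-a) for positive m and s. *)
Definition cutoff m s : R := flat 0 (m * s) * (expR 1 * flat 0 (1 - s / m)).

(** The factor between the derivative of [trunc_pow] and s^(-(a + 1)). The term [flat 1 (m * s)] is
    m s [flat 2 (m * s)]; outside the arguments of [flat], m survives only in s / m, which is why a
    bound uniform in m is possible. *)
Definition cutoff_derive m s : R :=
  (- a * flat 0 (m * s) + flat 1 (m * s)) * (expR 1 * flat 0 (1 - s / m)) -
  flat 0 (m * s) * (expR 1 * (s / m * flat 2 (1 - s / m))).

Definition trunc_pow_derive m s : R :=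
  m `^ a * (m * (- a * flat (a + 1) (m * s) + flat (a + 2) (m * s))) *
    (expR 1 * flat 0 (1 - s / m)) -
  m `^ a * flat a (m * s) * (expR 1 * (m^-1 * flat 2 (1 - s / m))).

Lemma smooth1_trunc_pow m : smooth1 (trunc_pow m).
Proof.
have h r (c e : R) : 0 <= r -> smooth1 (fun s => flat r (c * s + e)).
  by move=> r0 k; apply: Ck_comp; [exact: smooth1_flat|exact: smooth1_affine].
rewrite (_ : trunc_pow m = fun s => m `^ a * flat a (m * s + 0) * (expR 1 * flat 0 (- m^-1 * s + 1))).
  move=> k; apply: CkM; apply: CkM; [exact: Ck_cst|exact: h|exact: Ck_cst|exact: h].
by apply/funext => s; rewrite /trunc_pow addr0; congr (_ * (_ * flat _ _)); ring.
Qed.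

Lemma is_derive_trunc_pow m s : is_derive s (1 : R) (trunc_pow m) (trunc_pow_derive m s).
Proof.
have h r (c e : R) : 0 <= r -> is_derive s (1 : R) (fun s => flat r (c * s + e))
    ((- r * flat (r + 1) (c * s + e) + flat (r + 2) (c * s + e)) * c).
  move=> r0; apply: (@is_derive1_comp R (flat r) (fun s => c * s + e)).
    exact: is_derive_flat.
  exact: is_derive_affine.
have h1 := is_deriveZ (m `^ a) (h a m 0 a0).
have h2 := is_deriveZ (expR 1 : R) (h 0 (- m^-1) 1 (lexx _)).
have -> : trunc_pow m = (m `^ a *: (fun s => flat a (m * s + 0))) *
    ((expR 1 : R) *: (fun s => flat 0 (- m^-1 * s + 1))).
  apply/funext => t; rewrite /trunc_pow -[in LHS](addr0 (m * t)).
  by rewrite (_ : 1 - t / m = - m^-1 * t + 1); last by ring.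
have h3 := is_deriveM h1 h2; apply: (is_derive_eq h3).
rewrite /trunc_pow_derive /GRing.scale /= !addr0 (_ : - m^-1 * s + 1 = 1 - s / m); last by ring.
rewrite !add0r -[m `^ a *: flat a (m * s)]/(m `^ a * flat a (m * s)).
rewrite -[expR 1 *: flat 0 (1 - s / m)]/(expR 1 * flat 0 (1 - s / m)); ring.
Qed.

Lemma flat_pow r m s : 0 < m -> 0 < s -> flat r (m * s) = m `^ (- r) * (s `^ (- r) * flat 0 (m * s)).
Proof.
move=> m0 s0; rewrite /flat mulr_gt0// oppr0 powRr0 mul1r mulrA -powRM ?ltW//.
Qed.

Lemma pow_flat r m s : 0 < m -> 0 < s -> m `^ r * flat r (m * s) = s `^ (- r) * flat 0 (m * s).
Proof.
move=> m0 s0; have mn : m != 0 by rewrite gt_eqF.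
rewrite (flat_pow r)// [LHS]mulrA -powRD ?mn ?implybT//.
by rewrite subrr powRr0 mul1r.
Qed.

Lemma trunc_powE m s : 0 < m -> 0 < s -> trunc_pow m s = s `^ (- a) * cutoff m s.
Proof. by move=> m0 s0; rewrite /trunc_pow /cutoff pow_flat// -mulrA. Qed.

Lemma trunc_pow_deriveE m s : 0 < m -> 0 < s ->
  trunc_pow_derive m s = s `^ (- (a + 1)) * cutoff_derive m s.
Proof.
move=> m0 s0; have mn : m != 0 by rewrite gt_eqF.
have sn : s != 0 by rewrite gt_eqF.
have mS r : m `^ (r + 1) = m `^ r * m by rewrite powRD ?mn ?implybT// powRr1 ?ltW.
have sS r : s `^ (- r) = s `^ (- (r + 1)) * s.
  by rewrite -{3}[s]powRr1 ?ltW// -powRD ?sn ?implybT//; congr powR; ring.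
have E1 : m `^ a * m * flat (a + 1) (m * s) = s `^ (- (a + 1)) * flat 0 (m * s).
  by rewrite -mS pow_flat.
have E2 : m `^ a * m * flat (a + 2) (m * s) = s `^ (- (a + 1)) * flat 1 (m * s).
  have -> : flat 1 (m * s) = m^-1 * s^-1 * flat 0 (m * s).
    by rewrite (flat_pow 1)// !powR_inv1 ?ltW// mulrA.
  rewrite (_ : _ * m * _ = m^-1 * (m `^ (a + 2) * flat (a + 2) (m * s))).
    rewrite pow_flat// (sS (a + 1)) (_ : a + 1 + 1 = a + 2); last by ring.
    by field; rewrite mn sn.
  by rewrite (_ : a + 2 = a + 1 + 1) ?mS; [field|ring].
have E3 : m `^ a * flat a (m * s) = s `^ (- (a + 1)) * (s * flat 0 (m * s)).
  by rewrite pow_flat// sS mulrA.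
rewrite /trunc_pow_derive /cutoff_derive E3.
rewrite (_ : m `^ a * (m * _) = - a * (m `^ a * m * flat (a + 1) (m * s)) + m `^ a * m * flat (a + 2) (m * s)).
  by rewrite E1 E2; ring.
by ring.
Qed.

Lemma cutoff_support m s : 0 < m -> m <= s -> cutoff m s = 0 /\ cutoff_derive m s = 0.
Proof.
move=> m0 ms; have h : 1 - s / m <= 0 by rewrite subr_le0 ler_pdivlMr// mul1r.
by rewrite /cutoff /cutoff_derive !(flat_le0 _ h) !mulr0 subr0.
Qed.

Lemma cutoff_bound : exists2 C, 0 <= C & forall m s, 0 < m -> 0 < s ->
  `|cutoff m s| <= C /\ `|cutoff_derive m s| <= C.
Proof.
have [C1 C10 hC1] := @flat_bounded R 1 ler01.
have [C2 C20 hC2] := @flat_bounded R 2 (ler0n R 2).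
have e0 : 0 <= expR 1 :> R by exact: expR_ge0.
exists (expR 1 * (1 + (a + C1 + C2))) => [|m s m0 s0].
  by rewrite mulr_ge0// !addr_ge0.
have nf t : `|flat 0 t| <= 1 :> R by rewrite ger0_norm ?flat_ge0 ?flat0_le1.
(* Where the flat factor is nonzero one has s < m, so s / m is at most 1. *)
have sm : 0 <= s / m * flat 2 (1 - s / m) <= C2.
  apply/andP; split; first by rewrite mulr_ge0 ?flat_ge0 ?divr_ge0 ?ltW.
  have [h|h] := leP m s.
    have h' : 1 - s / m <= 0 by rewrite subr_le0 ler_pdivlMr// mul1r.
    by rewrite (flat_le0 _ h') mulr0.
  apply: le_trans (hC2 (1 - s / m)); rewrite ler_piMl ?flat_ge0//.
  by rewrite ler_pdivrMr// mul1r ltW.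
have f1 : 0 <= flat 1 (m * s) <= C1 by rewrite flat_ge0 hC1.
split.
  rewrite /cutoff !normrM (ger0_norm e0) mulrCA; apply: ler_wpM2l => //.
  apply: (@le_trans _ _ 1); first by rewrite -[leRHS]mulr1; apply: ler_pM.
  by rewrite lerDl !addr_ge0.
rewrite /cutoff_derive (_ : _ - _ = expR 1 * ((- a * flat 0 (m * s) + flat 1 (m * s)) * flat 0 (1 - s / m) -
    flat 0 (m * s) * (s / m * flat 2 (1 - s / m)))); last by ring.
rewrite normrM (ger0_norm e0); apply: ler_wpM2l => //.
apply: (@le_trans _ _ (a + C1 + C2)); last by rewrite lerDr.
apply: (le_trans (ler_normB _ _)); apply: lerD.
  rewrite normrM -[leRHS]mulr1; apply: ler_pM => //.
  apply: (le_trans (ler_normD _ _)).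
  rewrite normrM normrN (ger0_norm a0); apply: lerD; first by rewrite ler_piMr.
  by case/andP: f1 => ? ?; rewrite ger0_norm.
rewrite normrM -[leRHS]mul1r; apply: ler_pM => //.
by case/andP: sm => ? ?; rewrite ger0_norm.
Qed.

(** [flat 1 (m * s)] tends to 0 because it is 1/(m s) times a bounded factor, and the last term
    vanishes with s / m. What remains is -a, the coefficient in the derivative of s^(-a). *)
Lemma cutoff_cvg s : 0 < s ->
  cutoff m.+1%:R s @[m --> \oo] --> (1 : R) /\
  cutoff_derive m.+1%:R s @[m --> \oo] --> (- a : R).
Proof.
move=> s0.
have cm : flat 0 (m.+1%:R * s) @[m --> \oo] --> (1 : R).
  have := @flat_cvg1 R (fun m : nat => m.+1%:R * s) s s0. apply. apply: nearW => m.
  by rewrite mulrC ler_pM2r// ler_nat.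
have cinv : (m.+1%:R^-1 : R) @[m --> \oo] --> (0 : R) by exact: cvg_harmonic.
have c1 : (1 - s / m.+1%:R) @[m --> \oo] --> (1 : R).
  rewrite -[X in _ --> X]subr0; apply: cvgB; first exact: cvg_cst.
  by rewrite -[X in _ --> X](mulr0 s); apply: cvgM => //; exact: cvg_cst.
have cf r : 0 <= r -> flat r (1 - s / m.+1%:R) @[m --> \oo] --> flat r 1.
  move=> r0; have h : flat r t @[t --> (1 : R)] --> flat r 1.
    exact: (Ck_continuous (smooth1_flat r0 0%N)).
  exact: cvg_comp c1 h.
have f01 : expR 1 * flat 0 1 = 1 :> R.
  by rewrite /flat ltr01 oppr0 powRr0 mul1r invr1 -expRD subrr expR0.
have c0 : expR 1 * flat 0 (1 - s / m.+1%:R) @[m --> \oo] --> (1 : R).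
  by rewrite -[X in _ --> X]f01; apply: cvgM; [exact: cvg_cst|exact: cf].
have c10 : flat 1 (m.+1%:R * s) @[m --> \oo] --> (0 : R).
  have -> : (fun m : nat => flat 1 (m.+1%:R * s)) = (fun m : nat => s^-1 * m.+1%:R^-1 * flat 0 (m.+1%:R * s)).
    apply/funext => m; rewrite (flat_pow 1)// mulrA; congr (_ * _).
    by rewrite !powR_inv1 ?ltW// mulrC.
  rewrite -[X in _ --> X](mul0r 1); apply: cvgM => //.
  by rewrite -[X in _ --> X](mulr0 s^-1); apply: cvgM => //; exact: cvg_cst.
split.
  by rewrite -[X in _ --> X](mulr1 1); exact: cvgM.
rewrite /cutoff_derive.
rewrite [X in _ --> X](_ : - a = (- a * 1 + 0) * 1 - 1 * (expR 1 * (s * 0 * flat 2 1))); last by ring.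
apply: cvgB; apply: cvgM.
- by apply: cvgD; [apply: cvgM; [exact: cvg_cst|exact: cm]|exact: c10].
- exact: c0.
- exact: cm.
- apply: cvgM; first exact: cvg_cst.
  apply: cvgM; last exact: cf.
  by apply: cvgM; [exact: cvg_cst|exact: cinv].
Qed.

End truncated_power.

(** * Truncated kernels on R^n *)

Section truncated_kernel.
Context {R : realType} {n : nat}.
Local Notation Rn := 'rV[R]_n.
Local Notation leb := (lebesgue_rV R n).
Variables (r : R) (i : 'I_n).
Hypothesis r0 : 0 < r.
Implicit Types (x z : Rn).

Let a0 : 0 <= r / 2.
Proof. by rewrite divr_ge0// ltW. Qed.

Lemma kernel_dotr p z : kernel p z = dotr z z `^ (- (p / 2)).
Proof.
rewrite /kernel /enorm -powR12_sqrt ?dotr_ge0// -powRrM powRN.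
by congr (_ `^ _)^-1; rewrite mulrC.
Qed.

Lemma is_derive_dotr z : is_derive z (vbase i) (fun z : Rn => dotr z z) (2 * z ord0 i).
Proof.
apply/is_derive_line/is_derive1_caratheodory; exists (fun h => h + 2 * z ord0 i); split.
- move=> h; rewrite subr0 scale0r add0r /dotr.
  rewrite (bigD1 i)//= [X in _ - X](bigD1 i)//= !coord_line eqxx mulr1n.
  rewrite (eq_bigr (fun j => z ord0 j * z ord0 j)); first by ring.
  by move=> j ji; rewrite coord_line (negbTE ji) add0r.
- by apply: cvgD; [exact: cvg_id|exact: cvg_cst].
- by rewrite add0r.
Qed.

Lemma smooth_dotr : smooth (fun z : Rn => dotr z z).
Proof. by move=> k; apply: Ck_sum => j; apply: CkM; exact: smooth_coord0. Qed.

(** Composing with the polynomial |z|^2 instead of |z| preserves smoothness at the origin and halves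
    the exponent. The index m + 1 keeps the truncation parameter positive. *)
Definition trunc_kernel (m : nat) z : R := trunc_pow (r / 2) m.+1%:R (dotr z z).

Definition trunc_kernel_derive (m : nat) z : R :=
  trunc_pow_derive (r / 2) m.+1%:R (dotr z z) * (2 * z ord0 i).

Lemma trunc_kernel_smooth m : smooth (trunc_kernel m).
Proof. by move=> k; apply: Ck_comp; [exact: smooth1_trunc_pow|exact: smooth_dotr]. Qed.

Lemma is_derive_trunc_kernel m z :
  is_derive z (vbase i) (trunc_kernel m) (trunc_kernel_derive m z).
Proof. by apply: is_derive_comp; [exact: is_derive_trunc_pow|exact: is_derive_dotr]. Qed.

Lemma dotr_gt0 z : z != 0 -> 0 < dotr z z.
Proof. by move=> z0; rewrite -enorm_sqr exprn_gt0// enorm_gt0. Qed.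

Lemma kernel0 p : 0 < p -> kernel p (0 : Rn) = 0.
Proof. by move=> p0; rewrite /kernel enorm0 powR0 ?invr0// gt_eqF. Qed.

Lemma trunc_kernelE m z : trunc_kernel m z = kernel r z * cutoff m.+1%:R (dotr z z).
Proof.
have [->|z0] := eqVneq z 0; last by rewrite /trunc_kernel trunc_powE ?dotr_gt0// kernel_dotr.
rewrite kernel0// mul0r /trunc_kernel /trunc_pow -enorm_sqr enorm0 expr0n/= mulr0.
by rewrite (@flat_le0 _ (r / 2) 0)// mulr0 mul0r.
Qed.

Lemma trunc_kernel_deriveE m z : trunc_kernel_derive m z =
  2 * (z ord0 i * kernel (r + 2) z) * cutoff_derive (r / 2) m.+1%:R (dotr z z).
Proof.
have [->|z0] := eqVneq z 0; first by rewrite /trunc_kernel_derive mxE !(mulr0, mul0r).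
rewrite /trunc_kernel_derive trunc_pow_deriveE ?dotr_gt0// kernel_dotr.
rewrite (_ : (r + 2) / 2 = r / 2 + 1); first by ring.
by field.
Qed.

Lemma trunc_kernel_support m z : ~ rV_cube m.+1%:R z ->
  trunc_kernel m z = 0 /\ trunc_kernel_derive m z = 0.
Proof.
move=> /not_rV_cube[j hj].
have [c1 c2] : cutoff m.+1%:R (dotr z z) = 0 /\ cutoff_derive (r / 2) m.+1%:R (dotr z z) = 0.
  apply: cutoff_support => //; rewrite -enorm_sqr.
  have h1 := le_trans (ltW hj) (coord_le_enorm z j).
  have h2 : (1 : R) <= m.+1%:R by rewrite ler1n.
  (* The truncation acts on |z|^2 while the cube bounds z; (m + 1)^2 >= m + 1 bridges the two. *)
  apply: (@le_trans _ _ (m.+1%:R ^+ 2)); first by rewrite ler_eXnr.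
  by rewrite ler_sqr ?nnegrE ?enorm_ge0.
by rewrite trunc_kernelE trunc_kernel_deriveE c1 c2 !mulr0.
Qed.

Lemma trunc_kernel_bound : exists2 C, 0 <= C & forall m z,
  `|trunc_kernel m z| <= C * kernel r z /\ `|trunc_kernel_derive m z| <= C * kernel (r + 1) z.
Proof.
have [C C0 hC] := cutoff_bound a0; exists (2 * C) => [|m z]; first by rewrite mulr_ge0.
have r10 : 0 < r + 1 by rewrite addr_gt0.
have [->|z0] := eqVneq z 0.
  by rewrite trunc_kernelE trunc_kernel_deriveE mxE (kernel0 r0) (kernel0 r10) !(mul0r, mulr0) normr0.
have [//|h1 h2] := hC m.+1%:R (dotr z z) _ (dotr_gt0 z0).
have k0 := kernel_ge0 r z; split.
  rewrite trunc_kernelE normrM (ger0_norm k0) mulrC; apply: ler_wpM2r => //.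
  by apply: (le_trans h1); lra.
rewrite trunc_kernel_deriveE normrM normrM (normrM (z ord0 i)) (@ger0_norm _ 2)//.
rewrite (ger0_norm (kernel_ge0 _ _)).
rewrite -(kernel_decomp z r10) -addrA -!mulrA; apply: ler_wpM2l => //.
rewrite (mulrC C) -!mulrA; apply: ler_pM => //.
- by rewrite mulr_ge0 ?kernel_ge0.
- exact: coord_le_enorm.
- by apply: ler_wpM2l => //; exact: kernel_ge0.
Qed.

Lemma trunc_kernel_cvg z :
  trunc_kernel m z @[m --> \oo] --> kernel r z /\
  trunc_kernel_derive m z @[m --> \oo] --> - r * (z ord0 i * kernel (r + 2) z).
Proof.
have [->|z0] := eqVneq z 0.
  rewrite kernel0// mxE mul0r mulr0; split.
    under eq_fun do rewrite trunc_kernelE kernel0// mul0r.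
    exact: cvg_cst.
  under eq_fun do rewrite trunc_kernel_deriveE mxE !(mul0r, mulr0).
  exact: cvg_cst.
have [h1 h2] := @cutoff_cvg R (r / 2) _ (dotr_gt0 z0); split.
  have -> : (fun m => trunc_kernel m z) = (fun m => kernel r z * cutoff m.+1%:R (dotr z z)).
    by apply/funext => m; rewrite trunc_kernelE.
  by rewrite -[X in _ --> X]mulr1; apply: cvgM; [exact: cvg_cst|exact: h1].
have -> : (fun m => trunc_kernel_derive m z) =
    (fun m => 2 * (z ord0 i * kernel (r + 2) z) * cutoff_derive (r / 2) m.+1%:R (dotr z z)).
  by apply/funext => m; rewrite trunc_kernel_deriveE.
have -> : - r * (z ord0 i * kernel (r + 2) z) = 2 * (z ord0 i * kernel (r + 2) z) * - (r / 2).
  by field.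
by apply: cvgM; [exact: cvg_cst|exact: h2].
Qed.

Lemma trunc_kernel_deriveN m z : trunc_kernel_derive m (- z) = - trunc_kernel_derive m z.
Proof.
rewrite !trunc_kernel_deriveE kernelN mxE (_ : dotr (- z) (- z) = dotr z z); first by ring.
by rewrite -!enorm_sqr enormN.
Qed.

Lemma trunc_kernel_derive_continuous m : continuous (trunc_kernel_derive m).
Proof.
have [C1 C2] := Ck_elim i (trunc_kernel_smooth m 1%N).
rewrite (_ : trunc_kernel_derive m = 'D_(vbase i) (trunc_kernel m)); first exact: Ck_continuous C1.
by apply/funext => z; have [_ ->] := is_derive_trunc_kernel m z.
Qed.

Lemma trunc_kernel_derive_bounded m : exists2 C, 0 <= C & forall z, `|trunc_kernel_derive m z| <= C.
Proof.
have /compact_bounded[B [_ hB]] : compact (trunc_kernel_derive m @` rV_cube m.+1%:R).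
  apply: continuous_compact; last exact: rV_cube_compact.
  by apply: continuous_subspaceT; exact: trunc_kernel_derive_continuous.
exists (`|B| + 1) => [|z]; first by rewrite addr_ge0.
have [zM|zM] := pselect (rV_cube m.+1%:R z).
  apply: (hB (`|B| + 1)); first by apply: le_lt_trans (ler_norm _) _; rewrite ltrDl.
  by exists z.
by rewrite (trunc_kernel_support zM).2 normr0 addr_ge0.
Qed.

Lemma measurable_trunc_kernel_derive m : measurable_fun setT (trunc_kernel_derive m).
Proof. by apply: continuous_rV_measurable; exact: trunc_kernel_derive_continuous. Qed.

Lemma measurable_trunc_kernel m : measurable_fun setT (trunc_kernel m).
Proof.
by apply: continuous_rV_measurable; exact: (Ck_continuous (trunc_kernel_smooth m 0%N)).
Qed.

Lemma trunc_kernel_derive_integrable m : leb.-integrable setT (fun z => (trunc_kernel_derive m z)%:E).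
Proof.
have [C C0 hC] := trunc_kernel_derive_bounded m.
have iM : leb.-integrable setT (EFin \o (\1_(rV_cube m.+1%:R) : Rn -> R)).
  have mM := @measurable_rV_cube R n m.+1%:R.
  apply/integrableP; split; first exact/measurable_EFinP/measurable_indicP.
  under eq_integral do rewrite gee0_abs ?lee_fin//.
  by rewrite integral_indic// setIT; exact: leb_box_fin.
have := @integrable_Mbounded R n _ _ C iM (measurable_trunc_kernel_derive m) hC.
apply: eq_integrable => // z _; congr EFin; rewrite indicE.
have [zM|zM] := pselect (rV_cube m.+1%:R z); first by rewrite mem_set// mul1r.
by rewrite (trunc_kernel_support zM).2 mulr0.
Qed.

(** The integrand is odd and integrable; in the pairing below this permits subtracting the constant
    f(x). *)
Lemma integral_trunc_kernel_derive m : (\int[leb]_z (trunc_kernel_derive m z)%:E = 0)%E.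
Proof.
have iD := trunc_kernel_derive_integrable m.
have mD : measurable_fun setT (fun z => (trunc_kernel_derive m z)%:E) by exact: measurable_int iD.
have := integral_reflect mD; under eq_integral do rewrite trunc_kernel_deriveN EFinN.
rewrite integralN ?integrable_add_def//.
rewrite -(fineK (integrable_fin_num measurableT iD)) -EFinN => -[] h.
by congr EFin; lra.
Qed.

End truncated_kernel.

(** * The fractional gradient as a potential of [Df] *)

Section gradient_representation.
Context {R : realType} {n : nat}.
Local Notation Rn := 'rV[R]_n.
Local Notation leb := (lebesgue_rV R n).
Implicit Types (f : Rn -> R) (i : 'I_n).

(** The kernel is at most its part on the unit cube plus 1. The Lebesgue integral in x of the first
    part is finite and the same for all y, so Tonelli makes it integrable for the product with the
    finite measure [P]; the constant 1 is integrable for [P]. *)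
Lemma kernel_integrable_ae (P : {finite_measure set Rn -> \bar R}) (r : R) : 0 < r < n%:R ->
  \forall x \ae leb, P.-integrable setT (fun y : Rn => (kernel r (y - x))%:E).
Proof.
move=> /[dup] /andP[r0 _] rn; pose k (z : Rn) : R := kernel r z * \1_(rV_cube 1 : set Rn) z.
have mc := @measurable_rV_cube R n 1.
have mk : measurable_fun setT k.
  by apply: measurable_funM; [exact: measurable_kernel|exact/measurable_indicP].
have k0 z : 0 <= k z by rewrite mulr_ge0 ?kernel_ge0.
have kfin : (\int[leb]_z (k z)%:E < +oo)%E.
  have := kernel_int_near rn; rewrite integral_mkcond; apply: le_lt_trans.
  rewrite le_eqVlt; apply/orP; left; apply/eqP; apply: eq_integral => z _.
  by rewrite patchE /k indicE; case: (_ \in _); rewrite ?mulr1 ?mulr0.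
have mkk : measurable_fun setT (fun p : Rn * Rn => (k (p.2 - p.1))%:E).
  apply/measurable_EFinP; apply: measurableT_comp => //.
  have mN : measurable_fun setT (fun p : Rn * Rn => - p.1).
    by apply: (@measurableT_comp _ _ _ _ _ _ (fun x : Rn => - x) _ fst) => //; exact: measurable_rVN.
  exact: measurable_rVDV measurable_snd mN.
have kk0 (p : Rn * Rn) : (0 <= (k (p.2 - p.1))%:E)%E by rewrite lee_fin.
have ik : (leb \x P)%E.-integrable setT (fun p : Rn * Rn => (k (p.2 - p.1))%:E).
  apply/(@integrable12ltyP _ _ _ _ R leb P _ mkk).
  under eq_integral do under eq_integral do rewrite gee0_abs//.
  rewrite -[ltLHS](@fubini_tonelli1 _ _ _ _ R leb P _ mkk kk0) (@fubini_tonelli2 _ _ _ _ R leb P _ mkk kk0).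
  rewrite /fubini_G /=.
  have kE y : (\int[leb]_x (k (y - x))%:E = \int[leb]_z (k z)%:E)%E.
    have mkN : measurable_fun setT (fun z : Rn => (k (- z))%:E).
      by apply/measurable_EFinP; apply: measurableT_comp => //; exact: measurable_rVN.
    rewrite -(@ge0_integral_reflect R n (fun z => (k z)%:E)); last 2 first.
    - exact/measurable_EFinP.
    - by move=> z; rewrite lee_fin.
    rewrite -(@ge0_integral_shift R n (- y) (fun z => (k (- z))%:E))//; last first.
      by move=> z; rewrite lee_fin.
    by apply: eq_integral => z _; rewrite opprD opprK addrC.
  under eq_integral do rewrite kE.
  rewrite integral_cst//; apply: lte_mul_pinfty => //.
  - by apply: integral_ge0 => z _; rewrite lee_fin.
  - by rewrite ge0_fin_numE//; apply: integral_ge0 => z _; rewrite lee_fin.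
  - by rewrite ltey_eq fin_num_measure.
have := ae_integrable1 ik; apply: filterS => x /= ix.
have i1 : P.-integrable setT (EFin \o (cst 1 : Rn -> R)).
  by apply: (@finite_measure_integrable _ _ _ P _ `|1|) => //.
have := integrableD measurableT ix i1; apply: le_integrable => //.
  apply/measurable_EFinP.
  by apply: (@measurable_kernel2 R n r _ _ (fun y : Rn => y - x)); exact: measurable_rVD.
move=> y _; rewrite /= lee_fin !ger0_norm ?kernel_ge0 ?addr_ge0//.
rewrite /k indicE; have [yc|yc] := pselect (rV_cube 1 (y - x)).
  by rewrite mem_set// mulr1 lerDl.
rewrite memNset// mulr0 add0r; have [j hj] := not_rV_cube yc.
have := kernel_le (ltW r0) ltr01 (le_trans (ltW hj) (coord_le_enorm (y - x) j)).
by rewrite powR1.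
Qed.

Lemma gradient_measure_pairing f (D : vector_measure R n) i (u : Rn -> R) (d : Rn -> R) (M : R) :
  is_gradient_measure f D -> smooth u -> (forall x, ~ rV_cube M x -> u x = 0) ->
  (forall x, is_derive x (vbase i) u (d x)) ->
  (\int[leb]_x (f x * d x)%:E = - charge_integral (D i) (EFin \o u))%E.
Proof.
move=> fD su uM ud; rewrite -charge_integral_basis -fD; last exact: Cinfty_c_scale uM.
apply: eq_integral => x _; congr (f x * _)%:E; apply/esym.
by apply: divergence_scale => // j; have [_ /(_ x)[]] := Ck_elim j (su 1%N).
Qed.

Variable alpha : R.
Hypotheses (n0 : (0 < n)%N) (alpha01 : 0 < alpha < 1).
Local Notation q := (n%:R + alpha).

Let r0 : 0 < q - 1.
Proof.
have n1 : (1 : R) <= n%:R by rewrite ler1n.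
by case/andP: alpha01 => ? _; lra.
Qed.

(** The field is y -> G(y - x) e_i with G the truncated kernel. Since the derivative of G has
    integral zero, f(x + z) may be replaced by f(x + z) - f(x). *)
Lemma trunc_kernel_pairing f (D : vector_measure R n) i x (m : nat) : in_L1 f ->
  is_gradient_measure f D ->
  (\int[leb]_z ((f (x + z)%R - f x) * trunc_kernel_derive (q - 1) i m z)%:E =
   - charge_integral (D i) (fun y : Rn => (trunc_kernel (q - 1) m (y - x))%:E))%E.
Proof.
move=> fi fD; set G := trunc_kernel _ m; set G' := trunc_kernel_derive _ i m.
have mf : measurable_fun setT f by exact: in_L1_measurable.
have mG' : measurable_fun setT G' by exact: measurable_trunc_kernel_derive.
have [C C0 hC] := trunc_kernel_derive_bounded i r0 m.
transitivity (\int[leb]_y (f y * G' (y - x))%:E)%E; last first.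
  apply: (@gradient_measure_pairing f D i (fun y : Rn => G (y - x)) _ (m.+1%:R + `|x|) fD).
  - by apply: smooth_shift; exact: trunc_kernel_smooth.
  - move=> y yM; have [] // := @trunc_kernel_support R n (q - 1) i r0 m (y - x).
    apply: contra_not yM => /rV_cubeP h; apply/rV_cubeP => j.
    have := h j; rewrite !mxE => hj; rewrite -[y _ _](subrK (x ord0 j)).
    by apply: (le_trans (ler_normD _ _)); apply: lerD => //; exact: coord_le_norm.
  - by move=> y; apply: is_derive_shiftV; exact: is_derive_trunc_kernel.
rewrite -(@integral_shift R n x (fun y : Rn => (f y * G' (y - x))%:E)); last first.
  apply/measurable_EFinP; apply: measurable_funM => //.
  by apply: measurableT_comp => //; exact: measurable_rVD.
have I1 := integrable_Mbounded (in_L1_shift x fi) mG' hC.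
have I2 := integrableZl measurableT (f x) (trunc_kernel_derive_integrable i r0 m).
transitivity (\int[leb]_z ((f (z + x) * G' z)%:E - (f x)%:E * (G' z)%:E))%E.
  by apply: eq_integral => z _; rewrite -EFinM -EFinB (addrC x) mulrBl.
rewrite integralB// integralZl//; last exact: trunc_kernel_derive_integrable.
rewrite integral_trunc_kernel_derive// mule0 sube0.
by apply: eq_integral => z _; rewrite addrK.
Qed.

(** Limit of [trunc_kernel_pairing]: one side is dominated by C |f(x + z) - f(x)| K_q(z), the other,
    for each Jordan part, by C K_(q-1)(y - x). The factor q - 1 is the exponent brought down by
    differentiation. *)
Lemma riesz_int_charge f (D : vector_measure R n) i x (P N : {finite_measure set Rn -> \bar R}) :
  in_L1 f -> is_gradient_measure f D ->
  (forall g, charge_integral (D i) g = \int[P]_y g y - \int[N]_y g y)%E ->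
  P.-integrable setT (fun y : Rn => (kernel (q - 1) (y - x))%:E) ->
  N.-integrable setT (fun y : Rn => (kernel (q - 1) (y - x))%:E) ->
  leb.-integrable setT (fun z => (`|f (x + z)%R - f x| * kernel q z)%:E) ->
  (((q - 1) * riesz_int alpha i f x)%:E =
   charge_integral (D i) (fun y : Rn => (kernel (q - 1) (y - x))%:E))%E.
Proof.
move=> fi fD PN iP iN iK; set r := q - 1.
have mf : measurable_fun setT f by exact: in_L1_measurable.
have [C C0 hC] := @trunc_kernel_bound R n r i r0.
have q1 : r + 1 = q by rewrite subrK.
have q2 : r + 2 = q + 1 by rewrite /r; ring.
have mfx : measurable_fun setT (fun z => f (x + z) - f x).
  exact: (measurableT_comp (measurable_shift_diff2 mf) (measurable_pair1 x)).
have iR : leb.-integrable setT (fun z => (riesz_diff alpha i f (x, z))%:E).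
  apply: le_integrable iK => //.
    apply/measurable_EFinP.
    by have := measurable_riesz_diff alpha i mf => /measurableT_comp; apply.
  move=> z _; rewrite lee_fin [leRHS]ger0_norm ?mulr_ge0 ?kernel_ge0//.
  exact: (riesz_diff_le alpha01 i f (x, z)).
pose F m z := ((f (x + z) - f x) * trunc_kernel_derive r i m z)%:E.
pose Finf z := ((f (x + z) - f x) * (- r * (z ord0 i * kernel (r + 2) z)))%:E.
have mFm m : measurable_fun setT (F m).
  by apply/measurable_EFinP; apply: measurable_funM => //; exact: measurable_trunc_kernel_derive.
have mFinf : measurable_fun setT Finf.
  apply/measurable_EFinP; apply: measurable_funM => //; apply: measurable_funM => //.
  by apply: measurable_funM; [exact: measurable_rV_coord|exact: measurable_kernel].
have iCK := integrableZl measurableT C iK.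
have [||_ _ limF] := @dominated_convergence _ _ _ leb setT measurableT F Finf _ mFm mFinf _ iCK.
- apply/aeW => z _; apply/fine_cvgP; split; first exact: nearW.
  by apply: cvgM; [exact: cvg_cst|exact: (trunc_kernel_cvg i r0 z).2].
- apply/aeW => z m _; rewrite /F -EFinM abse_EFin lee_fin normrM mulrCA.
  by apply: ler_wpM2l => //; rewrite -q1; exact: (hC m z).2.
have limP (Q : {finite_measure set Rn -> \bar R}) :
    Q.-integrable setT (fun y : Rn => (kernel r (y - x))%:E) ->
    ((\int[Q]_y (trunc_kernel r m (y - x))%:E) @[m --> \oo] --> \int[Q]_y (kernel r (y - x))%:E)%E.
  move=> iQ; have iCQ := integrableZl measurableT C iQ.
  have mk : measurable_fun setT (fun y : Rn => (kernel r (y - x))%:E) by exact: measurable_int iQ.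
  have mG m : measurable_fun setT (fun y : Rn => (trunc_kernel r m (y - x))%:E).
    apply/measurable_EFinP; apply: (@measurableT_comp _ _ _ _ _ _ (trunc_kernel r m) _ (fun y : Rn => y - x)).
      exact: measurable_trunc_kernel.
    exact: measurable_rVD.
  have [||_ _ //] := @dominated_convergence _ _ _ Q setT measurableT _ _ _ mG mk _ iCQ.
  - apply/aeW => y _; apply/fine_cvgP; split; first exact: nearW.
    exact: (trunc_kernel_cvg i r0 (y - x)).1.
  - by apply/aeW => y m _; rewrite -EFinM abse_EFin lee_fin; exact: (hC m (y - x)).1.
have finP := integrable_fin_num measurableT iP.
have finN := integrable_fin_num measurableT iN.
have limPN : ((\int[P]_y (trunc_kernel r m (y - x))%:E - \int[N]_y (trunc_kernel r m (y - x))%:E)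
    @[m --> \oo] --> \int[P]_y (kernel r (y - x))%:E - \int[N]_y (kernel r (y - x))%:E)%E.
  by apply: cvgeB; [rewrite fin_num_adde_defr|exact: limP|exact: limP].
have limF' : ((- \int[leb]_z F m z) @[m --> \oo] --> - \int[leb]_z Finf z)%E by exact: cvgeN.
have E m : ((- \int[leb]_z F m z) = \int[P]_y (trunc_kernel r m (y - x))%:E - \int[N]_y (trunc_kernel r m (y - x))%:E)%E.
  by rewrite /F (trunc_kernel_pairing i x m fi fD) oppeK PN.
rewrite (eq_cvg _ _ E) in limF'.
rewrite PN; have <- := cvg_unique (@ereal_hausdorff R) limF' limPN.
rewrite /Finf (eq_integral (fun z => (- r)%:E * (riesz_diff alpha i f (x, z))%:E)%E); last first.
  by move=> z _; rewrite q2 -EFinM /riesz_diff /riesz /=; congr EFin; ring.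
rewrite integralZl// /riesz_int /Rintegral EFinM fineK ?integrable_fin_num//.
by rewrite EFinN mulNe oppeK.
Qed.

Lemma frac_grad_charge f (D : vector_measure R n) : in_W alpha f ->
  is_gradient_measure f D -> \forall x \ae leb, forall i,
    ((frac_grad alpha f x ord0 i)%:E = (frac_const n alpha / (q - 1))%:E *
      charge_integral (D i) (fun y : Rn => (kernel (q - 1) (y - x))%:E))%E.
Proof.
move=> fW fD; have [fi _] := fW.
have mf : measurable_fun setT f by exact: in_L1_measurable.
have rn : 0 < q - 1 < n%:R by rewrite r0/=; case/andP: alpha01 => _ a1; lra.
apply: filter_forall => i; have [P [N [_ PN _]]] := charge_integral_decomp (D i).
have h := ae_integrable1 (in_W_integrable_diff fW).
(* Three null sets for each coordinate: one for the potential of each Jordan part and one for the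
   increments of [f]. There are finitely many coordinates, so a common null set exists. *)
apply: filterS3 (kernel_integrable_ae P rn) (kernel_integrable_ae N rn) h => x iP iN ix.
rewrite -(riesz_int_charge fi fD PN iP iN ix) (frac_gradE alpha x i mf) -EFinM.
by congr EFin; field; rewrite gt_eqF.
Qed.

End gradient_representation.
Unset Implicit Arguments.

Theorem theorem3p18 (R : realType) (n : nat) (alpha : R)
    (n_ge1 : (1 <= n)%N) (alpha01 : 0 < alpha < 1) :
  (forall f : 'rV[R]_n -> R, in_W alpha f ->
    [/\ in_BValpha alpha f,
        (frac_variation alpha f <= (frac_const n alpha)%:E * W_seminorm alpha f)%E,
        (forall phi : 'rV[R]_n -> 'rV[R]_n, Lip_c phi ->
          (\int[lebesgue_rV R n]_x (f x * frac_div alpha phi x)%:E =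
           - \int[lebesgue_rV R n]_x (dotr (phi x) (frac_grad alpha f x))%:E)%E),
        (forall i : 'I_n, (lebesgue_rV R n).-integrable setT
          (fun x => (frac_grad alpha f x ord0 i)%:E)) &
        (forall D : vector_measure R n,
          is_frac_gradient_measure alpha f D <->
          (forall (i : 'I_n) (A : set 'rV[R]_n), measurable A ->
            D i A = (\int[lebesgue_rV R n]_(x in A) (frac_grad alpha f x ord0 i)%:E)%E))])
  /\
  (exists2 c : R, 0 < c &
    forall f : 'rV[R]_n -> R, in_BV f ->
      [/\ in_W alpha f,
          (W_norm alpha f <= c%:E * BV_norm f)%E &
          (forall Df : vector_measure R n, is_gradient_measure f Df ->
            \forall x \ae lebesgue_rV R n, forall i : 'I_n,
              (frac_grad alpha f x ord0 i)%:E =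
              ((frac_const n alpha / (n%:R + alpha - 1))%:E *
               charge_integral (Df i)
                 (fun y => ((enorm (y - x) `^ (n%:R + alpha - 1))^-1)%:E))%E)]).
Proof.
split=> [f fW|].
  split.
  - split; first by have [] := fW.
    apply: le_lt_trans (frac_variation_le n_ge1 alpha01 fW) _.
    by apply: lte_mul_pinfty => //; [rewrite lee_fin frac_const_ge0|have [] := fW].
  - exact: frac_variation_le.
  - by move=> phi; exact: frac_parts.
  - by move=> i; exact: frac_grad_integrable.
  - by move=> D; exact: frac_gradient_measureP.
have [c c0 hc] := bv_W_bound n_ge1 alpha01; exists c => // f fBV.
have [fW fc] := hc f fBV; split => // Df fDf.
exact: frac_grad_charge.
Qed.
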